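(* Let $N\ge 2$ and let $\Omega\subset\mathbb{R}^N$ be a smooth bounded domain. Let $p$ and $s$ be continuous symmetric functions on $\overline\Omega\times\overline\Omega$ with $0<s^-\le s(x,y)\le s^+<1$ and $s(x,y)p(x,y)<N$ for all $(x,y)\in\overline\Omega\times\overline\Omega$, let $\alpha,q\in C(\overline\Omega)$ with $p(x,x)\le q(x)<p_s^*(x)$ for all $x\in\overline\Omega$, and let $r^+$ be a real number, such that $$2<\alpha^-\le\alpha(x)\le\alpha^+<p^-\le p(x,y)\le p^+<q^+<r^+<(r^+)^2<p_s^*(x)$$ and $\alpha(x)\le p(x,x)$ for all $x,y\in\overline\Omega$. Then there exists $\delta_0>0$, depending only on $N,\Omega,s,p,q,\alpha,r^+$, with the following property. Let $f\in C^1(\Omega\times\mathbb{R},\mathbb{R})$ have primitive $F(x,u)=\int_0^u f(x,\sigma)\,d\sigma$ and satisfy: (i) $f(x,0)=0$ and $f(x,tu)=t^{r^+-1}f(x,u)$ for all $(x,u)\in\Omega\times\mathbb{R}$ and $t>0$; (ii) $F:\overline\Omega\times\mathbb{R}\to\mathbb{R}$ is (positively) homogeneous of degree $r^+$ in $u$; (iii) $\left|\frac{\partial f}{\partial \sigma}(x,\sigma)\right|\le\delta|\sigma|^{r^+-2}$ for all $x\in\Omega$, $\sigma\in\mathbb{R}$, for some $0<\delta\le\delta_0$; (iv) $\lim_{\sigma\to\infty}\frac{f(x,\sigma)}{\sigma^{r^+-1}}=0$ uniformly for a.e. $x\in\Omega$. Then there exist $\lambda_*>0$ and $\beta_*>0$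 such that for all $\lambda\in(0,\lambda_* )$ and $\beta\in(0,\beta_* )$ the problem $$-\Delta_{p(x,y)}^{s(x,y)}u=\beta|u|^{\alpha(x)-2}u+\lambda f(x,u)\ \text{ in }\Omega,\qquad u=0\ \text{ in }\mathbb{R}^N\setminus\Omega$$ admits two distinct nontrivial weak solutions belonging to the Nehari manifold $\mathcal{N}$. Moreover, these solutions are in $L^\infty(\Omega)$.
   Context: For a bounded function $h$, $h^-$ and $h^+$ denote its infimum and supremum over its domain ($\overline\Omega$ or $\overline\Omega\times\overline\Omega$); $r^+$ is just a constant. The critical exponent is $p_s^*(x)=\frac{Np(x,x)}{N-s(x,x)p(x,x)}$. In integrals over $\mathbb{R}^N\times\mathbb{R}^N$, $p$ and $s$ are understood as extended to continuous symmetric functions on $\mathbb{R}^N\times\mathbb{R}^N$ with the same bounds $p^\pm$, $s^\pm$. Space: with $T=\mathbb{R}^{2N}\setminus(\Omega^c\times\Omega^c)$, $X$ is the set of $u:\mathbb{R}^N\to\mathbb{R}$ with $u|_\Omega\in L^{q(x)}(\Omega)$ and $\int_T\frac{|u(x)-u(y)|^{p(x,y)}}{\theta^{p(x,y)}|x-y|^{N+s(x,y)p(x,y)}}\,dx\,dy<\infty$ for some $\theta>0$, and $X_0=\{u\in X: u=0\text{ a.e. in }\mathbb{R}^N\setminus\Omega\}$ (also written $W_0^{s(x,y),p(x,y)}(\overline\Omega)$), normed by $$\|u\|=\inf\Big\{\theta>0:\int_{\mathbb{R}^N}\int_{\mathbb{R}^N}\frac{|u(x)-u(y)|^{p(x,y)}}{\theta^{p(x,y)}|x-y|^{N+s(x,y)p(x,y)}}\,dx\,dy<1\Big\}.$$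 Weak solution: $u\in X_0$ is a weak solution of the problem if for all $v\in X_0$ $$\int_{\mathbb{R}^N}\int_{\mathbb{R}^N}\frac{|u(x)-u(y)|^{p(x,y)-2}(u(x)-u(y))(v(x)-v(y))}{|x-y|^{N+s(x,y)p(x,y)}}\,dx\,dy=\beta\int_\Omega|u|^{\alpha(x)-2}uv\,dx+\lambda\int_\Omega f(x,u)v\,dx .$$ Energy functional on $X_0$: $$I_{\lambda,\beta}(u)=\int_{\mathbb{R}^N}\int_{\mathbb{R}^N}\frac{|u(x)-u(y)|^{p(x,y)}}{p(x,y)|x-y|^{N+s(x,y)p(x,y)}}\,dx\,dy-\beta\int_\Omega\frac{|u|^{\alpha(x)}}{\alpha(x)}\,dx-\lambda\int_\Omega F(x,u)\,dx .$$ Nehari manifold: $\mathcal{N}=\{u\in X_0\setminus\{0\}:\langle I_{\lambda,\beta}'(u),u\rangle=0\}$. *)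

(* Defs.v *)
From HB Require Import structures.
From mathcomp Require Import all_boot all_order all_algebra.
From mathcomp Require Import all_classical all_reals all_analysis.

Set Implicit Arguments.
Unset Strict Implicit.
Unset Printing Implicit Defensive.

Import Order.TTheory GRing.Theory Num.Theory.
Import numFieldTopology.Exports numFieldNormedType.Exports.

Local Open Scope classical_set_scope.
Local Open Scope ring_scope.

Section rV_measurable.
Context {R : realType} {n : nat}.

(* The sigma-algebra generated by the coordinates, i.e. the Borel one. *)
Definition rV_coord (i : 'I_n) (x : 'rV[R]_n) : R := x ord0 i.

Let rV_set0 : g_sigma_preimage rV_coord set0.
Proof. exact: sigma_algebra0. Qed.

Let rV_setC A : g_sigma_preimage rV_coord A -> g_sigma_preimage rV_coord (~` A).
Proof. exact: sigma_algebraC. Qed.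

Let rV_bigcup (F : (set 'rV[R]_n)^nat) :
  (forall i, g_sigma_preimage rV_coord (F i)) ->
  g_sigma_preimage rV_coord (\bigcup_i (F i)).
Proof. exact: sigma_algebra_bigcup. Qed.

HB.instance Definition _ := @isMeasurable.Build default_measure_display
  'rV[R]_n (g_sigma_preimage rV_coord) rV_set0 rV_setC rV_bigcup.

End rV_measurable.

Section rV_measurable_theory.
Context {R : realType}.

Lemma measurable_rV_coord n (i : 'I_n) :
  measurable_fun [set: 'rV[R]_n] (rV_coord i).
Proof.
move=> _ Y mY; rewrite setTI; apply: sub_sigma_algebra => /=.
rewrite -bigcup_seq/=; exists i => /=; first by rewrite mem_index_enum.
by exists Y => //; rewrite setTI.
Qed.

Lemma measurable_fun_rVP d (T : measurableType d) n (f : T -> 'rV[R]_n) :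
  (forall i, measurable_fun [set: T] (rV_coord i \o f)) ->
  measurable_fun [set: T] f.
Proof.
move=> mf.
have : g_sigma_preimage (fun i => rV_coord i \o f) `<=` measurable.
  apply: smallest_sub; first exact: sigma_algebra_measurable.
  rewrite -bigcup_seq; apply: bigcup_sub => i _.
  by move=> A [B mB <-]; exact: mf.
rewrite g_sigma_preimage_comp => sub _ A mA.
by apply: sub; exists A.
Qed.

Definition rV_cons n (z : measurableTypeR R * 'rV[R]_n) : 'rV[R]_n.+1 :=
  \row_i oapp (fun j => z.2 ord0 j) z.1 (unlift ord0 i).

Lemma rV_coord_cons0 n z : rV_coord ord0 (@rV_cons n z) = z.1.
Proof. by rewrite /rV_coord mxE unlift_none. Qed.

Lemma rV_coord_consS n z i :
  rV_coord (lift ord0 i) (@rV_cons n z) = rV_coord i z.2.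
Proof. by rewrite /rV_coord mxE liftK. Qed.

Lemma measurable_rV_cons n : measurable_fun setT (@rV_cons n).
Proof.
apply: measurable_fun_rVP => i.
have [j ->|->] := unliftP ord0 i.
  rewrite (_ : _ \o _ = rV_coord j \o snd); last first.
    by apply/funext => z /=; rewrite rV_coord_consS.
  by apply: measurableT_comp; [exact: measurable_rV_coord|exact: measurable_snd].
rewrite (_ : _ \o _ = fst); first exact: measurable_fst.
by apply/funext => z /=; rewrite rV_coord_cons0.
Qed.

Definition rV_uncons n (x : 'rV[R]_n.+1) : measurableTypeR R * 'rV[R]_n :=
  (x ord0 ord0, \row_i x ord0 (lift ord0 i)).

Lemma rV_consK n : cancel (@rV_cons n) (@rV_uncons n).
Proof.
move=> [a x]; congr pair => /=; first exact: (rV_coord_cons0 (a, x)).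
by apply/rowP => i; rewrite mxE; exact: (rV_coord_consS (a, x)).
Qed.

Lemma rV_unconsK n : cancel (@rV_uncons n) (@rV_cons n).
Proof.
move=> x; apply/rowP => i.
have [j ->|->] := unliftP ord0 i; rewrite mxE ?unlift_none//.
by rewrite liftK /= mxE.
Qed.

Lemma measurable_rV_uncons n : measurable_fun setT (@rV_uncons n).
Proof.
apply/measurable_fun_pairP; split.
  exact: (@measurable_rV_coord n.+1 ord0).
apply: measurable_fun_rVP => i.
rewrite (_ : _ \o _ = @rV_coord R n.+1 (lift ord0 i)).
  exact: measurable_rV_coord.
by apply/funext => x; rewrite /rV_coord/= mxE.
Qed.

Section rV_push.
Local Open Scope ereal_scope.
Context n (m : {sigma_finite_measure set 'rV[R]_n -> \bar R}).

Definition rV_push : set 'rV[R]_n.+1 -> \bar R :=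
  pushforward (lebesgue_measure \x m) (@rV_cons n).

Let mrV_cons (A : set 'rV[R]_n.+1) :
  measurable A -> measurable (@rV_cons n @^-1` A).
Proof. by move=> mA; rewrite -[X in measurable X]setTI; exact: measurable_rV_cons. Qed.

Let rV_push0 : rV_push set0 = 0.
Proof. by rewrite /rV_push /pushforward preimage_set0 measure0. Qed.

Let rV_push_ge0 A : 0 <= rV_push A.
Proof. exact: (measure_ge0 (lebesgue_measure \x m)). Qed.

Let rV_push_sigma_additive : semi_sigma_additive rV_push.
Proof.
move=> F mF tF mUF; rewrite /rV_push /pushforward preimage_bigcup.
apply: (@measure_semi_sigma_additive _ _ _ (lebesgue_measure \x m)).
- by move=> k; exact: mrV_cons.
- apply/trivIsetP => /= i j _ _ ij; rewrite -preimage_setI.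
  by move/trivIsetP : tF => /(_ _ _ _ _ ij) ->//; rewrite preimage_set0.
- by rewrite -preimage_bigcup; exact: mrV_cons.
Qed.

HB.instance Definition _ := isMeasure.Build _ _ _ rV_push
  rV_push0 rV_push_ge0 rV_push_sigma_additive.

Let rV_push_sigma_finite : sigma_finite setT rV_push.
Proof.
have /sigma_finiteP[F [TF ndF Foo]] := sigma_finiteT (@lebesgue_measure R).
have /sigma_finiteP[G [TG ndG Goo]] := sigma_finiteT m.
exists (fun k => @rV_uncons n @^-1` (F k `*` G k)) => [|k].
  rewrite -preimage_bigcup; apply/esym/seteqP; split => // x _.
  have [i _ Fi] : (\bigcup_i F i) (rV_uncons x).1 by rewrite -TF.
  have [j _ Gj] : (\bigcup_i G i) (rV_uncons x).2 by rewrite -TG.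
  exists (maxn i j) => //; split.
  - by move: Fi; exact/subsetPset/ndF/leq_maxl.
  - by move: Gj; exact/subsetPset/ndG/leq_maxr.
have [? ?] := Foo k; have [? ?] := Goo k.
split.
  rewrite -[X in measurable X]setTI; apply: measurable_rV_uncons => //.
  exact: measurableX.
rewrite /rV_push /pushforward -comp_preimage (_ : _ \o _ = id); last first.
  by apply/funext => z /=; rewrite rV_consK.
rewrite preimage_id product_measure1E// lte_mul_pinfty// ge0_fin_numE//.
Qed.

HB.instance Definition _ := Measure_isSigmaFinite.Build _ _ _ rV_push
  rV_push_sigma_finite.

End rV_push.

Fixpoint lebesgue_rV n : {sigma_finite_measure set 'rV[R]_n -> \bar R} :=
  match n with
  | 0 => \d_(0 : 'rV[R]_0)
  | n'.+1 => rV_push (lebesgue_rV n')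
  end.

Definition rV_box {n} (a b : 'rV[R]_n) : set 'rV[R]_n :=
  [set x | forall i, a ord0 i <= x ord0 i <= b ord0 i].

(* This characterizes lebesgue_rV among the Borel measures. *)
Lemma lebesgue_rV_box n (a b : 'rV[R]_n) :
  (forall i, a ord0 i <= b ord0 i) ->
  lebesgue_rV n (rV_box a b) = (\prod_i (b ord0 i - a ord0 i))%:E.
Proof.
elim: n a b => [|n IHn] a b ab.
  rewrite big_ord0 /= diracE mem_set//.
  by case.
rewrite big_ord_recl.
pose a' := (rV_uncons a).2; pose b' := (rV_uncons b).2.
have boxE : @rV_cons n @^-1` rV_box a b
    = (`[a ord0 ord0, b ord0 ord0]%classic : set (measurableTypeR R)) `*`
      rV_box a' b'.
  apply/seteqP; split=> [z /= abz|z /= [z1 z2] i].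
    split=> [|i]; first by rewrite in_itv/= -(rV_coord_cons0 z); exact: abz.
    rewrite /a' /b' /= !mxE -[z.2 _ _]/(rV_coord i z.2) -rV_coord_consS.
    exact: abz.
  have [j ->|->] := unliftP ord0 i.
    rewrite -[rV_cons z _ _]/(rV_coord _ _) rV_coord_consS.
    by have := z2 j; rewrite /a' /b' /= !mxE.
  rewrite -[rV_cons z _ _]/(rV_coord _ _) rV_coord_cons0.
  by move: z1; rewrite in_itv.
rewrite -[LHS]/((lebesgue_measure \x lebesgue_rV n)%E
  (@rV_cons n @^-1` rV_box a b)) boxE.
rewrite product_measure1E; last 2 first.
- exact: measurable_itv.
- rewrite (_ : rV_box _ _ = \bigcap_(i in [set: 'I_n])
    (rV_coord i @^-1` `[a' ord0 i, b' ord0 i]%classic)); last first.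
    apply/seteqP; split=> [x abx i _ /=|x abx i].
      by rewrite in_itv /=; exact: abx.
    by have := abx i I; rewrite /= in_itv.
  apply: fin_bigcap_measurable => // i _; rewrite -[X in measurable X]setTI.
  exact: measurable_rV_coord.
rewrite IHn => [|i]; last by rewrite /a' /b' /= !mxE.
have itvE := @lebesgue_measure_itv R `[a ord0 ord0, b ord0 ord0].
transitivity ((if (a ord0 ord0 < b ord0 ord0)%R then
    (b ord0 ord0 - a ord0 ord0)%:E else 0) *
    (\prod_i (b' ord0 i - a' ord0 i))%:E)%E.
  by congr (_ * _)%E; rewrite /= lte_fin in itvE; exact: itvE.
rewrite (eq_bigr (fun i => b ord0 (lift ord0 i) - a ord0 (lift ord0 i))); last first.
  by move=> i _; rewrite /a' /b' /= !mxE.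
case: ltP => [_|ba]; first by rewrite -EFinM.
have -> : b ord0 ord0 = a ord0 ord0 by apply/le_anti; rewrite ba ab.
by rewrite subrr mul0r mul0e.
Qed.

End rV_measurable_theory.

(* Meant for U open; 'D_v g is the derivative in the direction v. *)
Fixpoint Ck_on {R : realType} {V : normedModType R} (U : set V) (k : nat)
    (g : V -> R^o) : Prop :=
  match k with
  | 0 => forall x, U x -> {for x, continuous g}
  | k'.+1 => (forall x, U x -> differentiable g x) /\
             forall v : V, Ck_on U k' ('D_v g)
  end.

Definition smooth {R : realType} {V : normedModType R} (g : V -> R^o) : Prop :=
  forall k, Ck_on setT k g.

(* Near each boundary point, up to relabelling and reorienting the axes, Omega
   is the region above the graph of a smooth function of the other N - 1
   coordinates. The ball is a cube, which is immaterial as r may shrink. *)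
Definition smooth_boundary {R : realType} {N : nat} (Omega : set 'rV[R]_N) :=
  forall x0, (closure Omega `\` interior Omega) x0 ->
  exists (r : R) (i : 'I_N) (b : bool) (g : 'rV[R]_N.-1 -> R),
    [/\ 0 < r, smooth g &
        forall x, ball x0 r x ->
          (Omega x <-> g (col' i x) < (-1) ^+ b * x ord0 i)].

Definition smooth_bounded_domain {R : realType} {N : nat}
    (Omega : set 'rV[R]_N) : Prop :=
  [/\ Omega !=set0, open Omega, connected Omega, bounded_set Omega &
      smooth_boundary Omega].

Definition inf2 {T : Type} {R : realType} (A : set T) (h : T -> T -> R) : R :=
  inf [set h x y | x in A & y in A].

Definition sup2 {T : Type} {R : realType} (A : set T) (h : T -> T -> R) : R :=
  sup [set h x y | x in A & y in A].

Definition crit_exp {R : realType} {N : nat} (p s : 'rV[R]_N -> 'rV[R]_N -> R)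
    (x : 'rV[R]_N) : R :=
  N%:R * p x x / (N%:R - s x x * p x x).

(* The library norm on 'rV[R]_N is the sup norm. *)
Definition edist {R : realType} {N : nat} (x y : 'rV[R]_N) : R :=
  Num.sqrt (\sum_i (x ord0 i - y ord0 i) ^+ 2).

Definition oriented_integral {R : realType} (a b : R) (g : R -> R) : R :=
  if a <= b then \int[lebesgue_measure]_(x in `[a, b]) g x
  else - \int[lebesgue_measure]_(x in `[b, a]) g x.

Section FractionalSpace.
Context {R : realType} {N : nat}.
Local Notation RN := 'rV[R]_N.
Local Notation leb := (lebesgue_rV N : {sigma_finite_measure set RN -> \bar R}).
Local Notation leb2 := (leb \x leb)%E.

Implicit Types (Omega : set RN) (p s : RN -> RN -> R) (q alpha : RN -> R)
  (u v : RN -> R) (f F : RN -> R -> R).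

Definition kernel p s (z : RN * RN) : R :=
  edist z.1 z.2 `^ (N%:R + s z.1 z.2 * p z.1 z.2).

Definition gagliardo p s u (theta : R) (z : RN * RN) : R :=
  `|u z.1 - u z.2| `^ p z.1 z.2 / (theta `^ p z.1 z.2 * kernel p s z).

Definition Lvar_exp Omega q u : Prop :=
  exists2 theta : R, 0 < theta &
    (\int[leb]_(x in Omega) ((`|u x| / theta) `^ q x)%:E < +oo)%E.

(* Functions are Borel measurable representatives: each class of Lebesgue
   measurable functions modulo a.e. equality contains one. *)
Definition in_X Omega p s q u : Prop :=
  [/\ measurable_fun setT u, Lvar_exp Omega q u &
      exists2 theta : R, 0 < theta &
        (\int[leb2]_(z in ~` (~` Omega `*` ~` Omega))
           (gagliardo p s u theta z)%:E < +oo)%E].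

Definition in_X0 Omega p s q u : Prop :=
  in_X Omega p s q u /\ {ae leb, forall x, ~ Omega x -> u x = 0}.

Definition X0norm p s u : R :=
  inf [set theta : R | 0 < theta /\
    (\int[leb2]_z (gagliardo p s u theta z)%:E < 1)%E].

Definition weak_lhs p s u v (z : RN * RN) : R :=
  `|u z.1 - u z.2| `^ (p z.1 z.2 - 2) * (u z.1 - u z.2) * (v z.1 - v z.2)
    / kernel p s z.

Definition weak_solution Omega p s q alpha f (lambda beta : R) u : Prop :=
  in_X0 Omega p s q u /\
  forall v, in_X0 Omega p s q v ->
  [/\ leb2.-integrable setT (EFin \o weak_lhs p s u v),
      leb.-integrable Omega
        (fun x => (`|u x| `^ (alpha x - 2) * u x * v x)%:E),
      leb.-integrable Omega (fun x => (f x (u x) * v x)%:E) &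
      \int[leb2]_z weak_lhs p s u v z =
        beta * (\int[leb]_(x in Omega) (`|u x| `^ (alpha x - 2) * u x * v x)) +
        lambda * (\int[leb]_(x in Omega) (f x (u x) * v x))].

Definition energy Omega p s alpha F (lambda beta : R) u : R :=
  \int[leb2]_z (`|u z.1 - u z.2| `^ p z.1 z.2 / (p z.1 z.2 * kernel p s z))
  - beta * (\int[leb]_(x in Omega) (`|u x| `^ alpha x / alpha x))
  - lambda * (\int[leb]_(x in Omega) F x (u x)).

(* L is the Frechet derivative at u of J : X_0 -> R, for the norm of X_0. The
   bound makes L vanish on functions which are 0 a.e., hence well defined on
   classes modulo a.e. equality. *)
Definition is_frechet_derivative Omega p s q (J : (RN -> R) -> R) u
    (L : (RN -> R) -> R) : Prop :=
  [/\ forall (a : R) v w, in_X0 Omega p s q v -> in_X0 Omega p s q w ->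
        L (fun x => a * v x + w x) = a * L v + L w,
      exists C : R, forall v, in_X0 Omega p s q v ->
        `|L v| <= C * X0norm p s v &
      forall e : R, 0 < e -> exists2 d : R, 0 < d &
        forall v, in_X0 Omega p s q v -> X0norm p s v < d ->
          `|J (u \+ v) - J u - L v| <= e * X0norm p s v].

Definition nehari Omega p s q alpha F (lambda beta : R) u : Prop :=
  [/\ in_X0 Omega p s q u, ~ {ae leb, forall x, u x = 0} &
      exists2 L, is_frechet_derivative Omega p s q
                   (energy Omega p s alpha F lambda beta) u L & L u = 0].

Definition in_Linfty Omega u : Prop :=
  measurable_fun Omega u /\
  exists M : R, {ae leb, forall x, Omega x -> `|u x| <= M}.

End FractionalSpace.

(* Main.v *)
Require Import Defs.
From mathcomp Require Import all_boot all_order all_algebra.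
From mathcomp Require Import all_classical all_reals all_analysis.
From mathcomp Require Import measurable_realfun ring lra.

(** The decay of [f] at infinity and its homogeneity force [f x t = 0] for [t > 0]
    and almost every [x], so that [f x t = h x * (t^-)^(r - 1)] with the bounded
    function [h x = f x (- 1)]. The equation therefore decouples by sign: a
    nonnegative solution of the problem without [f], and the opposite of a
    nonnegative solution of
    [- Delta w = beta w^(alpha - 1) - lambda h w^(r - 1)], are two distinct
    solutions. Both are instances of one existence theorem,
    [reaction_solution], for a reaction [beta w^(alpha - 1) + b w^(r - 1)] with
    [b] small.

    The solution minimises the energy among functions with values in [0, 1] that
    vanish off the domain. No compact embedding is used. Fix [k] with
    [alpha < k < p]. Along the power means
    [((u^k + v^k) / 2)^(1/k)] the nonlocal energy is convex
    ([pmean_hidden_convex]), the term of order [alpha] is uniformly concave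
    ([powR_midpoint_concave]) and the term of order [r] is absorbed by the
    interaction of the domain with a cube away from it, where all functions
    vanish ([powR_defect_le], [outer_integral_ge]). The energy is thus uniformly
    midpoint convex ([functional_midpoint]), minimising sequences converge
    almost everywhere, and Fatou's lemma concludes ([minimiser_exists]). The
    minimum is negative, since [alpha < p] and a Lipschitz bump has finite energy
    ([functional_neg]), hence the minimiser is not zero.

    The constraint is inactive. Truncating a variation to [0, 1] decreases the
    nonlocal energy, and above height one the gain is proportional to the excess,
    again by the interaction with the outer cube; for small [beta] and [lambda]
    it dominates what the reaction loses ([euler_le], [euler_equation]).

    The Nehari condition asks for the Frechet derivative of the energy. Its
    remainder is quadratic ([energy_expansion]) once the Lebesgue norm of
    exponent [r] is controlled by the norm of the space. This follows from
    [sobolev_bound], an iteration on dyadic level sets for which it suffices that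
    [r + 1 <= r^2] and that [r^2] is subcritical near the diagonal. Testing the
    equation with the solution itself shows that the derivative vanishes there
    ([euler_solution]). *)

Set Implicit Arguments.
Unset Strict Implicit.
Unset Printing Implicit Defensive.

Import Order.TTheory GRing.Theory Num.Theory.
Import numFieldTopology.Exports numFieldNormedType.Exports.

Local Open Scope classical_set_scope.
Local Open Scope ring_scope.

Local Notation edist := Defs.edist.

(** * Inequalities for powers and power means *)

Section power_inequalities.
Context {R : realType}.
Implicit Types a b c m x y P : R.

Lemma powR_le e x y : 0 <= e -> 0 <= x -> x <= y -> x `^ e <= y `^ e.
Proof.
move=> e0 x0 xy; apply: ge0_ler_powR => //; rewrite nnegrE//.
exact: le_trans xy.
Qed.

Lemma powR_gt0_MVT e x y : 0 < x -> x <= y ->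
  exists2 z, x <= z <= y & y `^ e - x `^ e = e * z `^ (e - 1) * (y - x).
Proof.
move=> x0 xy.
have [| |z zxy ->] :=
    @MVT_segment R (@powR R ^~ e) (fun z => e * z `^ (e - 1)) x y xy.
- move=> z; rewrite in_itv/= => /andP[xz _]; apply: is_derive1_powR.
  exact: lt_trans xz.
- apply: derivable_within_continuous => z; rewrite in_itv/= => /andP[xz _].
  by apply: derivable_powR; rewrite in_itv/= andbT (lt_le_trans x0).
- by exists z => //; rewrite in_itv in zxy.
Qed.

(** The graph of a convex power lies above its tangents. *)
Lemma powR_tangent m x y : 1 <= m -> 0 <= x -> 0 <= y ->
  y `^ m + m * y `^ (m - 1) * (x - y) <= x `^ m.
Proof.
move=> m1 x0 y0; have m0 : 0 < m by exact: lt_le_trans m1.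
have [y00|yp] := eqVneq y 0.
  rewrite y00 powR0 ?gt_eqF// add0r subr0.
  have [->|mn1] := eqVneq m 1; first by rewrite subrr powRr0 mul1r mul1r powRr1.
  by rewrite powR0 ?subr_eq0// mulr0 mul0r powR_ge0.
have {yp}y0 : 0 < y by rewrite lt_neqAle eq_sym yp.
have [x00|xp] := eqVneq x 0.
  rewrite x00 (powR0 (lt0r_neq0 m0)) sub0r mulrN -mulrA (mulrC _ y).
  rewrite (mulr_powRB1 (ltW y0) m0) -[X in X - _]mul1r -mulrBl.
  by rewrite mulr_le0_ge0 ?powR_ge0// subr_le0.
have {xp}x0 : 0 < x by rewrite lt_neqAle eq_sym xp.
rewrite -lerBrDl.
have [xy|/ltW yx] := leP y x.
  have [z /andP[yz zx] ->] := powR_gt0_MVT m y0 xy.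
  rewrite ler_wpM2r ?subr_ge0// ler_wpM2l ?(ltW m0)//.
  by apply: powR_le; rewrite ?subr_ge0// ltW.
have [z /andP[xz zy] e] := powR_gt0_MVT m x0 yx.
rewrite -[leRHS]opprB e -mulrN opprB ler_wnM2r ?subr_le0//.
rewrite ler_wpM2l ?(ltW m0)//.
by apply: powR_le; rewrite ?subr_ge0// (le_trans (ltW x0)).
Qed.

Lemma powR_incr m x y : 1 <= m -> 0 <= x -> x <= y ->
  y `^ m - x `^ m <= m * y `^ (m - 1) * (y - x).
Proof.
move=> m1 x0 xy; have := powR_tangent m1 x0 (le_trans x0 xy).
by rewrite -(opprB y x) mulrN; lra.
Qed.

Lemma powR_convex m x y : 1 <= m -> 0 <= x -> 0 <= y ->
  ((x + y) / 2) `^ m <= (x `^ m + y `^ m) / 2.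
Proof.
move=> m1 x0 y0; set M := (x + y) / 2.
have M0 : 0 <= M by rewrite divr_ge0// addr_ge0.
have := powR_tangent m1 x0 M0; have := powR_tangent m1 y0 M0.
have -> : y - M = - (x - M) by rewrite /M; field.
set k := _ * _ `^ _; rewrite mulrN; lra.
Qed.

(** A function on ]0, 1] with nondecreasing derivative lies above its tangents. *)
Lemma tangent_nondecreasing_derive (f df : R -> R) :
  (forall x, 0 < x -> x <= 1 -> is_derive x 1 f (df x)) ->
  (forall x y, 0 < x -> x <= y -> y <= 1 -> df x <= df y) ->
  forall x y, 0 < x -> x <= 1 -> 0 < y -> y <= 1 ->
  f y + df y * (x - y) <= f x.
Proof.
move=> fdf mdf.
have mvt (u v : R) : 0 < u -> u <= v -> v <= 1 ->
    exists2 z, u <= z <= v & f v - f u = df z * (v - u).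
  move=> u0 uv v1; have [| |z zuv ->] := @MVT_segment R f df u v uv.
  - move=> z; rewrite in_itv/= => /andP[uz zv]; apply: fdf.
    + exact: lt_trans uz.
    + exact: le_trans (ltW zv) _.
  - apply: derivable_within_continuous => z; rewrite in_itv/= => /andP[uz zv].
    apply: (@ex_derive _ _ _ _ _ _ _ (fdf z _ _)).
    + exact: lt_le_trans uz.
    + exact: le_trans zv _.
  - by exists z => //; rewrite in_itv in zuv.
move=> x y x0 x1 y0 y1; have [xy|/ltW yx] := leP x y.
  have [z /andP[xz zy] E] := mvt x y x0 xy y1.
  have := mdf z y (lt_le_trans x0 xz) zy y1.
  have : 0 <= y - x by rewrite subr_ge0.
  nra.
have [z /andP[yz zx] E] := mvt y x y0 yx x1.
have := mdf y z y0 yz (le_trans zx x1).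
have : 0 <= x - y by rewrite subr_ge0.
nra.
Qed.

(** Quantitative midpoint concavity, on the unit interval, of the powers with
    exponent in a compact subinterval of ]0, 1[. *)
Lemma powR_midpoint_concave (em eM e x y : R) :
  0 < em -> em <= e -> e <= eM -> eM < 1 -> 0 <= x <= 1 -> 0 <= y <= 1 ->
  (x `^ e + y `^ e) / 2 + em * (1 - eM) / 8 * (x - y) ^+ 2
    <= ((x + y) / 2) `^ e.
Proof.
move=> em0 eme eeM eM1 /andP[x0 x1] /andP[y0 y1].
have e0 : 0 < e by exact: lt_le_trans eme.
have e1 : e < 1 by exact: le_lt_trans eM1.
(* c is at most half of the modulus e (1 - e) of the second derivative. *)
set c := em * (1 - eM) / 2.
have c0 : 0 <= c by rewrite /c; nra.
have c1 : c <= 1 - e by rewrite /c; nra.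
have c2 : 2 * c <= e * (1 - e) by rewrite /c; nra.
pose f u := - (u `^ e) - c * u ^+ 2.
pose df u := - (e * u `^ (e - 1)) - c * (2 * u).
have fdf (u : R) : 0 < u -> u <= 1 -> is_derive u 1 f (df u).
  move=> u0 u1; have := is_derive1_powR e u0 => ?.
  apply: is_deriveB.
  rewrite (_ : (fun _ => _) = (c *: (@id R : R -> R^o) ^+ 2)); last first.
    by apply/funext => z; rewrite /= -[RHS]/(c * (z ^+ 2)).
  apply: is_derive_eq.
  by rewrite /GRing.scale/= expr1 mulr1.
have mdf (u v : R) : 0 < u -> u <= v -> v <= 1 -> df u <= df v.
  move=> u0 uv v1.
  have [z /andP[sz zt] E] := powR_gt0_MVT (e - 1) u0 uv.
  have z0 : 0 < z by exact: lt_le_trans sz.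
  have z1 : z <= 1 by exact: le_trans v1.
  have zz : 1 <= z `^ (e - 1 - 1).
    rewrite -[leLHS](powRr0 z) ger_powR ?z0// lerBlDr lerBlDr !add0r.
    by rewrite (le_trans (ltW e1))// lerDl.
  have vu : 0 <= v - u by rewrite subr_ge0.
  have D : v `^ (e - 1) - u `^ (e - 1) <= - (1 - e) * (v - u).
    rewrite E ler_wpM2r//; nra.
  have {}D : e * (v `^ (e - 1) - u `^ (e - 1)) <= e * (- (1 - e) * (v - u)).
    by rewrite ler_pM2l.
  have : 2 * c * (v - u) <= e * (1 - e) * (v - u) by rewrite ler_wpM2r.
  rewrite /df; lra.
have key (u v : R) : 0 <= u -> u <= 1 -> 0 < v -> v <= 1 ->
    f v + df v * (u - v) <= f u.
  move=> u0 u1 v0 v1.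
  have [u00|up] := eqVneq u 0; last first.
    have {up}u0 : 0 < u by rewrite lt_neqAle eq_sym up.
    exact: (tangent_nondecreasing_derive fdf mdf).
  rewrite u00 /f /df powR0 ?gt_eqF// sub0r expr0n/= mulr0 subr0 oppr0.
  have -> : - v `^ e - c * v ^+ 2 + (- (e * v `^ (e - 1)) - c * (2 * v)) * - v =
    - v `^ e + e * (v * v `^ (e - 1)) + c * v ^+ 2 by ring.
  rewrite (mulr_powRB1 (ltW v0) e0).
  have : v ^+ 2 <= v `^ e.
    by rewrite -(powR_mulrn 2 (ltW v0)) ger_powR ?v0// (le_trans (ltW e1))// ler1n.
  have : 0 <= v `^ e by exact: powR_ge0.
  nra.
set M := (x + y) / 2.
(* The tangent at the midpoint is compared with both end points. *)
have [M0|M0] := eqVneq M 0.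
  have [-> ->] : x = 0 /\ y = 0 by rewrite /M in M0; split; lra.
  by rewrite M0 subrr expr0n/= mulr0 addr0 !powR0 ?gt_eqF// addr0 mul0r.
have {}M0 : 0 < M by rewrite lt_neqAle eq_sym M0 divr_ge0// addr_ge0.
have M1 : M <= 1 by rewrite /M; lra.
have := key x M x0 x1 M0 M1; have := key y M y0 y1 M0 M1.
have -> : y - M = - (x - M) by rewrite /M; field.
set k := df M; rewrite /f mulrN => h1 h2.
have E : x ^+ 2 + y ^+ 2 = 2 * M ^+ 2 + (x - y) ^+ 2 / 2.
  by rewrite /M; field.
have -> : em * (1 - eM) / 8 = c / 4 by rewrite /c; field.
nra.
Qed.

(** The convexity defect of a power on the unit interval controls the defects
    of the higher powers. *)
Lemma powR_defect_le (pm b c x y : R) :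
  1 < pm -> pm <= b -> b <= c -> 0 <= x <= 1 -> 0 <= y <= 1 ->
  (x `^ c + y `^ c) / 2 - ((x + y) / 2) `^ c <=
  c * (c - 1) / (pm * (pm - 1)) *
    ((x `^ b + y `^ b) / 2 - ((x + y) / 2) `^ b).
Proof.
move=> pm1 pmb bc /andP[x0 x1] /andP[y0 y1].
have b1 : 1 < b by exact: lt_le_trans pmb.
have c1 : 1 < c by exact: lt_le_trans bc.
have [b0 c0 pm0] : [/\ 0 < b, 0 < c & 0 < pm].
  by split; lra.
set C := c * (c - 1) / (pm * (pm - 1)).
have Cpm : C * (pm * (pm - 1)) = c * (c - 1).
  by rewrite /C mulfVK// mulf_neq0// ?gt_eqF// subr_gt0.
have C0 : 0 <= C by rewrite /C divr_ge0// mulr_ge0 ?subr_ge0// ltW.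
have Cb : c * (c - 1) <= C * b * (b - 1).
  rewrite -Cpm -mulrA ler_wpM2l//; nra.
have Cb' : c - 1 <= C * (b - 1).
  have h : 0 <= C * (b - 1) * (c - b) by apply: mulr_ge0; [apply: mulr_ge0|]; lra.
  have : c * (c - 1) <= c * (C * (b - 1)) by lra.
  by rewrite ler_pM2l.
(* The constant C makes f convex on the unit interval. *)
pose f u := C * u `^ b - u `^ c.
pose df u := C * (b * u `^ (b - 1)) - c * u `^ (c - 1).
have fdf (u : R) : 0 < u -> u <= 1 -> is_derive u 1 f (df u).
  move=> u0 u1; have := is_derive1_powR b u0 => ?.
  have := is_derive1_powR c u0 => ?.
  apply: is_deriveB.
have mdf (u v : R) : 0 < u -> u <= v -> v <= 1 -> df u <= df v.
  move=> u0 uv v1.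
  pose k := (c - 1) / (b - 1).
  have b10 : 0 < b - 1 by rewrite subr_gt0.
  have k1 : 1 <= k by rewrite ler_pdivlMr// mul1r lerD2r.
  have kE : (b - 1) * k = c - 1 by rewrite mulrC mulfVK// gt_eqF.
  have uv' : u `^ (b - 1) <= v `^ (b - 1).
    by apply: powR_le => //; exact: ltW.
  have v0 : 0 < v by exact: lt_le_trans uv.
  have := powR_incr k1 (powR_ge0 u (b - 1)) uv'.
  rewrite -!powRrM !kE => h.
  have h1 : v `^ ((b - 1) * (k - 1)) <= 1.
    rewrite -[leRHS](powRr0 v) ger_powR ?v0// mulr_ge0// ?subr_ge0//.
    exact: ltW.
  have h0 := powR_ge0 v ((b - 1) * (k - 1)).
  have ck : c * k <= C * b.
    rewrite /k mulrA ler_pdivrMr//.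
  rewrite /df.
  set U := u `^ (b - 1) in uv' h *; set V := v `^ (b - 1) in uv' h *.
  set U' := u `^ (c - 1) in h *; set V' := v `^ (c - 1) in h *.
  set w := v `^ _ in h h0 h1 *.
  have h2 : V' - U' <= k * (V - U).
    apply: le_trans h _; rewrite ler_wpM2r ?subr_ge0//.
    by rewrite ler_piMr// (le_trans _ k1).
  have : c * (V' - U') <= C * b * (V - U).
    apply: (@le_trans _ _ (c * (k * (V - U)))); first by rewrite ler_pM2l.
    by rewrite mulrA ler_wpM2r// subr_ge0.
  lra.
have key (u v : R) : 0 <= u -> u <= 1 -> 0 < v -> v <= 1 ->
    f v + df v * (u - v) <= f u.
  move=> u0 u1 v0 v1.
  have [u00|up] := eqVneq u 0; last first.
    have {up}u0 : 0 < u by rewrite lt_neqAle eq_sym up.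
    exact: (tangent_nondecreasing_derive fdf mdf).
  rewrite u00 /f /df !powR0 ?gt_eqF// sub0r mulr0 subr0.
  have -> : C * v `^ b - v `^ c + (C * (b * v `^ (b - 1)) - c * v `^ (c - 1)) * - v =
    C * v `^ b - v `^ c - C * b * (v * v `^ (b - 1)) + c * (v * v `^ (c - 1)).
    by ring.
  rewrite (mulr_powRB1 (ltW v0) b0) (mulr_powRB1 (ltW v0) c0).
  have : v `^ c <= v `^ b by rewrite ger_powR ?v0.
  have : 0 <= v `^ c by exact: powR_ge0.
  set X := v `^ b; set Y := v `^ c => Y0 YX.
  have : (c - 1) * Y <= C * (b - 1) * X.
    apply: (@le_trans _ _ ((c - 1) * X)).
      by rewrite ler_wpM2l// subr_ge0 ltW.
    by rewrite ler_wpM2r// (le_trans Y0).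
  lra.
set M := (x + y) / 2.
have [M0|M0] := eqVneq M 0.
  have [-> ->] : x = 0 /\ y = 0 by rewrite /M in M0; split; lra.
  by rewrite M0 !powR0 ?gt_eqF// addr0 mul0r subrr mulr0.
have {}M0 : 0 < M by rewrite lt_neqAle eq_sym M0 divr_ge0// addr_ge0.
have M1 : M <= 1 by rewrite /M; lra.
have := key x M x0 x1 M0 M1; have := key y M y0 y1 M0 M1.
have -> : y - M = - (x - M) by rewrite /M; field.
set k := df M; rewrite /f mulrN => h1 h2.
lra.
Qed.

End power_inequalities.

Section signed_powers.
Context {R : realType}.
Implicit Types a b c d k t P : R.

(** The signed power, derivative of [|t|^P / P]. *)
Definition spow P t : R := `|t| `^ (P - 2) * t.

Lemma spowN P t : spow P (- t) = - spow P t.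
Proof. by rewrite /spow normrN mulrN. Qed.

Lemma spow_norm P t : 1 < P -> `|spow P t| = `|t| `^ (P - 1).
Proof.
move=> P1; rewrite /spow normrM (ger0_norm (powR_ge0 _ _)) mulrC.
rewrite (_ : P - 2 = P - 1 - 1); last by ring.
by rewrite mulr_powRB1// subr_gt0.
Qed.

Lemma spow_ge0E P t : 1 < P -> 0 <= t -> spow P t = t `^ (P - 1).
Proof.
move=> P1 t0; rewrite -[in RHS](ger0_norm t0) -spow_norm// ger0_norm//.
by rewrite /spow mulr_ge0// powR_ge0.
Qed.

Lemma spow_mulr P t : 1 < P -> spow P t * t = `|t| `^ P.
Proof.
move=> P1; rewrite /spow -mulrA -expr2 -real_normK ?num_real// expr2.
rewrite mulrCA (mulrC _ `|t|) (_ : P - 2 = P - 1 - 1); last by ring.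
rewrite mulr_powRB1// ?subr_gt0// mulr_powRB1//.
exact: lt_trans P1.
Qed.

(** The graph of [|t|^P / P] lies above its tangents. *)
Lemma spow_tangent P a c : 1 < P ->
  `|a| `^ P / P + spow P a * (c - a) <= `|c| `^ P / P.
Proof.
move=> P1; have P0 : 0 < P by exact: lt_trans P1.
have := powR_tangent (ltW P1) (normr_ge0 c) (normr_ge0 a).
have h : spow P a * c <= `|a| `^ (P - 1) * `|c|.
  by rewrite -spow_norm// -normrM ler_norm.
have e : `|a| `^ (P - 1) * `|a| = `|a| `^ P by rewrite mulrC mulr_powRB1.
rewrite [spow P a * _]mulrBr spow_mulr// => h2.
rewrite ler_pdivlMr// mulrDl mulfVK ?gt_eqF//.
set X := `|a| `^ P in h2 e *; set Y := `|c| `^ P in h2 *.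
set Z := `|a| `^ (P - 1) in h h2 e *; set W := spow P a in h *.
have : P * (W * c) <= P * (Z * `|c|) by rewrite ler_pM2l.
have : P * (Z * `|a|) = P * X by rewrite e.
lra.
Qed.

Lemma spow_lipschitz P a c : 2 <= P ->
  `|spow P c - spow P a| <= (P - 1) * (`|a| + `|c|) `^ (P - 2) * `|c - a|.
Proof.
move=> P2; have P1 : 1 < P by lra.
have P20 : 0 <= P - 2 by rewrite subr_ge0.
wlog ac : a c / `|a| <= `|c|.
  move=> wl; have [/wl//|/ltW ca] := leP `|a| `|c|.
  by have := wl _ _ ca; rewrite distrC (distrC a) (addrC `|c|).
wlog c0 : a c ac / 0 <= c.
  move=> wl; have [c0|/ltW c0] := leP 0 c; first exact: wl.
  have := wl (- a) (- c); rewrite !normrN oppr_ge0 !spowN => /(_ ac c0).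
  by rewrite -!opprD !normrN.
rewrite (ger0_norm c0) in ac *.
have aac : `|a| <= `|a| + c by rewrite lerDl.
have cac : c <= `|a| + c by rewrite lerDr.
have [a0|a0] := leP 0 a.
  rewrite (ger0_norm a0) in ac aac cac *.
  rewrite !spow_ge0E// [X in _ * X]ger0_norm ?subr_ge0//.
  rewrite ger0_norm ?subr_ge0; last by apply: powR_le => //; lra.
  have P11 : 1 <= P - 1 by lra.
  apply: (le_trans (powR_incr P11 a0 ac)).
  rewrite ler_wpM2r ?subr_ge0// ler_wpM2l; [by []|lra|].
  by rewrite (_ : P - 1 - 1 = P - 2); [exact: powR_le|ring].
have b0 : 0 <= - a by lra.
rewrite (ltr0_norm a0) in ac aac cac *.
have -> : spow P a = - spow P (- a) by rewrite spowN opprK.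
rewrite opprK /spow (ger0_norm c0) (ger0_norm b0).
have -> : `|c - a| = c - a by rewrite ger0_norm//; lra.
rewrite ger0_norm; last by rewrite addr_ge0// mulr_ge0// powR_ge0.
have h1 := powR_le P20 c0 cac.
have h2 := powR_le P20 b0 aac.
set X := (- a + c) `^ _ in h1 h2 *.
have X0 : 0 <= X by exact: powR_ge0.
apply: (@le_trans _ _ (X * c + X * - a)).
  by rewrite lerD// ler_wpM2r.
have : 0 <= (P - 2) * (X * (c - a)).
  by apply: mulr_ge0 => //; apply: mulr_ge0 => //; lra.
lra.
Qed.

(** Second order Taylor estimate for [|t|^P / P]. *)
Lemma spow_taylor P a c : 2 <= P ->
  `|c| `^ P / P - `|a| `^ P / P - spow P a * (c - a)
    <= (P - 1) * (`|a| + `|c|) `^ (P - 2) * (c - a) ^+ 2.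
Proof.
move=> P2; have P1 : 1 < P by lra.
have := spow_tangent c a P1.
have h : (spow P c - spow P a) * (c - a) <=
   (P - 1) * (`|a| + `|c|) `^ (P - 2) * (c - a) ^+ 2.
  apply: le_trans (ler_norm _) _; rewrite normrM.
  rewrite -(real_normK (num_real (c - a))) expr2 [leRHS]mulrA.
  by rewrite ler_wpM2r// spow_lipschitz.
lra.
Qed.

(** The negative part. *)
Definition npart t : R := Num.max (- t) 0.

Lemma npart_ge0 t : 0 <= npart t.
Proof. by rewrite /npart le_max lexx orbT. Qed.

Lemma ger0_npart t : 0 <= t -> npart t = 0.
Proof. by move=> t0; rewrite /npart max_r// oppr_le0. Qed.

Lemma ler0_npart t : t <= 0 -> npart t = - t.
Proof. by move=> t0; rewrite /npart max_l// oppr_ge0. Qed.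

Lemma npart_le_norm t : npart t <= `|t|.
Proof.
have [t0|/ltW t0] := leP 0 t; first by rewrite ger0_npart.
by rewrite ler0_npart// ler0_norm.
Qed.

(** The corresponding estimate for [(t^-)^P / P]. *)
Lemma npart_taylor P a c : 2 <= P ->
  `|npart c `^ P / P - npart a `^ P / P + npart a `^ (P - 1) * (c - a)|
    <= (P - 1) * (`|a| + `|c|) `^ (P - 2) * (c - a) ^+ 2.
Proof.
move=> P2; have P1 : 1 < P by lra.
have P0 : 0 < P by lra.
have P20 : 0 <= P - 2 by lra.
have P10 : P - 1 != 0 by lra.
have Pn0 : P != 0 by lra.
have eP t : 0 <= t -> t `^ P = t `^ (P - 2) * t ^+ 2.
  move=> t0; have := @spow_mulr P t P1; rewrite /spow (ger0_norm t0) => <-.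
  by rewrite expr2 mulrA.
have eP1 t : 0 <= t -> t `^ (P - 1) = t `^ (P - 2) * t.
  by move=> t0; rewrite -spow_ge0E// /spow (ger0_norm t0).
have [a0|/ltW a0] := leP 0 a; have [c0|/ltW c0] := leP 0 c.
- rewrite !ger0_npart// !powR0// !mul0r subrr add0r normr0.
  apply: mulr_ge0; last exact: sqr_ge0.
  by apply: mulr_ge0; [lra|exact: powR_ge0].
- rewrite (ger0_npart a0) (ler0_npart c0) !powR0// !mul0r subr0 addr0.
  have c0' : 0 <= - c by lra.
  rewrite ger0_norm ?divr_ge0 ?powR_ge0 ?(ltW P0)//.
  rewrite (ger0_norm a0) (ler0_norm c0).
  have h : (- c) `^ (P - 2) <= (a - c) `^ (P - 2) by apply: powR_le => //; lra.
  rewrite eP//; have X0 := powR_ge0 (- c) (P - 2).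
  set X := _ `^ _ in h X0 *; set Y := _ `^ _ in h *.
  have h3 : (- c) ^+ 2 <= (c - a) ^+ 2 by nra.
  have h4 : X * (- c) ^+ 2 <= Y * (c - a) ^+ 2.
    by apply: ler_pM => //; exact: sqr_ge0.
  have Z0 : 0 <= X * (- c) ^+ 2 by rewrite mulr_ge0// sqr_ge0.
  rewrite ler_pdivrMr// (le_trans h4)//.
  have : 0 <= (P * (P - 1) - 1) * (Y * (c - a) ^+ 2).
    by apply: mulr_ge0; [nra|exact: le_trans h4].
  lra.
- rewrite (ler0_npart a0) (ger0_npart c0) !powR0// !mul0r sub0r.
  have a0' : 0 <= - a by lra.
  rewrite eP// eP1// (ler0_norm a0) (ger0_norm c0).
  have h : (- a) `^ (P - 2) <= (- a + c) `^ (P - 2) by apply: powR_le => //; lra.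
  have X0 := powR_ge0 (- a) (P - 2).
  set X := _ `^ _ in h X0 *; set Y := _ `^ _ in h *.
  have Pi : P^-1 <= 1 by rewrite invf_le1//; lra.
  have Pi0 : 0 <= P^-1 by rewrite invr_ge0 ltW.
  have Z0 : 0 <= X * (- a) ^+ 2 by rewrite mulr_ge0// sqr_ge0.
  have Z2 : X * (- a) ^+ 2 / P <= X * (- a) ^+ 2 by rewrite ler_piMr.
  have Z20 : 0 <= X * (- a) ^+ 2 / P by rewrite mulr_ge0.
  have Z1 : 0 <= X * (- a) * c by rewrite !mulr_ge0.
  rewrite ger0_norm; last by lra.
  have h4 : X * (c - a) ^+ 2 <= Y * (c - a) ^+ 2.
    by rewrite ler_wpM2r// sqr_ge0.
  have h5 : 0 <= X * c ^+ 2 by rewrite mulr_ge0// sqr_ge0.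
  have : 0 <= (P - 2) * (Y * (c - a) ^+ 2).
    by rewrite mulr_ge0// (le_trans _ h4)// mulr_ge0// sqr_ge0.
  lra.
- rewrite (ler0_npart a0) (ler0_npart c0).
  have a0' : 0 <= - a by lra.
  have c0' : 0 <= - c by lra.
  have := spow_taylor (- a) (- c) P2; have := spow_tangent (- a) (- c) P1.
  rewrite !normrN (spow_ge0E P1 a0') -!opprD sqrrN.
  rewrite (ler0_norm a0) (ler0_norm c0) => h1 h2.
  rewrite ger0_norm; lra.
Qed.

(** Weighted convexity of the powers. *)
Lemma powR_convexw m (l x y : R) : 1 <= m -> 0 <= l <= 1 -> 0 <= x -> 0 <= y ->
  (l * x + (1 - l) * y) `^ m <= l * x `^ m + (1 - l) * y `^ m.
Proof.
move=> m1 /andP[l0 l1] x0 y0; set M := l * x + (1 - l) * y.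
have l10 : 0 <= 1 - l by rewrite subr_ge0.
have M0 : 0 <= M by rewrite addr_ge0// mulr_ge0.
have h1 := powR_tangent m1 x0 M0; have h2 := powR_tangent m1 y0 M0.
set k := _ * M `^ _ in h1 h2.
have := ler_wpM2l l0 h1; have := ler_wpM2l l10 h2.
have : l * (k * (x - M)) + (1 - l) * (k * (y - M)) = 0 by rewrite /M; ring.
lra.
Qed.

Lemma powR_div k a b : 0 <= a -> 0 <= b -> (a / b) `^ k = a `^ k / b `^ k.
Proof.
move=> a0 b0; rewrite powRM ?invr_ge0//; congr *%R.
by rewrite -(powR_inv1 b0) -powRrM mulN1r powRN.
Qed.

(** The power mean of order [k] of two numbers. *)
Definition pmean k a b : R := ((a `^ k + b `^ k) / 2) `^ k^-1.

Lemma pmean_ge0 k a b : 0 <= pmean k a b.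
Proof. exact: powR_ge0. Qed.

Let half_ge0 k a b : 0 <= (a `^ k + b `^ k) / 2.
Proof. by rewrite divr_ge0// addr_ge0// powR_ge0. Qed.

Lemma powR_pmean k e a b :
  pmean k a b `^ e = ((a `^ k + b `^ k) / 2) `^ (e / k).
Proof. by rewrite /pmean -powRrM (mulrC k^-1). Qed.

Lemma powR_pmean_id k a b : 0 < k ->
  pmean k a b `^ k = (a `^ k + b `^ k) / 2.
Proof. by move=> k0; rewrite powR_pmean divff ?gt_eqF// powRr1. Qed.

Lemma powRK k a : 0 < k -> 0 <= a -> (a `^ k) `^ k^-1 = a.
Proof. by move=> k0 a0; rewrite -powRrM divff ?gt_eqF// powRr1. Qed.

Lemma pmean_le k a b c d : 0 < k -> 0 <= a -> 0 <= b -> a <= c -> b <= d ->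
  pmean k a b <= pmean k c d.
Proof.
move=> k0 a0 b0 ac bd; apply: powR_le => //; first by rewrite invr_ge0 ltW.
by rewrite ler_pM2r// lerD// powR_le// ltW.
Qed.

Lemma pmeanxx k a : 0 < k -> 0 <= a -> pmean k a a = a.
Proof.
move=> k0 a0; rewrite /pmean (_ : (_ + _) / 2 = a `^ k); last by field.
exact: powRK.
Qed.

Lemma pmean_eq0 k a b : 0 < k -> pmean k a b = 0 -> a = 0 /\ b = 0.
Proof.
move=> k0 /powR_eq0_eq0/eqP; rewrite mulf_eq0 invr_eq0 pnatr_eq0 orbF.
rewrite paddr_eq0 ?powR_ge0// => /andP[/eqP/powR_eq0_eq0 -> /eqP/powR_eq0_eq0 ->].
by [].
Qed.

(** The power mean of order at least one is subadditive: Minkowski's inequality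
    for two points. *)
Lemma pmean_triangle k a b c d : 1 <= k ->
  0 <= a -> 0 <= b -> 0 <= c -> 0 <= d ->
  pmean k (a + c) (b + d) <= pmean k a b + pmean k c d.
Proof.
move=> k1 a0 b0 c0 d0; have k0 : 0 < k by exact: lt_le_trans k1.
have [/(pmean_eq0 k0)[-> ->]|s0] := eqVneq (pmean k a b) 0.
  by rewrite !add0r lerDr pmean_ge0.
have [/(pmean_eq0 k0)[-> ->]|t0] := eqVneq (pmean k c d) 0.
  by rewrite !addr0 lerDl pmean_ge0.
have {}s0 : 0 < pmean k a b by rewrite lt_neqAle eq_sym s0 pmean_ge0.
have {}t0 : 0 < pmean k c d by rewrite lt_neqAle eq_sym t0 pmean_ge0.
have := powR_pmean_id c d k0; have := powR_pmean_id a b k0.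
rewrite [X in X <= _]/pmean.
move: (pmean k a b) (pmean k c d) s0 t0 => s t s0 t0 ea ec.
have st0 : 0 < s + t by exact: addr_gt0.
have stn : s + t != 0 by rewrite gt_eqF.
pose l := s / (s + t).
have l1 : 1 - l = t / (s + t) by rewrite /l; field.
have l01 : 0 <= l <= 1.
  rewrite /l divr_ge0 ?(ltW s0) ?(ltW st0)//=.
  by rewrite ler_pdivrMr// mul1r lerDl ltW.
have key (x y : R) : 0 <= x -> 0 <= y -> (x + y) `^ k / (s + t) `^ k <=
    l * (x `^ k / s `^ k) + (1 - l) * (y `^ k / t `^ k).
  move=> x0 y0.
  have := powR_convexw k1 l01 (divr_ge0 x0 (ltW s0)) (divr_ge0 y0 (ltW t0)).
  rewrite l1 {1}/l.
  have -> : s / (s + t) * (x / s) + t / (s + t) * (y / t) = (x + y) / (s + t).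
    by field; rewrite !gt_eqF.
  by rewrite !powR_div ?addr_ge0 ?(ltW s0) ?(ltW t0).
have skn : s `^ k != 0 by rewrite gt_eqF// powR_gt0.
have tkn : t `^ k != 0 by rewrite gt_eqF// powR_gt0.
have : ((a + c) `^ k + (b + d) `^ k) / 2 <= (s + t) `^ k.
  have := key _ _ a0 c0; have := key _ _ b0 d0.
  set S := (s + t) `^ k; have S0 : 0 < S by rewrite powR_gt0.
  move=> h1 h2; rewrite -[leRHS]mul1r -ler_pdivrMr//.
  have e1 : a `^ k / s `^ k + b `^ k / s `^ k = 2.
    have -> : a `^ k = 2 * s `^ k - b `^ k by rewrite ea; field.
    by field.
  have e2 : c `^ k / t `^ k + d `^ k / t `^ k = 2.
    have -> : c `^ k = 2 * t `^ k - d `^ k by rewrite ec; field.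
    by field.
  set x1 := a `^ k / _ in e1 h2; set x2 := b `^ k / _ in e1 h1.
  set y1 := c `^ k / _ in e2 h2; set y2 := d `^ k / _ in e2 h1.
  have -> : ((a + c) `^ k + (b + d) `^ k) / 2 / S = ((a + c) `^ k / S + (b + d) `^ k / S) / 2.
    by field; rewrite gt_eqF.
  have : l * (x1 + x2) = l * 2 by rewrite e1.
  have : (1 - l) * (y1 + y2) = (1 - l) * 2 by rewrite e2.
  lra.
have ki : 0 <= k^-1 by rewrite invr_ge0 ltW.
by move=> /(powR_le ki (half_ge0 _ _ _)) /le_trans; apply; rewrite powRK// ltW.
Qed.

(** Hidden convexity: for [k <= P], increments of power means of order [k] are
    controlled by the increments of the functions. *)
Lemma pmean_hidden_convex k P a b c d : 1 <= k -> k <= P ->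
  0 <= a -> 0 <= b -> 0 <= c -> 0 <= d ->
  `|pmean k a b - pmean k c d| `^ P <= (`|a - c| `^ P + `|b - d| `^ P) / 2.
Proof.
move=> k1 kP a0 b0 c0 d0; have k0 : 0 < k by exact: lt_le_trans k1.
have P0 : 0 <= P by rewrite (le_trans (ltW k0)).
apply: (@le_trans _ _ (pmean k `|a - c| `|b - d| `^ P)).
  apply: powR_le => //; have tr (x y x' y' : R) : 0 <= x -> 0 <= y -> 0 <= x' -> 0 <= y' ->
      pmean k x y - pmean k x' y' <= pmean k `|x - x'| `|y - y'|.
    move=> x0 y0 x0' y0'; rewrite lerBlDl.
    apply: le_trans (pmean_triangle k1 x0' y0' (normr_ge0 _) (normr_ge0 _)).
    by apply: pmean_le => //; rewrite -lerBlDl ler_norm.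
  rewrite ler_norml; apply/andP; split; last exact: tr.
  by rewrite lerNl opprB (distrC a) (distrC b); exact: tr.
rewrite powR_pmean.
have Pk : 1 <= P / k by rewrite ler_pdivlMr// mul1r.
apply: le_trans (powR_convex Pk (powR_ge0 _ _) (powR_ge0 _ _)) _.
by rewrite -!powRrM !(mulrC k) !mulfVK// gt_eqF.
Qed.

End signed_powers.

(** * Borel sets and cubes *)

Section rV_borel.
Context {R : realType}.

Lemma rat_approx (x e : R) : 0 < e -> exists q : rat, `|x - ratr q| < e.
Proof.
move=> e0; have : x - e < x + e by lra.
move=> /rat_in_itvoo[q]; rewrite in_itv/= => /andP[h1 h2].
by exists q; rewrite ltr_norml; apply/andP; split; lra.
Qed.

Lemma natSinv_lt (e : R) : 0 < e -> exists k : nat, k.+1%:R^-1 < e.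
Proof.
move=> e0; have [k _ /(_ k (leqnn _)) ke] := near_infty_natSinv_lt (PosNum e0).
by exists k.
Qed.

(** Rational open cubes, a countable basis of the topology. *)
Let cell n (a : {ffun 'I_n -> rat}) (k : nat) : set 'rV[R]_n :=
  [set x | forall i, `|x ord0 i - ratr (a i)| < k.+1%:R^-1].

Let measurable_cell n (a : {ffun 'I_n -> rat}) k : measurable (cell a k).
Proof.
rewrite (_ : cell a k = \bigcap_(i in [set: 'I_n])
    (rV_coord i @^-1` (ball (ratr (a i) : R) k.+1%:R^-1))); last first.
  apply/seteqP; split=> [x ax i _ /=|x ax i].
    by rewrite /ball/= distrC; exact: ax.
  by have := ax i I; rewrite /ball/= distrC.
apply: fin_bigcap_measurable => // i _; rewrite -[X in measurable X]setTI.
by apply: measurable_rV_coord => //; exact: measurable_ball.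
Qed.

(** The sigma-algebra generated by the coordinates contains the open sets, also
    on a product of two spaces. *)
Lemma open_rV2_measurable n m (U : set ('rV[R]_n * 'rV[R]_m)) :
  open U -> measurable U.
Proof.
move=> oU.
pose T := ({ffun 'I_n -> rat} * {ffun 'I_m -> rat} * nat)%type.
pose C (t : T) := cell t.1.1 t.2 `*` cell t.1.2 t.2.
pose D (t : T) := if pselect (C t `<=` U) then C t else set0.
rewrite (_ : U = \bigcup_t D t).
  apply: countable_bigcupT_measurable => [|t]; first exact: countableP.
  rewrite /D; case: pselect => h /=; last exact: measurable0.
  by apply: measurableX; exact: measurable_cell.
apply/seteqP; split=> [[x y] Uxy|z [t _]]; last first.
  by rewrite /D; case: pselect => //= sub Ct; exact: sub.
have /nbhs_ballP[e /= e0 sub] : nbhs (x, y) U by exact: open_nbhs_nbhs.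
have [k ke] : exists k : nat, k.+1%:R^-1 < e / 2.
  by apply: natSinv_lt; rewrite divr_gt0.
have approx l (v : 'rV[R]_l) : exists a : {ffun 'I_l -> rat}, cell a k v.
  have /choice[a ha] : forall i : 'I_l, exists q : rat,
      `|v ord0 i - ratr q| < k.+1%:R^-1 by move=> i; exact: rat_approx.
  by exists [ffun i => a i] => i; rewrite ffunE.
have near l (v w : 'rV[R]_l) (a : {ffun 'I_l -> rat}) :
    cell a k v -> cell a k w -> ball v e w.
  move=> av aw; split=> // i j; rewrite (ord1 i) /ball/=.
  have := av j; have := aw j; set q := ratr _ => h1 h2.
  rewrite (_ : v ord0 j - w ord0 j = (v ord0 j - q) - (w ord0 j - q)); last by ring.
  by rewrite (splitr e) (le_lt_trans (ler_normB _ _))// ltrD// (lt_trans _ ke).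
have [a ax] := approx n x; have [b by_] := approx m y.
exists ((a, b), k) => //; rewrite /D; case: pselect => //= nsub.
exfalso; apply: nsub => -[x' y'] [/= ax' by'].
by apply: sub; split => /=; [exact: (near _ _ _ a)|exact: (near _ _ _ b)].
Qed.

Lemma open_rV_measurable n (U : set 'rV[R]_n) : open U -> measurable U.
Proof.
move=> oU; have mU : measurable (fst @^-1` U : set ('rV[R]_n * 'rV[R]_n)).
  apply: open_rV2_measurable; apply: open_comp => // x _.
  exact: cvg_fst.
rewrite (_ : U = (fun x => (x, x)) @^-1` (fst @^-1` U)) //.
rewrite -[X in measurable X]setTI.
have : measurable_fun [set: 'rV[R]_n] (fun x => (x, x)).
  exact: measurable_fun_pair.
by apply.
Qed.

(** Not the general measurability of continuous maps: the sigma-algebra here is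
    generated by the coordinates, not by the open sets. *)
Lemma continuous_rV2_measurable n m (g : 'rV[R]_n * 'rV[R]_m -> R) :
  continuous g -> measurable_fun setT g.
Proof.
move=> cg _ ; apply: (measurability _ (RGenOpens.measurableE R)) => //.
move=> _ [_ [a [b ->] <-]]; rewrite setTI; apply: open_rV2_measurable.
by move/continuousP : cg; apply; exact: interval_open.
Qed.

Lemma continuous_rV_measurable n (D : set 'rV[R]_n) (g : 'rV[R]_n -> R) :
  open D -> (forall x, D x -> {for x, continuous g}) -> measurable_fun D g.
Proof.
move=> oD cg; have mD := open_rV_measurable oD.
apply: (measurability _ (RGenOpens.measurableE R)) => //.
move=> _ [_ [a [b ->] <-]]; apply: open_rV_measurable.
rewrite openE => x [Dx gx]; rewrite /interior; apply: filterI.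
  exact: open_nbhs_nbhs.
apply: (cg x Dx); apply: open_nbhs_nbhs; split=> //; exact: interval_open.
Qed.

Lemma measurable_rV_box n (a b : 'rV[R]_n) : measurable (rV_box a b).
Proof.
rewrite (_ : rV_box _ _ = \bigcap_(i in [set: 'I_n])
  (rV_coord i @^-1` `[a ord0 i, b ord0 i]%classic)); last first.
  apply/seteqP; split=> [x abx i _ /=|x abx i].
    by rewrite in_itv /=; exact: abx.
  by have := abx i I; rewrite /= in_itv.
apply: fin_bigcap_measurable => // i _; rewrite -[X in measurable X]setTI.
exact: measurable_rV_coord.
Qed.

(** The closed cube of centre [x] and half side [e]. *)
Definition cube n (x : 'rV[R]_n) (e : R) : set 'rV[R]_n :=
  [set y | forall i, `|x ord0 i - y ord0 i| <= e].

Lemma cubeE n (x : 'rV[R]_n) e :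
  cube x e = rV_box (\row_i (x ord0 i - e)) (\row_i (x ord0 i + e)).
Proof.
apply/seteqP; split=> y xy i; have := xy i; rewrite !mxE ler_norml => /andP[h1 h2];
  by apply/andP; split; lra.
Qed.

Lemma measurable_cube n (x : 'rV[R]_n) e : measurable (cube x e).
Proof. by rewrite cubeE; exact: measurable_rV_box. Qed.

Lemma lebesgue_rV_cube n (x : 'rV[R]_n) e : 0 <= e ->
  lebesgue_rV n (cube x e) = ((2 * e) ^+ n)%:E.
Proof.
move=> e0; rewrite cubeE lebesgue_rV_box; last by move=> i; rewrite !mxE; lra.
rewrite (eq_bigr (fun=> 2 * e)); last by move=> i _; rewrite !mxE; ring.
by rewrite prodr_const card_ord.
Qed.

Lemma edist_nneg n (x y : 'rV[R]_n) : 0 <= edist x y.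
Proof. exact: sqrtr_ge0. Qed.

Lemma coord_le_edist n (x y : 'rV[R]_n) i : `|x ord0 i - y ord0 i| <= edist x y.
Proof.
rewrite -sqrtr_sqr ler_sqrt ?sumr_ge0// => [|j _]; last exact: sqr_ge0.
by rewrite (bigD1 i)//= lerDl sumr_ge0// => j _; exact: sqr_ge0.
Qed.

Lemma edist_le_cube n (x y : 'rV[R]_n) e : 0 <= e -> cube x e y ->
  edist x y <= n%:R * e.
Proof.
move=> e0 xy; rewrite -[leRHS]ger0_norm ?mulr_ge0// -sqrtr_sqr.
rewrite ler_sqrt ?sqr_ge0//.
apply: (@le_trans _ _ (\sum_(i < n) e ^+ 2)).
  by apply: ler_sum => i _; rewrite -real_normK ?num_real// lerXn2r// nnegrE.
rewrite sumr_const card_ord -[leLHS]mulr_natl exprMn ler_wpM2r ?sqr_ge0//.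
by case: n {x y xy} => [|n]; rewrite ?expr0n//= -natrX ler_nat expnS leq_pmulr.
Qed.

Lemma measurable_edist n :
  measurable_fun setT (fun z : 'rV[R]_n * 'rV[R]_n => edist z.1 z.2).
Proof.
apply: measurableT_comp.
  exact: continuous_measurable_fun (@sqrt_continuous R).
apply: measurable_sum => i; apply: measurable_funX.
apply: measurable_funB; [apply: (measurableT_comp (f := rV_coord i)) => //|
  apply: (measurableT_comp (f := rV_coord i)) => //]; exact: measurable_rV_coord.
Qed.

End rV_borel.

Section measurability.
Context d (T : measurableType d) {R : realType}.

Lemma measurable_powR_fun (D : set T) (f g : T -> R) :
  measurable_fun D f -> measurable_fun D g ->
  measurable_fun D (fun x => f x `^ g x).
Proof.
move=> mf mg mD.
rewrite (_ : (fun _ => _) = fun x => if f x == 0 then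
    (if g x == 0 then 1 else 0) else expR (g x * ln (f x))); last first.
  by apply/funext => x; rewrite /powR; case: ifP => // _; case: ifP.
apply: measurable_fun_if => //.
- by apply: measurable_fun_eqr.
- apply: (measurable_funS mD); first exact: subIsetl.
  by apply: measurable_fun_if => //; [exact: measurable_fun_eqr|..].
- apply: (measurable_funS mD); first exact: subIsetl.
  apply: measurableT_comp; first exact: measurable_expR.
  apply: measurable_funM => //.
  by apply: measurableT_comp => //; exact: measurable_ln.
Qed.

Lemma measurable_funV (D : set T) (f : T -> R) :
  measurable_fun D f -> measurable_fun D (fun x => (f x)^-1).
Proof.
move=> mf; rewrite (_ : (fun _ => _) = fun x => f x * (f x ^+ 2) `^ (-1)).
  apply: measurable_funM => //; apply: measurable_powR_fun => //.
  exact: measurable_funX.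
apply/funext => x; rewrite powR_inv1 ?sqr_ge0//.
have [->|fx0] := eqVneq (f x) 0; first by rewrite invr0 mul0r.
by field.
Qed.

Lemma measurable_fun_div (D : set T) (f g : T -> R) :
  measurable_fun D f -> measurable_fun D g ->
  measurable_fun D (fun x => f x / g x).
Proof. by move=> mf mg; apply: measurable_funM => //; exact: measurable_funV. Qed.

End measurability.

Section ae_product.
Local Open Scope ereal_scope.
Context d1 d2 (T1 : measurableType d1) (T2 : measurableType d2) {R : realType}.
Variables (m1 : {sigma_finite_measure set T1 -> \bar R}).
Variables (m2 : {sigma_finite_measure set T2 -> \bar R}).

Lemma ae_prod1 (P : T1 -> Prop) : {ae m1, forall x, P x} ->
  {ae (m1 \x m2), forall z, P z.1}.
Proof.
move=> [A [mA A0 subA]]; exists (A `*` setT); split.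
- exact: measurableX.
- transitivity (m1 A * m2 setT); last by rewrite A0 mul0e.
  exact: product_measure1E.
- by move=> z /= nP; split=> //=; exact: subA.
Qed.

Lemma ae_prod2 (P : T2 -> Prop) : {ae m2, forall x, P x} ->
  {ae (m1 \x m2), forall z, P z.2}.
Proof.
move=> [A [mA A0 subA]]; exists (setT `*` A); split.
- exact: measurableX.
- transitivity (m1 setT * m2 A); last by rewrite A0 mule0.
  exact: product_measure1E.
- by move=> z /= nP; split=> //=; exact: subA.
Qed.

End ae_product.

(** * The modular and the exterior condition *)

(** Measurable variable exponents [p] and [s], with [2 < pm <= p <= pM] and
    [0 <= s <= 1]. *)
Record admissible {R : realType} {N : nat} (p s : 'rV[R]_N -> 'rV[R]_N -> R)
    (pm pM : R) : Prop := Admissible {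
  p_measurable : measurable_fun setT (fun z : 'rV[R]_N * 'rV[R]_N => p z.1 z.2);
  s_measurable : measurable_fun setT (fun z : 'rV[R]_N * 'rV[R]_N => s z.1 z.2);
  pm_gt2 : 2 < pm;
  p_ge : forall x y, pm <= p x y;
  p_le : forall x y, p x y <= pM;
  s_ge0 : forall x y, 0 <= s x y;
  s_le1 : forall x y, s x y <= 1 }.

Section modular.
Context {R : realType} {N : nat}.
Local Notation RN := 'rV[R]_N.
Local Notation leb := (lebesgue_rV N : {sigma_finite_measure set RN -> \bar R}).
Local Notation leb2 := (leb \x leb)%E.
Context (p s : RN -> RN -> R) (pm pM : R) (H : admissible p s pm pM).
Implicit Types (u v : RN -> R) (z : RN * RN).

(** The integrand of the modular of the Gagliardo seminorm. *)
Definition gdens u z : R := `|u z.1 - u z.2| `^ p z.1 z.2 / Defs.kernel p s z.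

(** The modular of the Gagliardo seminorm. *)
Definition modular u : \bar R := (\int[leb2]_z (gdens u z)%:E)%E.

Lemma kernel_ge0 z : 0 <= Defs.kernel p s z.
Proof. exact: powR_ge0. Qed.

Lemma kernel_gt0 z : 0 < edist z.1 z.2 -> 0 < Defs.kernel p s z.
Proof. exact: powR_gt0. Qed.

Lemma measurable_gagliardo_kernel : measurable_fun setT (Defs.kernel p s).
Proof.
apply: measurable_powR_fun; first exact: measurable_edist.
apply: measurable_funD => //.
by apply: measurable_funM; [exact: s_measurable H|exact: p_measurable H].
Qed.

Lemma p_gt0 x y : 0 < p x y.
Proof. by rewrite (lt_le_trans _ (p_ge H x y))// (lt_trans _ (pm_gt2 H)). Qed.

Lemma p_gt1 x y : 1 < p x y.
Proof. by rewrite (lt_le_trans _ (p_ge H x y))// (lt_trans _ (pm_gt2 H))// ltr1n. Qed.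

Lemma p_gt2 x y : 2 < p x y.
Proof. exact: lt_le_trans (pm_gt2 H) (p_ge H x y). Qed.

Lemma pM_gt2 : 2 < pM.
Proof. exact: lt_le_trans (p_gt2 0 0) (p_le H 0 0). Qed.

Lemma gdens_ge0 u z : 0 <= gdens u z.
Proof. by rewrite divr_ge0// ?powR_ge0// kernel_ge0. Qed.

Lemma measurable_increment u : measurable_fun setT u ->
  measurable_fun setT (fun z : RN * RN => u z.1 - u z.2).
Proof. by move=> mu; apply: measurable_funB; exact: measurableT_comp. Qed.

Lemma measurable_gdens u : measurable_fun setT u ->
  measurable_fun setT (gdens u).
Proof.
move=> mu; apply: measurable_fun_div; last exact: measurable_gagliardo_kernel.
apply: measurable_powR_fun; last exact: p_measurable H.
by apply: measurableT_comp => //; exact: measurable_increment.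
Qed.

Lemma measurable_egdens u : measurable_fun setT u ->
  measurable_fun setT (fun z => (gdens u z)%:E).
Proof. by move=> mu; apply/measurable_EFinP; exact: measurable_gdens. Qed.

Lemma modular_ge0 u : (0 <= modular u)%E.
Proof. by apply: integral_ge0 => z _; rewrite lee_fin gdens_ge0. Qed.

Lemma gagliardoE u theta z : 0 < theta ->
  gagliardo p s u theta z = gdens (fun x => u x / theta) z.
Proof.
move=> t0; rewrite /gagliardo /gdens -mulrBl normrM normfV (gtr0_norm t0).
by rewrite powR_div ?(ltW t0)// -mulrA -invfM.
Qed.

Lemma gdens_scale u (a : R) z : 0 <= a ->
  gdens (fun x => a * u x) z = a `^ p z.1 z.2 * gdens u z.
Proof.
by move=> a0; rewrite /gdens -mulrBr normrM (ger0_norm a0) powRM// mulrA.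
Qed.

Lemma powR_le_pm (a : R) x y : 0 <= a -> a <= 1 -> a `^ p x y <= a `^ pm.
Proof.
rewrite le_eqVlt => /predU1P[<-|a0] a1.
  by rewrite !powR0 ?gt_eqF ?p_gt0// (lt_trans _ (pm_gt2 H)).
by rewrite ger_powR ?a0// (p_ge H).
Qed.

Lemma powR_le_pM (a : R) x y : 1 <= a -> a `^ p x y <= a `^ pM.
Proof. by move=> a1; rewrite ler_powR// (p_le H). Qed.

Lemma powR_le_max (a : R) x y : 0 <= a -> a `^ p x y <= Num.max 1 a `^ pM.
Proof.
move=> a0; apply: (@le_trans _ _ (Num.max 1 a `^ p x y)).
  by apply: powR_le => //; [exact/ltW/p_gt0|rewrite le_max lexx orbT].
by apply: powR_le_pM; rewrite le_max lexx.
Qed.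

Lemma modular_scale_fin u (a : R) : measurable_fun setT u -> 0 <= a ->
  (modular u < +oo)%E -> (modular (fun x => a * u x)%R < +oo)%E.
Proof.
move=> mu a0 fu; pose C := Num.max 1 a `^ pM.
apply: (@le_lt_trans _ _ (C%:E * modular u)%E).
  rewrite /modular -ge0_integralZl//; first apply: ge0_le_integral => //.
  - by move=> z _; rewrite lee_fin gdens_ge0.
  - by apply: measurable_egdens; exact: measurable_funM.
  - by apply: measurable_funeM; exact: measurable_egdens.
  - move=> z _; rewrite -EFinM lee_fin gdens_scale//.
    by rewrite ler_wpM2r// ?gdens_ge0// powR_le_max.
  - exact: measurable_egdens.
  - by move=> z _; rewrite lee_fin gdens_ge0.
  - by rewrite lee_fin powR_ge0.
by rewrite lte_mul_pinfty// lee_fin powR_ge0.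
Qed.

Lemma eq_ae_modular u v : measurable_fun setT u -> measurable_fun setT v ->
  {ae leb, forall x, u x = v x} -> modular u = modular v.
Proof.
move=> mu mv uv; apply: ae_eq_integral => //; try exact: measurable_egdens.
have h1 : {ae leb2, forall z, u z.1 = v z.1} := ae_prod1 leb uv.
have h2 : {ae leb2, forall z, u z.2 = v z.2} := ae_prod2 leb uv.
by apply: filterS2 h1 h2 => z e1 e2 _; rewrite /gdens e1 e2.
Qed.

Lemma gdens_add_le u v z :
  gdens (fun x => u x + v x) z <= 2 `^ pM * (gdens u z + gdens v z).
Proof.
rewrite /gdens -mulrDl mulrA ler_wpM2r// ?invr_ge0 ?kernel_ge0//.
rewrite (_ : u z.1 + v z.1 - _ = (u z.1 - u z.2) + (v z.1 - v z.2)); last by ring.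
set a := u z.1 - _; set b := v z.1 - _.
have P1 : 1 <= p z.1 z.2 by exact/ltW/p_gt1.
have := powR_convex P1 (normr_ge0 a) (normr_ge0 b).
rewrite powR_div// => h.
have -> : `|a| `^ p z.1 z.2 + `|b| `^ p z.1 z.2 =
  2 * ((`|a| `^ p z.1 z.2 + `|b| `^ p z.1 z.2) / 2) by field.
set X := (_ + _) / 2 in h *.
apply: (@le_trans _ _ ((`|a| + `|b|) `^ p z.1 z.2)).
  by apply: powR_le; rewrite ?ler_normD// ltW// p_gt0.
have P20 : 0 < 2 `^ p z.1 z.2 :> R by rewrite powR_gt0.
move: h; rewrite ler_pdivrMr// => /le_trans; apply.
have X0 : 0 <= X by rewrite divr_ge0// addr_ge0// powR_ge0.
rewrite [leLHS]mulrC; apply: ler_pM; [exact: ltW|exact: X0| |].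
  by apply: powR_le_pM; rewrite ler1n.
by rewrite ler_peMl// ler1n.
Qed.

Lemma modular_add_fin u v : measurable_fun setT u -> measurable_fun setT v ->
  (modular u < +oo)%E -> (modular v < +oo)%E ->
  (modular (fun x => u x + v x)%R < +oo)%E.
Proof.
move=> mu mv fu fv.
have C0 : (0 <= (2 `^ pM)%:E :> \bar R)%E by rewrite lee_fin powR_ge0.
apply: (@le_lt_trans _ _ ((2 `^ pM)%:E * (modular u + modular v))%E).
  rewrite /modular -ge0_integralD//; last 4 first.
  - by move=> z _; rewrite lee_fin gdens_ge0.
  - exact: measurable_egdens.
  - by move=> z _; rewrite lee_fin gdens_ge0.
  - exact: measurable_egdens.
  rewrite -ge0_integralZl//; last 2 first.
  - by apply: emeasurable_funD; exact: measurable_egdens.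
  - by move=> z _; rewrite -EFinD lee_fin addr_ge0// gdens_ge0.
  apply: ge0_le_integral => //.
  - by move=> z _; rewrite lee_fin gdens_ge0.
  - by apply: measurable_egdens; exact: measurable_funD.
  - apply: measurable_funeM.
    by apply: emeasurable_funD; exact: measurable_egdens.
  - by move=> z _; rewrite -EFinD -EFinM lee_fin gdens_add_le.
apply: lte_mul_pinfty; first exact: C0.
  by [].
move: (modular u) (modular v) fu fv => a b; exact: lte_add_pinfty.
Qed.

Lemma integrable_gdens u : measurable_fun setT u -> (modular u < +oo)%E ->
  leb2.-integrable setT (EFin \o gdens u).
Proof.
move=> mu fu; apply/integrableP; split; first exact: measurable_egdens.
apply: le_lt_trans fu; rewrite le_eqVlt; apply/orP; left; apply/eqP.
by apply: eq_integral => z _ /=; rewrite ger0_norm// gdens_ge0.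
Qed.

End modular.

(** A measurable set lying in the cube of centre 0 and half side [B]. *)
Record located {R : realType} {N : nat} (Omega : set 'rV[R]_N) (B : R) : Prop :=
  Located {
  N_gt0 : (0 < N)%N;
  mOmega : measurable Omega;
  B_ge0 : 0 <= B;
  Omega_bounded : forall x i, Omega x -> `|x ord0 i| <= B }.

Section killing.
Context {R : realType} {N : nat}.
Local Notation RN := 'rV[R]_N.
Local Notation leb := (lebesgue_rV N : {sigma_finite_measure set RN -> \bar R}).
Local Notation leb2 := (leb \x leb)%E.
Context (p s : RN -> RN -> R) (pm pM : R) (H : admissible p s pm pM).
Context (Omega : set RN) (B : R) (OB : located Omega B).
Implicit Types (u v : RN -> R) (z : RN * RN).

Lemma Omega_fin : (leb Omega < +oo)%E.
Proof.
apply: (@le_lt_trans _ _ (leb (cube 0 B))).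
  apply: le_measure; rewrite ?inE//; first exact: mOmega OB.
    exact: measurable_cube.
  by move=> x Ox i; rewrite mxE sub0r normrN; exact: (Omega_bounded OB).
by rewrite lebesgue_rV_cube ?(B_ge0 OB)// ltry.
Qed.

(** A cube away from [Omega]. *)
Definition outer_cube : set RN := cube (const_mx (B + 2)) 1.

Lemma measurable_outer_cube : measurable outer_cube.
Proof. exact: measurable_cube. Qed.

Lemma outer_cube_measure : leb outer_cube = (2 ^+ N)%:E.
Proof. by rewrite lebesgue_rV_cube// mulr1. Qed.

Lemma outer_cube_coord x y i : Omega x -> outer_cube y ->
  1 <= `|x ord0 i - y ord0 i| <= 2 * B + 3.
Proof.
move=> /(Omega_bounded OB i) + /(_ i); rewrite mxE !ler_norml.
move=> /andP[h1 h2] /andP[h3 h4].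
by rewrite ler_normr; apply/andP; split; first (apply/orP; right); lra.
Qed.

Lemma outer_cube_notin y : outer_cube y -> ~ Omega y.
Proof.
move=> Yy Oy; have /andP[] := outer_cube_coord (Ordinal (N_gt0 OB)) Oy Yy.
by rewrite subrr normr0 ler10.
Qed.

(** Upper bound of the kernel between [Omega] and the outer cube. *)
Definition kmax : R := (N%:R * (2 * B + 3)) `^ (N%:R + pM).

Lemma kmax_gt0 : 0 < kmax.
Proof. by apply: powR_gt0; rewrite mulr_gt0 ?ltr0n ?(N_gt0 OB)//; have := B_ge0 OB; lra. Qed.

Lemma outer_cube_kernel x y : Omega x -> outer_cube y ->
  0 < Defs.kernel p s (x, y) <= kmax.
Proof.
move=> Ox Yy; have D1 : 1 <= edist x y.
  have /andP[h _] := outer_cube_coord (Ordinal (N_gt0 OB)) Ox Yy.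
  exact: le_trans h (coord_le_edist _ _ _).
rewrite kernel_gt0/=; last exact: lt_le_trans D1.
have e0 : 0 <= N%:R + s x y * p x y.
  by rewrite addr_ge0// mulr_ge0 ?(s_ge0 H)// ltW// (p_gt0 H).
apply: (@le_trans _ _ ((N%:R * (2 * B + 3)) `^ (N%:R + s x y * p x y))).
  apply: powR_le; [exact: e0|exact: edist_nneg|].
  apply: edist_le_cube; first by have := B_ge0 OB; lra.
  by move=> i; have /andP[] := outer_cube_coord i Ox Yy.
apply: ler_powR.
  have : 1 <= N%:R :> R by rewrite ler1n (N_gt0 OB).
  by have := B_ge0 OB; nra.
rewrite lerD2l (le_trans _ (p_le H x y))// ler_piMl ?(s_le1 H)//.
exact/ltW/p_gt0/H.
Qed.

(** A density on pairs bounded below on [Omega] times the outer cube controls an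
    integral over [Omega]: the effect of the exterior condition. *)
Lemma outer_integral_ge (g : RN -> R) (h : RN * RN -> R) :
  measurable_fun Omega g -> (forall x, Omega x -> 0 <= g x) ->
  measurable_fun setT h -> (forall z, 0 <= h z) ->
  {ae leb2, forall z, Omega z.1 -> outer_cube z.2 -> g z.1 <= h z} ->
  ((2 ^+ N)%:E * \int[leb]_(x in Omega) (g x)%:E <= \int[leb2]_z (h z)%:E)%E.
Proof.
move=> mg g0 mh h0 gh.
pose k z : R := (g \_ Omega) z.1 * \1_outer_cube z.2.
have mO := mOmega OB.
have mgO : measurable_fun setT (g \_ Omega).
  by apply/(measurable_restrictT _ _).1.
have gO0 x : 0 <= (g \_ Omega) x.
  by rewrite patchE; case: ifPn => // /set_mem; exact: g0.
have k0 z : 0 <= k z by rewrite /k mulr_ge0// ler0n.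
have mk : measurable_fun setT (EFin \o k).
  apply/measurable_EFinP; apply: measurable_funM.
    exact: measurableT_comp.
  by apply: measurableT_comp => //; apply: measurable_indic; exact: measurable_outer_cube.
have -> : ((2 ^+ N)%:E * \int[leb]_(x in Omega) (g x)%:E =
    \int[leb2]_z (EFin \o k) z)%E.
  rewrite fubini_tonelli1//.
  rewrite integral_mkcond (_ : _ \_ Omega = EFin \o (g \_ Omega)); last first.
    exact: restrict_EFin.
  rewrite -ge0_integralZl//; last 2 first.
  - exact/measurable_EFinP.
  - by move=> x _; rewrite lee_fin.
  apply: eq_integral => x _; rewrite /fubini_F /k/=.
  under [RHS]eq_integral do rewrite EFinM.
  rewrite ge0_integralZl//; last 2 first.
  - by apply/measurable_EFinP; apply: measurable_indic; exact: measurable_outer_cube.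
  - by rewrite lee_fin.
  rewrite integral_indic ?setIT//; last exact: measurable_outer_cube.
  rewrite muleC; congr (_ * _)%E; exact/esym/outer_cube_measure.
apply: ae_ge0_le_integral => //.
- by move=> z _; rewrite lee_fin.
- by move=> z _; rewrite lee_fin.
- exact/measurable_EFinP.
apply: filterS gh => z ghz _; rewrite lee_fin /k patchE indicE.
case: ifPn => [/set_mem O1|_]; last by rewrite mul0r.
have [/set_mem Y2|_] := boolP (z.2 \in outer_cube); last by rewrite mulr0.
by rewrite mulr1; exact: ghz.
Qed.

End killing.

(** * A Sobolev inequality by level sets *)

Section sobolev.
Context {R : realType} {N : nat}.
Local Notation RN := 'rV[R]_N.
Local Notation leb := (lebesgue_rV N : {sigma_finite_measure set RN -> \bar R}).
Local Notation leb2 := (leb \x leb)%E.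

(** The interplay of exponents in the level set argument: if a set of measure [a]
    satisfies the decay bound [a <= D L^(- t)], then the kernel at distance
    [a^(1/N)] still beats the factor [L^t]. *)
Lemma level_ineq (L D a t th P pm : R) : 0 < pm -> pm <= t -> pm <= P ->
  0 <= th -> t <= P + t * th -> 1 <= L -> 1 <= D -> 0 < a -> a <= 1 ->
  a <= D * L `^ (- t) -> L `^ t * a `^ th <= D `^ (1 - pm / t) * L `^ P.
Proof.
move=> pm0 pmt pmP th0 tP L1 D1 a0 a1 aD.
have t0 : 0 < t by exact: lt_le_trans pmt.
have L0 : 0 < L by exact: lt_le_trans L1.
have D0 : 0 < D by exact: lt_le_trans D1.
pose ts := 1 - pm / t.
have ts0 : 0 <= ts by rewrite subr_ge0 ler_pdivrMr// mul1r.
have key e : 0 <= e -> a `^ e <= D `^ e * L `^ (- (t * e)).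
  move=> e0; apply: (le_trans (powR_le e0 (ltW a0) aD)).
  by rewrite powRM ?powR_ge0 ?(ltW D0)// -powRrM mulNr.
have [tsth|/ltW thts] := leP ts th.
  have h : a `^ th <= a `^ ts by rewrite ger_powR// a0.
  apply: (@le_trans _ _ (L `^ t * (D `^ ts * L `^ (- (t * ts))))).
    by rewrite ler_wpM2l ?powR_ge0// (le_trans h)// key.
  rewrite mulrCA -powRD ?(gt_eqF L0) ?implybT//.
  rewrite ler_wpM2l ?powR_ge0// ler_powR//.
  by rewrite /ts mulrBr mulr1 mulrCA divff ?gt_eqF// mulr1; lra.
apply: (@le_trans _ _ (L `^ t * (D `^ th * L `^ (- (t * th))))).
  by rewrite ler_wpM2l ?powR_ge0// key.
rewrite mulrCA -powRD ?(gt_eqF L0) ?implybT//.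
apply: ler_pM; rewrite ?powR_ge0//; first exact: ler_powR.
by rewrite ler_powR//; lra.
Qed.

Lemma edist_eq0 (x y : RN) : edist x y = 0 -> x = y.
Proof.
move=> e0; apply/rowP => i; apply/eqP; rewrite -subr_eq0 -normr_le0 -e0.
exact: coord_le_edist.
Qed.

Context (p s : RN -> RN -> R) (pm pM : R) (H : admissible p s pm pM).
Context (Omega : set RN) (B : R) (OB : located Omega B).
Context (t eta : R) (pm_t : pm <= t) (eta_gt0 : 0 < eta)
  (subcrit : forall x y, Omega x -> cube x eta y ->
    t <= p x y + t * (s x y * p x y / N%:R)).
Implicit Types (u v : RN -> R) (z : RN * RN).

Local Notation kM := (@kmax R N pM B).
Let ts := 1 - pm / t.
Let c : R := N%:R `^ (- (N%:R + pM)).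

Let mO : measurable Omega := mOmega OB.
Let t_gt0 : 0 < t. Proof. by apply: lt_le_trans pm_t; apply: lt_trans (pm_gt2 H). Qed.
Let Nr_ge1 : 1 <= N%:R :> R. Proof. by rewrite ler1n (N_gt0 OB). Qed.
Let Nr_gt0 : 0 < N%:R :> R. Proof. by rewrite ltr0n (N_gt0 OB). Qed.
Let c_gt0 : 0 < c. Proof. exact: powR_gt0. Qed.

(** Lower bound of the interaction density at scale [a^(1/N)] around a point of
    [Omega], when the jump of the function is at least [L]. Subcriticality is
    used only for pairs of points at distance at most [eta]. *)
Lemma kernel_level_ge (L D a : R) (x y : RN) : 1 <= L -> 1 <= D ->
  0 < a -> a <= 1 -> a <= eta `^ N%:R -> a <= D * L `^ (- t) ->
  Omega x -> cube x (a `^ N%:R^-1) y -> x != y ->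
  c * D `^ (- ts) * L `^ t / a <= L `^ p x y / Defs.kernel p s (x, y).
Proof.
move=> L1 D1 a0 a1 aeta aD Ox xy xneqy.
set rho := a `^ N%:R^-1 in xy.
have rho0 : 0 < rho by exact: powR_gt0.
have rhoeta : rho <= eta.
  by rewrite -(powRK Nr_gt0 (ltW eta_gt0)); apply: powR_le => //; exact: ltW.
have D0 : 0 < D by exact: lt_le_trans D1.
have L0 : 0 < L by exact: lt_le_trans L1.
set th := s x y * p x y / N%:R.
have th0 : 0 <= th.
  by rewrite divr_ge0// mulr_ge0 ?(s_ge0 H)// ltW// (p_gt0 H).
have sub : t <= p x y + t * th.
  by apply: subcrit => // i; apply: le_trans (xy i) rhoeta.
have pm0 : 0 < pm by apply: lt_trans (pm_gt2 H).
have key := level_ineq pm0 pm_t (p_ge H x y) th0 sub L1 D1 a0 a1 aD.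
have K0 : 0 < Defs.kernel p s (x, y).
  apply: kernel_gt0; rewrite lt_neqAle edist_nneg andbT eq_sym.
  by apply: contra xneqy => /eqP/edist_eq0 /= ->.
have e0 : 0 <= N%:R + s x y * p x y.
  by rewrite addr_ge0// mulr_ge0 ?(s_ge0 H)// ltW// (p_gt0 H).
have Kle : Defs.kernel p s (x, y) <= N%:R `^ (N%:R + pM) * (a * a `^ th).
  apply: (@le_trans _ _ ((N%:R * rho) `^ (N%:R + s x y * p x y))).
    apply: powR_le; [exact: e0|exact: edist_nneg|].
    by apply: edist_le_cube => //; exact: ltW.
  rewrite powRM ?(ltW rho0)//; apply: ler_pM; rewrite ?powR_ge0//.
    apply: ler_powR => //; rewrite lerD2l (le_trans _ (p_le H x y))//.
    by rewrite ler_piMl ?(s_le1 H)// ltW// (p_gt0 H).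
  rewrite -powRrM mulrDr mulVf ?gt_eqF// powRD ?(gt_eqF a0) ?implybT//.
  by rewrite powRr1 ?(ltW a0)// (mulrC N%:R^-1).
rewrite ler_pdivlMr//.
have Dts0 : 0 < D `^ ts by exact: powR_gt0.
apply: (@le_trans _ _ (c * D `^ (- ts) * L `^ t / a * (N%:R `^ (N%:R + pM) * (a * a `^ th)))).
  by apply: ler_wpM2l Kle; rewrite divr_ge0 ?(ltW a0)// !mulr_ge0 ?powR_ge0.
have -> : c * D `^ (- ts) * L `^ t / a * (N%:R `^ (N%:R + pM) * (a * a `^ th))
  = (L `^ t * a `^ th) / D `^ ts.
  rewrite /c !powRN; field.
  by rewrite (gt_eqF a0) (gt_eqF Dts0) (gt_eqF (powR_gt0 _ Nr_gt0)).
by rewrite ler_pdivrMr// [leRHS]mulrC.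
Qed.

(** The level sets of [|u|] in [Omega]. *)
Let A u (L : R) : set RN := Omega `&` [set x | L <= `|u x|].

Lemma measurable_level u (L : R) : measurable_fun setT u -> measurable (A u L).
Proof.
move=> mu; have -> : A u L = Omega `&` (fun x => `|u x|) @^-1` `[L, +oo[%classic.
  by apply/seteqP; split=> x [Ox] /=; rewrite in_itv/= andbT.
apply: measurableI => //; rewrite -[X in measurable X]setTI.
by apply: measurableT_comp => //; exact: measurable_itv.
Qed.

Lemma integral_level u (L : R) : measurable_fun setT u ->
  (\int[leb]_(x in Omega) (\1_(A u L) x)%:E = leb (A u L))%E.
Proof.
move=> mu; have e : A u L `&` Omega = A u L.
  by apply/seteqP; split => x // -[].
by rewrite -[in RHS]e; apply: integral_indic => //; exact: measurable_level.
Qed.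

(** A point of the level set [2 L] lies in a cube of which at least half avoids
    the level set [L]; the jumps across it bound the measure of the former. *)
Lemma level_step u (L D a : R) : measurable_fun setT u ->
  (forall x, ~ Omega x -> u x = 0) -> 1 <= L -> 1 <= D ->
  0 < a -> a <= 1 -> a <= eta `^ N%:R -> a <= D * L `^ (- t) ->
  leb (A u L) = a%:E ->
  ((c * D `^ (- ts) * L `^ t)%:E * leb (A u (2 * L)) <= modular p s u)%E.
Proof.
move=> mu u0 L1 D1 a0 a1 aeta aD Aa.
set k := c * _ * _.
have L0 : 0 < L by exact: lt_le_trans L1.
have D0 : 0 < D by exact: lt_le_trans D1.
have k0 : 0 <= k by rewrite /k !mulr_ge0 ?powR_ge0// ltW.
have mA := measurable_level (2 * L) mu.
rewrite /modular fubini_tonelli1; last 2 first.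
- exact: measurable_egdens H _ mu.
- by move=> z; rewrite lee_fin gdens_ge0.
rewrite -(@integral_cst _ _ _ leb)// [X in (_ <= X)%E](integral_mkcond setT).
apply: (@le_trans _ _ (\int[leb]_(x in A u (2 * L)) fubini_F leb (fun z => (gdens p s u z)%:E) x)%E); last first.
  rewrite -integral_mkcond; apply: ge0_subset_integral => //.
  - apply: measurable_fun_fubini_tonelli_F => //; first exact: measurable_egdens H _ mu.
    by move=> z; rewrite lee_fin gdens_ge0.
  - by move=> x _; apply: integral_ge0 => y _; rewrite lee_fin gdens_ge0.
apply: ge0_le_integral => //.
  apply: (measurable_funS measurableT) => //.
  apply: measurable_fun_fubini_tonelli_F => //; first exact: measurable_egdens H _ mu.
  by move=> z; rewrite lee_fin gdens_ge0.
move=> x [Ox Lx]; rewrite /fubini_F.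
pose rho := a `^ N%:R^-1.
have rho0 : 0 < rho by exact: powR_gt0.
have mAL := measurable_level L mu.
have mC := measurable_cube x rho.
have mCA : measurable (cube x rho `\` A u L) by exact: measurableD.
have mgx : measurable_fun setT (fun y => (gdens p s u (x, y))%:E).
  apply/measurable_EFinP; apply: measurableT_comp; first exact: measurable_gdens H _ mu.
  exact: measurable_fun_pair.
apply: (@le_trans _ _ (\int[leb]_(y in cube x rho `\` A u L) (k / a)%:E)%E); last first.
  apply: (@le_trans _ _ (\int[leb]_(y in cube x rho `\` A u L) (gdens p s u (x, y))%:E)%E); last first.
    by apply: ge0_subset_integral => //= y _; rewrite lee_fin gdens_ge0.
  apply: ge0_le_integral => //.
  - by move=> y _; rewrite lee_fin divr_ge0// ltW.
  - exact: measurable_funS mgx.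
  move=> y [Cy nAy]; rewrite lee_fin /gdens/=.
  have uy : `|u y| < L.
    have [Oy|/u0 ->] := pselect (Omega y); last by rewrite normr0.
    by rewrite ltNge; apply/negP => Ly; apply: nAy.
  have uxy : L <= `|u x - u y|.
    have := lerB_dist (u x) (u y); move: Lx => /=; lra.
  apply: (@le_trans _ _ (L `^ p x y / Defs.kernel p s (x, y))).
    apply: kernel_level_ge => //; apply/eqP => xy.
    by move: Lx uy => /=; rewrite xy; lra.
  rewrite ler_wpM2r ?invr_ge0 ?kernel_ge0//; apply: powR_le => //.
    exact/ltW/(p_gt0 H).
  exact: ltW.
rewrite integral_cst//.
have leC : leb (cube x rho) = (2 ^+ N * a)%:E.
  rewrite lebesgue_rV_cube ?(ltW rho0)//; congr EFin; rewrite exprMn.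
  congr (_ * _); rewrite /rho -powR_mulrn ?powR_ge0// -powRrM mulVf ?gt_eqF//.
  by rewrite powRr1// ltW.
have h : (a%:E <= leb (cube x rho `\` A u L))%E.
  have -> : leb (cube x rho `\` A u L) = (leb (cube x rho) - leb (cube x rho `&` A u L))%E.
    have leCoo : (leb (cube x rho) < +oo)%E by rewrite leC ltry.
    exact: measureD.
  have : (leb (cube x rho `&` A u L) <= a%:E)%E.
    by rewrite -Aa; apply: le_measure; rewrite ?inE//; exact: measurableI.
  have : (0 <= leb (cube x rho `&` A u L))%E by exact: measure_ge0.
  rewrite leC.
  case: (leb (cube x rho `&` A u L)) => [b| |] //.
  rewrite !lee_fin => b0 ba; rewrite -?EFinB ?lee_fin.
  have : 2 <= 2 ^+ N :> R.
    by rewrite -[leLHS]expr1; apply: ler_weXn2l; rewrite ?ler1n ?(N_gt0 OB).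
  nra.
apply: (@le_trans _ _ ((k / a)%:E * a%:E)%E).
  by rewrite -EFinM mulfVK// gt_eqF.
by apply: lee_wpmul2l => //; rewrite lee_fin divr_ge0// ltW.
Qed.

(** Interaction with the outer cube, where [u] vanishes, gives a first decay of
    the level sets. *)
Lemma level_killing u (L : R) : measurable_fun setT u ->
  (forall x, ~ Omega x -> u x = 0) -> 1 <= L -> (modular p s u <= 1%:E)%E ->
  (leb (A u L) <= (kM / L)%:E)%E.
Proof.
move=> mu u0 L1 mod1.
have L0 : 0 < L by exact: lt_le_trans L1.
have km := kmax_gt0 pM OB.
have mA := measurable_level L mu.
pose g x : R := L / kM * \1_(A u L) x.
have g0 x : Omega x -> 0 <= g x.
  by move=> _; rewrite /g mulr_ge0// ?divr_ge0 ?(ltW L0) ?(ltW km).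
have mg : measurable_fun Omega g.
  by apply: measurable_funM => //; apply: measurable_funTS.
have := outer_integral_ge OB mg g0
  (measurable_gdens H mu) (gdens_ge0 p s u).
have /[swap]/[apply] : {ae leb2, forall z, Omega z.1 -> outer_cube B z.2 ->
    g z.1 <= gdens p s u z}.
  apply: aeW => -[x y] /= Ox Yy.
  have [Ax|nAx] := boolP (x \in A u L); last first.
    by rewrite /g indicE (negbTE nAx) mulr0 gdens_ge0.
  have [_ /= Lx] := set_mem Ax.
  have /andP[K0 K1] := outer_cube_kernel H OB Ox Yy.
  rewrite /g indicE Ax mulr1 /gdens/= (u0 y) ?subr0; last exact: (outer_cube_notin OB Yy).
  apply: ler_pM.
  - exact: ltW.
  - by rewrite invr_ge0 ltW.
  - apply: (le_trans Lx); rewrite -[leLHS]powRr1//; apply: ler_powR.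
      exact: le_trans Lx.
    exact/ltW/(p_gt1 H).
  - by rewrite lef_pV2.
rewrite (eq_integral (fun x => (L / kM)%:E * (\1_(A u L) x)%:E)%E); last first.
  by move=> x _; rewrite -EFinM.
rewrite ge0_integralZl//; last 2 first.
- by apply/measurable_EFinP; apply: measurable_funTS.
- by rewrite lee_fin divr_ge0 ?(ltW L0) ?(ltW km).
rewrite integral_level//.
move=> /le_trans/(_ mod1).
have : (leb (A u L) <= leb Omega)%E.
  by apply: le_measure; rewrite ?inE// => x [].
have := Omega_fin OB.
have : (0 <= leb (A u L))%E by exact: measure_ge0.
move: (leb Omega) (leb (A u L)) => VO [a| |]// a0 VOoo le1; last first.
  by have := le_lt_trans le1 VOoo.
rewrite -!EFinM !lee_fin in a0 *; move=> h.
rewrite ler_pdivlMr//.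
have : 1 <= 2 ^+ N :> R by rewrite exprn_ege1// ler1n.
have : 0 <= L / kM * a by rewrite mulr_ge0// divr_ge0 ?(ltW L0) ?(ltW km).
move=> h0 h2; have : L / kM * a <= 1 by nra.
by rewrite mulrAC ler_pdivrMr// mul1r mulrC.
Qed.

(** Iterating [level_step] on dyadic levels improves the decay to the power [t]. *)
Lemma level_decay : exists Lam D : R, [/\ 1 <= Lam, 1 <= D &
  forall u, measurable_fun setT u -> (forall x, ~ Omega x -> u x = 0) ->
  (modular p s u <= 1%:E)%E -> forall k : nat,
  (leb (A u (Lam * 2 ^+ k)) <= (D * (Lam * 2 ^+ k) `^ (- t))%:E)%E].
Proof.
have km := kmax_gt0 pM OB.
have pm0 : 0 < pm by apply: lt_trans (pm_gt2 H).
(* m is the largest measure at which the local estimate applies; Lam is the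
   first level whose level set is that small. *)
pose m := Num.min 1 (eta `^ N%:R).
have m0 : 0 < m by rewrite lt_min ltr01 powR_gt0.
pose Lam := Num.max 1 (kM / m).
have Lam1 : 1 <= Lam by rewrite le_max lexx.
have Lam0 : 0 < Lam by exact: lt_le_trans Lam1.
pose D := Num.max (Lam `^ t) ((2 `^ t / c) `^ (t / pm)).
have D1 : 1 <= D.
  by rewrite le_max -[X in X <= _](powRr0 Lam) ler_powR// ltW.
have D0 : 0 < D by exact: lt_le_trans D1.
exists Lam, D; split => // u mu u0 mod1.
have L1 k : 1 <= Lam * 2 ^+ k.
  by rewrite (le_trans Lam1)// ler_peMr ?(ltW Lam0)// exprn_ege1// ler1n.
have small k : (leb (A u (Lam * 2 ^+ k)) <= m%:E)%E.
  apply: (le_trans (level_killing mu u0 (L1 k) mod1)); rewrite lee_fin.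
  rewrite ler_pdivrMr ?(lt_le_trans ltr01 (L1 k))//.
  have : kM / m <= Lam by rewrite le_max lexx orbT.
  rewrite ler_pdivrMr// => /le_trans; apply.
  by rewrite mulrC ler_pM2l// ler_peMr ?(ltW Lam0)// exprn_ege1// ler1n.
have Dpm : 2 `^ t / c <= D `^ (1 - ts).
  have -> : 1 - ts = pm / t by rewrite /ts; ring.
  have -> : 2 `^ t / c = ((2 `^ t / c) `^ (t / pm)) `^ (pm / t).
    rewrite -powRrM (_ : t / pm * (pm / t) = 1).
      by rewrite powRr1// divr_ge0 ?powR_ge0// ltW.
    by field; rewrite !gt_eqF.
  apply: powR_le; first by rewrite divr_ge0// ltW.
    exact: powR_ge0.
  by rewrite le_max lexx orbT.
elim=> [|k IH].
  apply: (le_trans (small 0)); rewrite lee_fin expr0 mulr1.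
  apply: (@le_trans _ _ 1); first by rewrite ge_min lexx.
  rewrite powRN -[leLHS](@divff _ (Lam `^ t)) ?gt_eqF ?powR_gt0//.
  by rewrite ler_wpM2r ?invr_ge0 ?powR_ge0// le_max lexx.
set L := Lam * 2 ^+ k in IH.
have L0 : 0 < L by exact: lt_le_trans (L1 k).
have -> : Lam * 2 ^+ k.+1 = 2 * L by rewrite /L exprS; ring.
have : (leb (A u (2 * L)) <= leb (A u L))%E.
  apply: le_measure; rewrite ?inE//; [exact: measurable_level..|].
  by move=> x [Ox /= h]; split=> //=; lra.
have : (0 <= leb (A u L))%E by exact: measure_ge0.
have : (0 <= leb (A u (2 * L)))%E by exact: measure_ge0.
move: (small k); rewrite -/L.
have := @level_step u L D _ mu u0 (L1 k) D1; rewrite -/L.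
move: IH; case: (leb (A u L)) => [a| |]// IH.
case: (leb (A u (2 * L))) => [b| |]//.
rewrite !lee_fin in IH *; move=> step am b0 a0 ba.
have [a00|an0] := eqVneq a 0.
  have -> : b = 0 by apply/le_anti; rewrite b0 -a00 ba.
  by rewrite mulr_ge0 ?powR_ge0// ltW.
have {an0}a0 : 0 < a by rewrite lt_neqAle eq_sym an0.
have [a1 ae] : a <= 1 /\ a <= eta `^ N%:R.
  by split; apply: (le_trans am); rewrite ge_min lexx ?orbT.
have := step a a0 a1 ae IH erefl.
move/le_trans => /(_ _ mod1); rewrite -EFinM lee_fin => h.
rewrite powRM ?(ltW L0)// powRN powRN.
have Lt : 0 < L `^ t by rewrite powR_gt0.
have t2 : 0 < 2 `^ t :> R by rewrite powR_gt0.
rewrite mulrA ler_pdivlMr// ler_pdivlMr//.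
have e : D = D `^ (1 - ts) * D `^ ts.
  by rewrite -powRD ?(gt_eqF D0) ?implybT// subrK powRr1// ltW.
have Dts : 0 < D `^ ts by rewrite powR_gt0.
rewrite powRN in h.
have {}h : b * L `^ t <= D `^ ts / c.
  rewrite ler_pdivlMr//.
  move: h; rewrite -[X in X <= _](_ : b * L `^ t * c / D `^ ts = _); last by ring.
  by rewrite ler_pdivrMr// mul1r.
rewrite e; apply: (@le_trans _ _ (2 `^ t / c * D `^ ts)); last first.
  by rewrite ler_wpM2r// ltW.
rewrite (_ : 2 `^ t / c * D `^ ts = D `^ ts / c * 2 `^ t); last by ring.
by rewrite ler_wpM2r// ltW.
Qed.

(** A weak form of the Sobolev inequality: functions vanishing off [Omega] and
    with modular at most 1 are bounded in the Lebesgue space of exponent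
    [r <= t - 1]. The measures of the dyadic level sets decay like the power
    [- t] of the level. *)
Lemma sobolev_bound (r : R) : 0 <= r -> r + 1 <= t -> exists2 C : R, 0 <= C &
  forall u, measurable_fun setT u -> (forall x, ~ Omega x -> u x = 0) ->
  (modular p s u <= 1%:E)%E ->
  (\int[leb]_(x in Omega) (`|u x| `^ r)%:E <= C%:E)%E.
Proof.
move=> r0 rt; have [Lam [D [Lam1 D1 decay]]] := level_decay.
have Lam0 : 0 < Lam by exact: lt_le_trans Lam1.
have D0 : 0 < D by exact: lt_le_trans D1.
have L1 k : 1 <= Lam * 2 ^+ k.
  by rewrite (le_trans Lam1)// ler_peMr ?(ltW Lam0)// exprn_ege1// ler1n.
have L0 k : 0 < Lam * 2 ^+ k by exact: lt_le_trans (L1 k).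
have [V V0 VE] : exists2 V : R, 0 <= V & leb Omega = V%:E.
  have := Omega_fin OB.
  have : (0 <= leb Omega)%E by exact: measure_ge0.
  by case: (leb Omega) => [V| |]// V0 _; exists V.
exists (Lam `^ r * V + 2 * (2 `^ r * D)).
  by rewrite addr_ge0// !mulr_ge0 ?powR_ge0// ltW.
move=> u mu u0 mod1.
pose f k x : \bar R := (((Lam * 2 ^+ k.+1) `^ r) * \1_(A u (Lam * 2 ^+ k)) x)%:E.
have f0 k x : (0 <= f k x)%E by rewrite lee_fin mulr_ge0 ?powR_ge0.
have mf k : measurable_fun Omega (f k).
  apply/measurable_EFinP; apply: measurable_funM => //.
  by apply: measurable_funTS; apply: measurable_indic; exact: measurable_level.
have ms : measurable_fun Omega (fun x => \sum_(k <oo) f k x)%E.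
  by apply: ge0_emeasurable_sum.
have s0 x : (0 <= \sum_(k <oo) f k x)%E by apply: nneseries_ge0.
apply: (@le_trans _ _ (\int[leb]_(x in Omega) ((Lam `^ r)%:E + \sum_(k <oo) f k x))%E).
  apply: ge0_le_integral => //.
  - apply/measurable_EFinP; apply: measurable_powR_fun => //.
    by apply: measurableT_comp => //; exact: measurable_funTS.
  - by apply: emeasurable_funD.
  move=> x Ox.
  have [ux|ux] := ltP `|u x| Lam.
    by rewrite (le_trans _ (leeDl _ _))// lee_fin powR_le// ltW.
  have [k /andP[uk1 uk2]] : exists k : nat,
      Lam * 2 ^+ k <= `|u x| < Lam * 2 ^+ k.+1.
    have ex : exists n : nat, `|u x| < Lam * 2 ^+ n.
      exists (Num.bound `|u x|); apply: lt_le_trans (ler_peMl _ Lam1).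
        apply: (lt_le_trans (archi_boundP (normr_ge0 _))).
        by rewrite -natrX ler_nat ltnW// ltn_expl.
      by rewrite exprn_ge0.
    case: (ex_minnP ex) => -[|n] un min.
      by move: un; rewrite expr0 mulr1 ltNge ux.
    exists n; rewrite un andbT leNgt; apply/negP => /min.
    by rewrite ltnn.
  apply: (@le_trans _ _ (f k x)).
    rewrite /f indicE mem_set ?mulr1; last by split.
    by rewrite lee_fin powR_le// ltW.
  apply: (@le_trans _ _ (\sum_(j <oo) f j x)%E); last first.
    by rewrite leeDr// lee_fin powR_ge0.
  apply: le_trans (nneseries_lim_ge k.+1 _); last by [].
  by rewrite big_nat_recr//= leeDr// sume_ge0.
rewrite ge0_integralD//; last by move=> x _; rewrite lee_fin powR_ge0.
have -> : (\int[leb]_(x in Omega) (Lam `^ r)%:E = (Lam `^ r * V)%:E)%E.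
  transitivity ((Lam `^ r)%:E * leb Omega)%E; first exact: integral_cst.
  by rewrite VE.
rewrite EFinD; apply: leeD; first by [].
rewrite integral_nneseries//.
apply: (@le_trans _ _ (\sum_(k <oo) ((2 `^ r * D) / 2 ^+ k)%:E)%E).
  apply: lee_nneseries => k _.
    by move=> _; apply: integral_ge0 => x _.
  under eq_integral do rewrite /f EFinM.
  rewrite ge0_integralZl//; last 2 first.
  - apply/measurable_EFinP; apply: measurable_funTS; apply: measurable_indic.
    exact: measurable_level.
  - by rewrite lee_fin powR_ge0.
  rewrite integral_level//.
  apply: (@le_trans _ _ (((Lam * 2 ^+ k.+1) `^ r)%:E *
       (D * (Lam * 2 ^+ k) `^ (- t))%:E)%E).
    by apply: lee_wpmul2l; [rewrite lee_fin powR_ge0|exact: decay].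
  rewrite -EFinM lee_fin exprS (mulrCA Lam).
  have Lk : 2 ^+ k <= Lam * 2 ^+ k by rewrite ler_peMl// exprn_ge0.
  move: (Lam * 2 ^+ k) (L0 k) (L1 k) Lk => L Lk0 Lk1 Lk.
  rewrite powRM ?(ltW Lk0)//.
  rewrite -!mulrA ler_wpM2l ?powR_ge0// mulrCA ler_wpM2l ?(ltW D0)//.
  rewrite -powRD ?(gt_eqF Lk0) ?implybT//.
  apply: (@le_trans _ _ (L `^ (-1))).
    by apply: ler_powR => //; lra.
  by rewrite powR_inv1 ?(ltW Lk0)// lef_pV2 ?posrE ?exprn_gt0.
have -> : (2 * (2 `^ r * D))%:E = (2 * (2 `^ r * D) / 2 ^+ 0)%:E.
  by rewrite expr0 divr1.
have := @cvg_geometric_eseries_half R (2 * (2 `^ r * D)) 0.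
move=> /(cvg_lim (@ereal_hausdorff R)) <-.
rewrite le_eqVlt; apply/orP; left; apply/eqP; apply: eq_eseriesr => k _.
congr EFin; rewrite addn1 natrX exprS; field.
by rewrite expf_neq0.
Qed.

End sobolev.

(** * Real integrals and the nonlocal energy *)

Section real_integrals.
Context d (T : measurableType d) {R : realType}.
Variable mu : {measure set T -> \bar R}.
Implicit Types (D : set T) (f g : T -> R).

Local Notation integ D f := (mu.-integrable D (EFin \o f)).

Lemma integ_add D f g : measurable D -> integ D f -> integ D g ->
  integ D (fun x => f x + g x).
Proof. by move=> mD; exact: integrableD. Qed.

Lemma integ_sub D f g : measurable D -> integ D f -> integ D g ->
  integ D (fun x => f x - g x).
Proof. by move=> mD; exact: integrableB. Qed.

Lemma integ_scale D (k : R) f : measurable D -> integ D f ->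
  integ D (fun x => k * f x).
Proof. by move=> mD; exact: integrableZl. Qed.

Lemma integ_meas D f : integ D f -> measurable_fun D f.
Proof. by move=> /integrableP[/measurable_EFinP]. Qed.

Lemma integ_le D f g : measurable D -> measurable_fun D f ->
  (forall x, D x -> `|f x| <= g x) -> integ D g -> integ D f.
Proof.
move=> mD mf fg; apply: le_integrable => //; first exact/measurable_EFinP.
by move=> x Dx; rewrite /= lee_fin (le_trans (fg x Dx))// ler_norm.
Qed.

Lemma integ_abs D f : measurable D -> integ D f -> integ D (fun x => `|f x|).
Proof.
move=> mD fi; apply: le_integrable (fi) => //.
  by apply/measurable_EFinP; apply: measurableT_comp => //; exact: integ_meas fi.
by move=> x Dx; rewrite /= normr_id.
Qed.

Lemma integ_bounded D f (M : R) : measurable D -> (mu D < +oo)%E ->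
  measurable_fun D f -> (forall x, D x -> `|f x| <= M) -> integ D f.
Proof.
move=> mD Doo mf fM; apply: measurable_bounded_integrable => //.
exists M; split; first exact: num_real.
by move=> y My x Dx /=; exact: le_trans (fM x Dx) (ltW My).
Qed.

Lemma integ_ge0 D f : measurable D -> measurable_fun D f ->
  (forall x, D x -> 0 <= f x) ->
  (\int[mu]_(x in D) (f x)%:E < +oo)%E -> integ D f.
Proof.
move=> mD mf f0 foo; apply/integrableP; split; first exact/measurable_EFinP.
rewrite (_ : (\int[mu]_(x in D) _)%E = (\int[mu]_(x in D) (f x)%:E)%E)//.
by apply: eq_integral => x /set_mem Dx; rewrite /= ger0_norm// f0.
Qed.

Lemma integ_ltoo D f : measurable D -> integ D f ->
  (\int[mu]_(x in D) (f x)%:E < +oo)%E.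
Proof. by move=> mD fi; exact: integrable_lty. Qed.

Lemma EFin_Rintegral D f : measurable D -> integ D f ->
  (\int[mu]_(x in D) f x)%:E = (\int[mu]_(x in D) (f x)%:E)%E.
Proof. by move=> mD fi; rewrite /Rintegral fineK//; exact: integrable_fin_num. Qed.

End real_integrals.

(** Continuity of the power at nonnegative points, zero included. *)
Lemma cvg_powR {R : realType} (e l : R) (u : nat -> R) : 0 < e ->
  (forall n, 0 <= u n) -> u @ \oo --> l -> (fun n => u n `^ e) @ \oo --> l `^ e.
Proof.
move=> e0 u0 ul.
have l0 : 0 <= l.
  by rewrite -(cvg_lim (@Rhausdorff R) ul); apply: limr_ge;
    [exact: cvgP ul|exact: nearW].
have [l00|ln0] := eqVneq l 0.
  rewrite l00 powR0 ?gt_eqF//; apply/cvgrPdist_lt => eps eps0.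
  have d0 : 0 < eps `^ e^-1 by rewrite powR_gt0.
  rewrite l00 in ul; move/cvgrPdist_lt : ul => /(_ _ d0).
  apply: filterS => n; rewrite !sub0r !normrN ger0_norm// => und.
  rewrite ger0_norm ?powR_ge0//.
  rewrite -[ltRHS](powRr1 (ltW eps0)) -[X in eps `^ X](mulVf (lt0r_neq0 e0)) powRrM.
  by apply: gt0_ltr_powR => //; rewrite nnegrE ?powR_ge0.
have {ln0}l0 : 0 < l by rewrite lt_neqAle eq_sym ln0.
apply: (@cvg_comp _ _ _ u (fun x : R => x `^ e) _ _ _ ul).
apply: (@differentiable_continuous _ _ _ l (@powR R ^~ e)).
apply/derivable1_diffP.
by apply: derivable_powR; rewrite in_itv/= andbT.
Qed.

Section energy.
Context {R : realType} {N : nat}.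
Local Notation RN := 'rV[R]_N.
Local Notation leb := (lebesgue_rV N : {sigma_finite_measure set RN -> \bar R}).
Local Notation leb2 := (leb \x leb)%E.
Context (p s : RN -> RN -> R) (pm pM : R) (H : admissible p s pm pM).
Implicit Types (u v : RN -> R) (z : RN * RN).

(** The energy density of the operator and the associated energy. *)
Definition edens u z : R :=
  `|u z.1 - u z.2| `^ p z.1 z.2 / (p z.1 z.2 * Defs.kernel p s z).

Definition Phi u : R := \int[leb2]_z edens u z.

Lemma edensE u z : edens u z = gdens p s u z / p z.1 z.2.
Proof. by rewrite /edens /gdens invfM mulrAC mulrA. Qed.

Lemma edens_ge0 u z : 0 <= edens u z.
Proof. by rewrite edensE divr_ge0 ?gdens_ge0// ltW// (p_gt0 H). Qed.

Lemma edens_le u z : edens u z <= gdens p s u z.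
Proof.
rewrite edensE ler_pdivrMr ?(p_gt0 H)// ler_peMr ?gdens_ge0//.
exact/ltW/(p_gt1 H).
Qed.

Lemma gdens_le u z : gdens p s u z <= pM * edens u z.
Proof.
rewrite edensE mulrCA ler_peMr ?gdens_ge0// ler_pdivlMr ?(p_gt0 H)// mul1r.
exact: p_le H _ _.
Qed.

Lemma measurable_edens u : measurable_fun setT u ->
  measurable_fun setT (edens u).
Proof.
move=> mu; rewrite (_ : edens u = fun z => gdens p s u z / p z.1 z.2); last first.
  by apply/funext => z; rewrite edensE.
have m1 := measurable_gdens H mu.
have m2 := p_measurable H.
exact: measurable_fun_div.
Qed.

Lemma integrable_edens u : measurable_fun setT u ->
  (modular p s u < +oo)%E -> leb2.-integrable setT (EFin \o edens u).
Proof.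
move=> mu fu; apply: integ_le (integrable_gdens H mu fu) => //.
  exact: measurable_edens.
by move=> z _; rewrite ger0_norm ?edens_ge0// edens_le.
Qed.

Lemma modular_lt_edens u : measurable_fun setT u ->
  (\int[leb2]_z (edens u z)%:E < +oo)%E -> (modular p s u < +oo)%E.
Proof.
move=> mu h; have ie : leb2.-integrable setT (EFin \o edens u).
  apply: integ_ge0 => //; first exact: measurable_edens.
  by move=> z _; exact: edens_ge0.
have := integ_ltoo measurableT (integ_scale pM measurableT ie); apply: le_lt_trans.
apply: ge0_le_integral => //.
- by move=> z _; rewrite lee_fin gdens_ge0.
- exact: (measurable_egdens H mu).
- apply/measurable_EFinP; apply: measurable_funM => //.
  exact: measurable_edens.
- by move=> z _; rewrite lee_fin gdens_le.
Qed.

Lemma eq_ae_Phi u v : measurable_fun setT u -> measurable_fun setT v ->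
  {ae leb, forall x, u x = v x} -> Phi u = Phi v.
Proof.
move=> mu mv uv; congr fine; apply: ae_eq_integral => //;
  try by apply/measurable_EFinP; exact: measurable_edens.
have h1 : {ae leb2, forall z, u z.1 = v z.1} := ae_prod1 leb uv.
have h2 : {ae leb2, forall z, u z.2 = v z.2} := ae_prod2 leb uv.
by apply: filterS2 h1 h2 => z e1 e2 _; rewrite /edens e1 e2.
Qed.

Lemma pmean_edens k u v z : 1 <= k -> k <= pm ->
  (forall x, 0 <= u x) -> (forall x, 0 <= v x) ->
  edens (fun x => pmean k (u x) (v x)) z <= (edens u z + edens v z) / 2.
Proof.
move=> k1 kp u0 v0; rewrite /edens -mulrDl mulrAC ler_wpM2r//.
  by rewrite invr_ge0 mulr_ge0 ?kernel_ge0// ltW// (p_gt0 H).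
by apply: pmean_hidden_convex => //; exact: le_trans kp (p_ge H _ _).
Qed.

End energy.

(** * Hidden convexity of the energy *)

(** The data of the reaction term [beta t^(alpha - 1) + b t^(r - 1)]. *)
Record reaction {R : realType} {N : nat} (Omega : set 'rV[R]_N)
    (pm pM : R) (alpha b : 'rV[R]_N -> R) (am aM r beta bM : R) : Prop :=
  Reaction {
  alpha_measurable : measurable_fun Omega alpha;
  am_gt2 : 2 < am;
  alpha_ge : forall x, Omega x -> am <= alpha x;
  alpha_le : forall x, Omega x -> alpha x <= aM;
  am_aM : am <= aM;
  aM_pm : aM < pm;
  pM_r : pM < r;
  beta_gt0 : 0 < beta;
  b_measurable : measurable_fun Omega b;
  bM_ge0 : 0 <= bM;
  b_le : forall x, Omega x -> `|b x| <= bM }.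

Section variational.
Context {R : realType} {N : nat}.
Local Notation RN := 'rV[R]_N.
Local Notation leb := (lebesgue_rV N : {sigma_finite_measure set RN -> \bar R}).
Local Notation leb2 := (leb \x leb)%E.
Context (p s : RN -> RN -> R) (pm pM : R) (H : admissible p s pm pM).
Context (Omega : set RN) (B : R) (OB : located Omega B).
Context (alpha b : RN -> R) (am aM r beta bM : R)
  (Q : reaction Omega pm pM alpha b am aM r beta bM).
Implicit Types (u v w : RN -> R) (z : RN * RN).
Local Notation kM := (@kmax R N pM B).

(** Primitive of the reaction term. *)
Definition reaction_prim (x : RN) (t : R) : R :=
  beta * (t `^ alpha x / alpha x) + b x * (t `^ r / r).

(** The contribution of the reaction to the energy. *)
Definition reaction_energy u : R := \int[leb]_(x in Omega) reaction_prim x (u x).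

(** The energy functional to be minimised. *)
Definition total_energy u : R := Phi p s u - reaction_energy u.

(** Functions of finite energy with values in the unit interval and vanishing
    off [Omega]. *)
Record unit_class u : Prop := UnitClass {
  uc_meas : measurable_fun setT u;
  uc_ge0 : forall x, 0 <= u x;
  uc_le1 : forall x, u x <= 1;
  uc_off : forall x, ~ Omega x -> u x = 0;
  uc_fin : (modular p s u < +oo)%E }.

Let mO : measurable Omega := mOmega OB.
Let Ooo : (leb Omega < +oo)%E := Omega_fin OB.

Lemma r_gt0 : 0 < r.
Proof.
by apply: lt_trans (pM_r Q); apply: lt_trans (pM_gt2 H).
Qed.

Lemma am_gt0 : 0 < am. Proof. by apply: lt_trans (am_gt2 Q). Qed.

Lemma alpha_gt0 x : Omega x -> 0 < alpha x.
Proof. by move=> Ox; apply: lt_le_trans am_gt0 (alpha_ge Q Ox). Qed.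

Lemma aM_gt0 : 0 < aM. Proof. exact: lt_le_trans am_gt0 (am_aM Q). Qed.

Lemma unit_powR_le1 (t e : R) : 0 <= t <= 1 -> 0 <= e -> t `^ e <= 1.
Proof. by move=> /andP[t0 t1] e0; have := powR_le e0 t0 t1; rewrite powR1. Qed.

Lemma measurable_prim u : measurable_fun Omega u ->
  measurable_fun Omega (fun x => reaction_prim x (u x)).
Proof.
move=> mu; have ma := alpha_measurable Q; have mb := b_measurable Q.
apply: measurable_funD; apply: measurable_funM => //.
  by apply: measurable_fun_div => //; exact: measurable_powR_fun.
apply: measurable_fun_div => //; apply: measurable_powR_fun => //.
Qed.

Lemma prim_norm_le x (t : R) : Omega x -> 0 <= t <= 1 ->
  `|reaction_prim x t| <= beta + bM.
Proof.
move=> Ox t01; have a0 := alpha_gt0 Ox; have r0 := r_gt0.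
have b0 := beta_gt0 Q.
apply: le_trans (ler_normD _ _) _; apply: lerD; rewrite normrM.
  rewrite gtr0_norm// ler_piMr ?(ltW b0)// ger0_norm ?divr_ge0 ?powR_ge0 ?(ltW a0)//.
  rewrite ler_pdivrMr// mul1r (le_trans (unit_powR_le1 t01 (ltW a0)))//.
  by rewrite (le_trans _ (alpha_ge Q Ox))// ltW// (lt_trans _ (am_gt2 Q))// ltr1n.
rewrite -[leRHS]mulr1; apply: ler_pM => //; first exact: (b_le Q Ox).
rewrite ger0_norm ?divr_ge0 ?powR_ge0 ?(ltW r0)//.
rewrite ler_pdivrMr// mul1r (le_trans (unit_powR_le1 t01 (ltW r0)))//.
have := pM_gt2 H; have := pM_r Q; lra.
Qed.

Lemma integrable_prim u : measurable_fun Omega u ->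
  (forall x, Omega x -> 0 <= u x <= 1) ->
  leb.-integrable Omega (EFin \o (fun x => reaction_prim x (u x))).
Proof.
move=> mu u01; apply: (@integ_bounded _ _ _ leb _ _ (beta + bM)) => //.
  exact: measurable_prim.
by move=> x Ox; apply: prim_norm_le => //; exact: u01.
Qed.

Lemma uc01 u x : unit_class u -> 0 <= u x <= 1.
Proof. by move=> uu; rewrite (uc_ge0 uu) (uc_le1 uu). Qed.

Lemma uc_measO u : unit_class u -> measurable_fun Omega u.
Proof. by move=> uu; apply: measurable_funTS; exact: uc_meas uu. Qed.

(** The order of the power means: strictly between [alpha] and [p], so that the
    reaction of order [alpha] is strictly concave along power means while the
    nonlocal energy is convex. *)
Definition mexp : R := (aM + pm) / 2.

Lemma mexp_bounds : [/\ 2 < mexp, aM < mexp & mexp < pm].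
Proof.
by have := am_gt2 Q; have := am_aM Q; have := aM_pm Q; rewrite /mexp; split; lra.
Qed.

Lemma mexp_gt0 : 0 < mexp.
Proof. by have [h _ _] := mexp_bounds; apply: lt_trans h. Qed.

(** The pointwise power mean of two functions. *)
Definition umean u v : RN -> R := fun x => pmean mexp (u x) (v x).

Lemma umean_class u v : unit_class u -> unit_class v -> unit_class (umean u v).
Proof.
move=> uu uv; have [k2 ka kp] := mexp_bounds; have k0 := mexp_gt0.
have mW : measurable_fun setT (umean u v).
  apply: measurable_powR_fun => //; apply: measurable_fun_div => //.
  by apply: measurable_funD; apply: measurable_powR_fun => //;
    [exact: uc_meas uu|exact: uc_meas uv].
split=> //.
- by move=> x; exact: pmean_ge0.
- move=> x; rewrite -(pmeanxx k0 ler01); apply: pmean_le => //.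
  + exact: (uc_ge0 uu).
  + exact: (uc_ge0 uv).
  + exact: (uc_le1 uu).
  + exact: (uc_le1 uv).
- by move=> x nOx; rewrite /umean (uc_off uu)// (uc_off uv)// pmeanxx.
apply: (modular_lt_edens H mW).
have ie := integrable_edens H (uc_meas uu) (uc_fin uu).
have ie' := integrable_edens H (uc_meas uv) (uc_fin uv).
have := integ_ltoo measurableT (integ_scale 2^-1 measurableT (integ_add measurableT ie ie')).
apply: le_lt_trans; apply: ge0_le_integral => //.
- by move=> z _; rewrite lee_fin (edens_ge0 H).
- by apply/measurable_EFinP; exact: (measurable_edens H mW).
- apply/measurable_EFinP; apply: measurable_funM => //.
  by apply: measurable_funD; [exact: integ_meas ie|exact: integ_meas ie'].
- move=> z _; rewrite lee_fin mulrC; apply: (pmean_edens H) => //.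
  + by rewrite (le_trans _ (ltW k2))// ler1n.
  + exact: ltW.
  + exact: uc_ge0 uu.
  + exact: uc_ge0 uv.
Qed.

(** The defect of convexity of the highest power. *)
Definition rgap u v x : R := (u x `^ r + v x `^ r) / 2 - umean u v x `^ r.

(** The constant of [powR_defect_le] for the exponents [r] and [p], relative to
    the order of the power means. *)
Definition gapC : R :=
  r / mexp * (r / mexp - 1) / (pm / mexp * (pm / mexp - 1)).

Lemma pmm_gt1 : 1 < pm / mexp.
Proof.
by have [_ _ kp] := mexp_bounds; rewrite ltr_pdivlMr ?mul1r// mexp_gt0.
Qed.

Lemma pmm_rm : pm / mexp < r / mexp.
Proof.
rewrite ltr_pM2r ?invr_gt0 ?mexp_gt0//.
by apply: le_lt_trans (pM_r Q); exact: le_trans (p_ge H 0 0) (p_le H 0 0).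
Qed.

Lemma gapC_gt0 : 0 < gapC.
Proof.
have h1 := pmm_gt1; have h2 := pmm_rm; rewrite /gapC.
by rewrite divr_gt0// mulr_gt0// ?subr_gt0//; lra.
Qed.

Lemma powR_mexp (t e : R) : (t `^ mexp) `^ (e / mexp) = t `^ e.
Proof. by rewrite -powRrM mulrC mulfVK// gt_eqF// mexp_gt0. Qed.

Lemma mpow01 (t : R) : 0 <= t <= 1 -> 0 <= t `^ mexp <= 1.
Proof. by move=> t01; rewrite powR_ge0 unit_powR_le1// ltW// mexp_gt0. Qed.

Lemma rgap_ge0 u v x : unit_class u -> unit_class v -> 0 <= rgap u v x.
Proof.
move=> uu uv; rewrite subr_ge0 /umean powR_pmean.
have rk : 1 <= r / mexp by have := pmm_gt1; have := pmm_rm; lra.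
apply: le_trans (powR_convex rk (powR_ge0 _ _) (powR_ge0 _ _)) _.
by rewrite !powR_mexp.
Qed.

Lemma rgap_le u v x y : unit_class u -> unit_class v ->
  rgap u v x <= gapC *
    ((u x `^ p x y + v x `^ p x y) / 2 - umean u v x `^ p x y).
Proof.
move=> uu uv; rewrite /rgap /umean !powR_pmean.
rewrite -(powR_mexp (u x) r) -(powR_mexp (v x) r).
rewrite -(powR_mexp (u x) (p x y)) -(powR_mexp (v x) (p x y)).
apply: powR_defect_le.
- exact: pmm_gt1.
- by rewrite ler_pM2r ?invr_gt0 ?mexp_gt0// (p_ge H).
- rewrite ler_pM2r ?invr_gt0 ?mexp_gt0// (le_trans (p_le H x y))// ltW//.
  exact: pM_r Q.
- by apply: mpow01; exact: uc01.
- by apply: mpow01; exact: uc01.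
Qed.

(** The coefficients of the gains in midpoint convexity: [gapD] comes from the
    interaction with the outer cube and absorbs the term of order [r], [gapB]
    comes from the strict concavity of the reaction of order [alpha]. *)
Definition gapD : R := (gapC * pM * kM)^-1.
Definition gapB : R := beta * (am / mexp * (1 - aM / mexp) / 8) / aM.

Lemma gapD_gt0 : 0 < gapD.
Proof.
rewrite /gapD invr_gt0; apply: mulr_gt0; last exact: (kmax_gt0 pM OB).
by apply: mulr_gt0; [exact: gapC_gt0|apply: lt_trans (pM_gt2 H)].
Qed.

Lemma am_mexp : 0 < am / mexp.
Proof. by rewrite divr_gt0 ?am_gt0 ?mexp_gt0. Qed.

Lemma aM_mexp : aM / mexp < 1.
Proof.
by have [_ h _] := mexp_bounds; rewrite ltr_pdivrMr ?mul1r// mexp_gt0.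
Qed.

Lemma gapB_gt0 : 0 < gapB.
Proof.
rewrite /gapB divr_gt0 ?aM_gt0// mulr_gt0 ?(beta_gt0 Q)// divr_gt0//.
by rewrite mulr_gt0 ?am_mexp// subr_gt0 aM_mexp.
Qed.

(** Against a point of the outer cube, where the functions vanish, the energy
    density is a power of order [p > mexp] and is strictly convex. *)
Lemma edens_midpoint_gain u v z : unit_class u -> unit_class v ->
  Omega z.1 -> outer_cube B z.2 ->
  gapD * rgap u v z.1 <=
    (edens p s u z + edens p s v z) / 2 - edens p s (umean u v) z.
Proof.
case: z => x y /= uu uv Ox Yy; have nOy := outer_cube_notin OB Yy.
have W := umean_class uu uv.
rewrite /edens/= (uc_off uu nOy) (uc_off uv nOy) (uc_off W nOy) !subr0.
rewrite !ger0_norm ?(uc_ge0 uu) ?(uc_ge0 uv) ?(uc_ge0 W)//.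
have := rgap_le x y uu uv.
have /andP[K0 K1] := outer_cube_kernel H OB Ox Yy.
have g0 := rgap_ge0 x uu uv.
have C0 := gapC_gt0; have P0 := p_gt0 H x y.
have pM0 : 0 < pM by apply: lt_trans (pM_gt2 H).
have km0 := kmax_gt0 pM OB.
set X := _ / 2 - _ => h.
have -> : (u x `^ p x y / (p x y * Defs.kernel p s (x, y)) +
  v x `^ p x y / (p x y * Defs.kernel p s (x, y))) / 2 -
  umean u v x `^ p x y / (p x y * Defs.kernel p s (x, y)) =
  X / (p x y * Defs.kernel p s (x, y)).
  by rewrite /X; field; rewrite (gt_eqF P0) (gt_eqF K0).
rewrite ler_pdivlMr; last by apply: mulr_gt0.
rewrite -[X in X <= _]mulrA /gapD ler_pdivrMl; last first.
  by apply: mulr_gt0 => //; apply: mulr_gt0.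
have PK : p x y * Defs.kernel p s (x, y) <= pM * kM.
  by apply: ler_pM => //; [exact: ltW|exact: ltW|exact: (p_le H)].
apply: (@le_trans _ _ (rgap u v x * (pM * kM))).
  by rewrite ler_wpM2l.
rewrite [leRHS](_ : _ = gapC * X * (pM * kM)); last by ring.
by rewrite ler_wpM2r// mulr_ge0// ltW.
Qed.

Lemma integrable_rgap u v : unit_class u -> unit_class v ->
  leb.-integrable Omega (EFin \o rgap u v).
Proof.
move=> uu uv; have W := umean_class uu uv.
apply: (@integ_bounded _ _ _ leb _ _ 1) => // [|x Ox].
  apply: measurable_funB; last first.
    by apply: measurable_powR_fun => //; exact: uc_measO.
  apply: measurable_fun_div => //; apply: measurable_funD;
    by apply: measurable_powR_fun => //; exact: uc_measO.
rewrite ger0_norm ?rgap_ge0// /rgap.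
have := unit_powR_le1 (uc01 x uu) (ltW r_gt0).
have := unit_powR_le1 (uc01 x uv) (ltW r_gt0).
by have := powR_ge0 (umean u v x) r; lra.
Qed.

Lemma Phi_midpoint u v : unit_class u -> unit_class v ->
  Phi p s (umean u v) + gapD * \int[leb]_(x in Omega) rgap u v x
    <= (Phi p s u + Phi p s v) / 2.
Proof.
move=> uu uv; have W := umean_class uu uv.
have iu := integrable_edens H (uc_meas uu) (uc_fin uu).
have iv := integrable_edens H (uc_meas uv) (uc_fin uv).
have iW := integrable_edens H (uc_meas W) (uc_fin W).
have iuv := integ_scale 2^-1 measurableT (integ_add measurableT iu iv).
have ih := integ_sub measurableT iuv iW.
have [k2 ka kp] := mexp_bounds.
have ig := integrable_rgap uu uv; have mg := integ_meas ig.
have g0 x : Omega x -> 0 <= gapD * rgap u v x.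
  by move=> _; rewrite mulr_ge0 ?(ltW gapD_gt0)// rgap_ge0.
have h0 z : 0 <= 2^-1 * (edens p s u z + edens p s v z) - edens p s (umean u v) z.
  rewrite subr_ge0 mulrC; apply: (pmean_edens H) => //.
  - by rewrite (le_trans _ (ltW k2))// ler1n.
  - exact: ltW.
  - exact: uc_ge0 uu.
  - exact: uc_ge0 uv.
have := outer_integral_ge OB (measurable_funM (measurable_cst gapD) mg) g0
  (integ_meas ih) h0.
have /[swap]/[apply] : {ae leb2, forall z, Omega z.1 -> outer_cube B z.2 ->
    gapD * rgap u v z.1 <=
    2^-1 * (edens p s u z + edens p s v z) - edens p s (umean u v) z}.
  by apply: aeW => z Oz Yz; rewrite (mulrC 2^-1); exact: edens_midpoint_gain.
have igD := integ_scale gapD mO ig.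
rewrite -(EFin_Rintegral mO igD) -(EFin_Rintegral measurableT ih) -EFinM lee_fin.
have iuvD := integ_add measurableT iu iv.
rewrite RintegralB// RintegralZl//.
rewrite RintegralZl// RintegralD//.
rewrite -/(Phi p s u) -/(Phi p s v) -/(Phi p s (umean u v)).
have I0 : 0 <= \int[leb]_(x in Omega) rgap u v x.
  by apply: Rintegral_ge0 => x _; exact: rgap_ge0.
have N1 : 1 <= 2 ^+ N :> R by rewrite exprn_ege1// ler1n.
have : gapD * (\int[leb]_(x in Omega) rgap u v x) <=
  2 ^+ N * (gapD * (\int[leb]_(x in Omega) rgap u v x)).
  by rewrite ler_peMl// mulr_ge0// ltW// gapD_gt0.
move: (Phi p s (umean u v)) (Phi p s u) (Phi p s v) (_ * Rintegral _ _ _).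
by move=> a1 a2 a3 a4; lra.
Qed.

Context (b_small : bM <= r * gapD).

Lemma prim_midpoint u v x : unit_class u -> unit_class v -> Omega x ->
  (reaction_prim x (u x) + reaction_prim x (v x)) / 2
    + gapB * (u x `^ mexp - v x `^ mexp) ^+ 2
    - gapD * rgap u v x <= reaction_prim x (umean u v x).
Proof.
move=> uu uv Ox.
have a0 := alpha_gt0 Ox; have r0 := r_gt0; have k0 := mexp_gt0.
have h1 : (u x `^ alpha x + v x `^ alpha x) / 2 +
    am / mexp * (1 - aM / mexp) / 8 * (u x `^ mexp - v x `^ mexp) ^+ 2 <=
    umean u v x `^ alpha x.
  rewrite /umean powR_pmean -(powR_mexp (u x) (alpha x)) -(powR_mexp (v x) (alpha x)).
  apply: powR_midpoint_concave.
  - exact: am_mexp.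
  - by rewrite ler_pM2r ?invr_gt0// (alpha_ge Q).
  - by rewrite ler_pM2r ?invr_gt0// (alpha_le Q).
  - exact: aM_mexp.
  - by apply: mpow01; exact: uc01.
  - by apply: mpow01; exact: uc01.
have g0 := rgap_ge0 x uu uv.
have h2 : - (gapD * rgap u v x) <= - (b x / r * rgap u v x).
  rewrite lerN2 ler_wpM2r// ler_pdivrMr// mulrC.
  by rewrite (le_trans _ b_small)// (le_trans (ler_norm _)) ?(b_le Q).
rewrite /reaction_prim.
set D2 := (_ - _) ^+ 2 in h1 *; set c0 := am / mexp * _ / 8 in h1.
have c00 : 0 <= c0.
  rewrite /c0 divr_ge0// mulr_ge0//; first exact: ltW am_mexp.
  by rewrite subr_ge0 ltW// aM_mexp.
have gE : gapB = beta / aM * c0 by rewrite /gapB -/c0 mulrAC.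
have D20 : 0 <= D2 by exact: sqr_ge0.
clearbody c0 D2.
have h3 : gapB * D2 <= beta / alpha x * (c0 * D2).
  rewrite gE -mulrA; apply: ler_wpM2r; first exact: mulr_ge0.
  apply: ler_wpM2l; first exact/ltW/(beta_gt0 Q).
  by rewrite lef_pV2 ?posrE ?aM_gt0// (alpha_le Q).
have ba0 : 0 <= beta / alpha x by rewrite divr_ge0 ?(ltW (beta_gt0 Q)) ?(ltW a0).
have := ler_wpM2l ba0 h1.
move: h2; rewrite /rgap.
have rn : r != 0 by rewrite gt_eqF.
have an : alpha x != 0 by rewrite gt_eqF.
set Ur := u x `^ r; set Vr := v x `^ r; set Wr := umean u v x `^ r.
set Ua := u x `^ alpha x in h1 *; set Va := v x `^ alpha x in h1 *.
set Wa := umean u v x `^ alpha x in h1 *.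
have -> : beta * (Ua / alpha x) = beta / alpha x * Ua by field.
have -> : beta * (Va / alpha x) = beta / alpha x * Va by field.
have -> : beta * (Wa / alpha x) = beta / alpha x * Wa by field.
have -> : b x * (Ur / r) = b x / r * Ur by field.
have -> : b x * (Vr / r) = b x / r * Vr by field.
have -> : b x * (Wr / r) = b x / r * Wr by field.
move: (beta / alpha x) (b x / r) (gapB * D2) (c0 * D2) gapD h3.
by move=> e1 e2 e3 e4 e5; lra.
Qed.

(** The energy is uniformly convex along power means, which replaces both
    compactness and weak lower semicontinuity in the direct method. *)
Lemma functional_midpoint u v : unit_class u -> unit_class v ->
  total_energy (umean u v)
    + gapB * \int[leb]_(x in Omega) ((u x `^ mexp - v x `^ mexp) ^+ 2)
    <= (total_energy u + total_energy v) / 2.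
Proof.
move=> uu uv; have W := umean_class uu uv.
have ig := integrable_rgap uu uv.
have iD : leb.-integrable Omega
    (EFin \o (fun x => (u x `^ mexp - v x `^ mexp) ^+ 2)).
  apply: (@integ_bounded _ _ _ leb _ _ 1) => // [|x Ox].
    apply: measurable_funX; apply: measurable_funB;
    by apply: measurable_powR_fun => //; exact: uc_measO.
  rewrite ger0_norm ?sqr_ge0//.
  have /andP[] := mpow01 (uc01 x uu); have /andP[] := mpow01 (uc01 x uv).
  nra.
have iP w : unit_class w -> leb.-integrable Omega (EFin \o (fun x => reaction_prim x (w x))).
  by move=> uw; apply: integrable_prim => [|x _]; [exact: uc_measO|exact: uc01].
have iuv := integ_scale 2^-1 mO (integ_add mO (iP u uu) (iP v uv)).
have iB := integ_scale gapB mO iD.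
have iG := integ_scale gapD mO ig.
have := @le_Rintegral _ _ _ leb _ _ _ mO
  (integ_sub mO (integ_add mO iuv iB) iG) (iP _ W).
have /[swap]/[apply] : forall x, Omega x -> 2^-1 * (reaction_prim x (u x) + reaction_prim x (v x)) +
    gapB * (u x `^ mexp - v x `^ mexp) ^+ 2 - gapD * rgap u v x <=
    reaction_prim x (umean u v x).
  by move=> x Ox; rewrite (mulrC 2^-1); exact: prim_midpoint.
rewrite RintegralB//; last exact: integ_add.
rewrite RintegralD// !RintegralZl//; last by apply: integ_add => //; exact: iP.
rewrite RintegralD//; [|exact: iP..].
have := Phi_midpoint uu uv.
rewrite /total_energy /reaction_energy.
move: (Phi p s (umean u v)) (Phi p s u) (Phi p s v) => a1 a2 a3.
move: (Rintegral _ _ _) (Rintegral _ _ _) (Rintegral _ _ _) (Rintegral _ _ _)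
  (Rintegral _ _ _) => a4 a5 a6 a7 a8; lra.
Qed.

End variational.

(** * Existence of a minimiser *)

Lemma cvg_EFin_comp {R : realType} (g : nat -> R) (l : R) :
  g @ \oo --> l -> (fun n => (g n)%:E) @ \oo --> l%:E.
Proof. by move=> gl; apply: cvg_EFin => //; exact: nearW. Qed.

Lemma cvg_norm_sub {R : realType} (f g : nat -> R) (a b : R) :
  f @ \oo --> a -> g @ \oo --> b ->
  (fun n => `|f n - g n|) @ \oo --> `|a - b|.
Proof. by move=> fa gb; apply: cvg_norm; exact: (cvgB fa gb). Qed.

Section fast_cauchy.
Context d (T : measurableType d) {R : realType}.
Variable mu : {measure set T -> \bar R}.

(** The sum of a series dominated by a geometric one of ratio one half. *)
Lemma nneseries_geometric_le (C : R) (f : nat -> \bar R) :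
  (forall n, 0 <= f n)%E -> (forall n, f n <= (C / 2 ^+ n)%:E)%E ->
  (\sum_(n <oo) f n <= (2 * C)%:E)%E.
Proof.
move=> f0 fC; apply: (@le_trans _ _ (\sum_(n <oo) (C / 2 ^+ n)%:E)%E).
  by apply: lee_nneseries.
have -> : (2 * C)%:E = (2 * C / 2 ^+ 0)%:E by rewrite expr0 divr1.
have := @cvg_geometric_eseries_half R (2 * C) 0.
move=> /(cvg_lim (@ereal_hausdorff R)) <-.
rewrite le_eqVlt; apply/orP; left; apply/eqP; apply: eq_eseriesr => k _.
congr EFin; rewrite addn1 natrX exprS; field.
by rewrite expf_neq0.
Qed.

(** A sequence whose increments have geometrically small integrals converges
    almost everywhere. *)
Lemma ae_cvg_fast_cauchy (D : set T) (v : nat -> T -> R) (C : R) :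
  measurable D -> (forall n, measurable_fun D (v n)) ->
  (forall n, \int[mu]_(x in D) (`|v n.+1 x - v n x|)%:E <= (C / 2 ^+ n)%:E)%E ->
  {ae mu, forall x, D x -> cvgn (fun n => v n x)}.
Proof.
move=> mD mv vC.
pose f n x : \bar R := (`|v n.+1 x - v n x|)%:E.
have mf n : measurable_fun D (f n).
  apply/measurable_EFinP; apply: measurableT_comp => //.
  exact: measurable_funB.
have f0 n x : D x -> (0 <= f n x)%E by move=> _; rewrite lee_fin.
have Sf : mu.-integrable D (fun x => \sum_(n <oo) f n x)%E.
  apply/integrableP; split.
    by apply: ge0_emeasurable_sum; [move=> n x Dx _; exact: f0|move=> n _; exact: mf].
  rewrite (eq_integral (fun x => \sum_(n <oo) f n x)%E); last first.
    move=> x /set_mem Dx; rewrite gee0_abs//.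
    by apply: nneseries_ge0 => n _ _; exact: f0.
  rewrite integral_nneseries//; apply: le_lt_trans (ltry (2 * C)).
  by apply: nneseries_geometric_le => // n; apply: integral_ge0 => x; exact: f0.
apply: filterS (integrable_ae mD Sf) => x /[apply] fin.
have cvs : cvgn (series (fun n => v n.+1 x - v n x)).
  apply: normed_cvg; apply: nondecreasing_is_cvgn.
    by apply: nondecreasing_series => n _ _ /=.
  exists (fine (\sum_(n <oo) f n x)%E) => _ [n _ <-].
  rewrite -lee_fin fineK// /series/= -sumEFin.
  have := @nneseries_lim_ge R (fun n => f n x) xpredT 0 n.
  by apply => k _ _; rewrite lee_fin.
rewrite (_ : (fun n => v n x) = fun n => v 0%N x + series (fun n => v n.+1 x - v n x) n).
  by apply: is_cvgD => //; exact: is_cvg_cst.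
apply/funext => n; rewrite (eq_sum_telescope (fun n => v n x) n); congr (_ + _).
Qed.

End fast_cauchy.

Section minimisation.
Context {R : realType} {N : nat}.
Local Notation RN := 'rV[R]_N.
Local Notation leb := (lebesgue_rV N : {sigma_finite_measure set RN -> \bar R}).
Local Notation leb2 := (leb \x leb)%E.
Context (p s : RN -> RN -> R) (pm pM : R) (H : admissible p s pm pM).
Context (Omega : set RN) (B : R) (OB : located Omega B).
Context (alpha b : RN -> R) (am aM r beta bM : R)
  (Q : reaction Omega pm pM alpha b am aM r beta bM).
Implicit Types (u v w : RN -> R) (z : RN * RN).
Local Notation kM := (@kmax R N pM B).
Local Notation mexp := (mexp pm aM).
Local Notation unit_class := (unit_class p s Omega).
Local Notation functional := (total_energy p s Omega alpha b r beta).
Local Notation Psi := (reaction_energy Omega alpha b r beta).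
Local Notation prim := (reaction_prim alpha b r beta).

Let mO : measurable Omega := mOmega OB.
Let Ooo : (leb Omega < +oo)%E := Omega_fin OB.

Lemma Phi_ge0 u : 0 <= Phi p s u.
Proof. by apply: Rintegral_ge0 => z _; exact: edens_ge0 H u z. Qed.

Lemma Psi_le u : unit_class u -> Psi u <= (beta + bM) * fine (leb Omega).
Proof.
move=> uu; rewrite /Psi -(Rintegral_cst leb mO).
have ip := integrable_prim H OB Q (uc_measO uu) (fun x _ => uc01 x uu).
apply: le_Rintegral => //.
  by apply: (@integ_bounded _ _ _ leb _ _ `|beta + bM|).
move=> x Ox; apply: le_trans (ler_norm _) _.
exact: (prim_norm_le H Q Ox (uc01 x uu)).
Qed.

Lemma unit_class0 : unit_class (fun=> 0).
Proof.
split=> //; rewrite /modular (eq_integral (cst 0%E)) ?integral0//.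
move=> z _; rewrite /gdens subrr normr0 powR0 ?mul0r//.
by rewrite gt_eqF// (p_gt0 H).
Qed.

Context (b_small : bM <= r * @gapD R N pm pM B aM r).

Lemma limn_einf_le_cvg (f : nat -> \bar R) (g : nat -> R) (l : R) :
  (forall n, f n <= (g n)%:E)%E -> g @ \oo --> l -> (limn_einf f <= l%:E)%E.
Proof.
move=> fg gl; have [<- _] := cvg_limn_einf_sup (cvg_EFin_comp gl).
rewrite !limn_einf_lim; apply: lee_lim; [exact: is_cvg_einfs|exact: is_cvg_einfs|].
apply: nearW => n; apply: le_ereal_inf_tmp => _ [k /= nk <-].
by apply: le_trans (fg k); apply: ereal_inf_lbound; exists k.
Qed.

(** The values of a bounded measurable sequence at its points of convergence. *)
Let ulim (v : nat -> RN -> R) (x : RN) : R :=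
  Num.min 1 (Num.max 0 (limn_sup (fun n => v n x))).

(** A minimising sequence with rate [8^(- n)] converges almost everywhere by
    uniform convexity; Fatou's lemma for the nonlocal energy and dominated
    convergence for the reaction show that its limit is a minimiser. *)
Lemma minimiser_exists : exists w, unit_class w /\
  forall u, unit_class u -> functional w <= functional u.
Proof.
have [k2 ka kp] := mexp_bounds Q; have k0 := mexp_gt0 Q.
pose S := [set functional u | u in unit_class].
have Slb : has_lbound S.
  exists (- ((beta + bM) * fine (leb Omega))) => _ [u uu <-].
  have := Psi_le uu; have := Phi_ge0 u; rewrite /functional.
  by move: (Phi p s u) (Psi u) => a1 a2; lra.
have S0 : S !=set0 by exists (functional (fun=> 0)), (fun=> 0) => //; exact: unit_class0.
pose m := inf S.
have mle u : unit_class u -> m <= functional u.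
  by move=> uu; apply: ge_inf => //; exists u.
(* The rate 8^(-n) makes the increments of the powers of order mexp summable. *)
have /choice[u_ hu_] : forall n : nat, exists u, unit_class u /\
    functional u < m + (8 ^+ n)^-1.
  move=> n; have e0 : 0 < (8 ^+ n)^-1 :> R by rewrite invr_gt0 exprn_gt0.
  by have [_ [u uu <-] ?] := inf_adherent e0 (conj S0 Slb); exists u.
have uu n := (hu_ n).1.
have uE n := (hu_ n).2.
pose v n x := u_ n x `^ mexp.
have mv n : measurable_fun setT (v n).
  by apply: measurable_powR_fun => //; exact: uc_meas (uu n).
have v01 n x : 0 <= v n x <= 1 by apply: (mpow01 Q); exact: uc01 (uu n).
have gB := gapB_gt0 Q.
set gapb := gapB _ _ _ _ in gB.
have V0 : 0 <= fine (leb Omega) by rewrite fine_ge0.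
have iD n : leb.-integrable Omega (EFin \o (fun x => (v n x - v n.+1 x) ^+ 2)).
  apply: (@integ_bounded _ _ _ leb _ _ 1) => // [|x Ox].
    by apply: measurable_funTS; apply: measurable_funX; exact: measurable_funB.
  rewrite ger0_norm ?sqr_ge0//.
  have /andP[] := v01 n x; have /andP[] := v01 n.+1 x; nra.
have sq n : \int[leb]_(x in Omega) ((v n x - v n.+1 x) ^+ 2) <= gapb^-1 / 8 ^+ n.
  have := functional_midpoint H OB Q b_small (uu n) (uu n.+1).
  have := mle _ (umean_class H Q (uu n) (uu n.+1)).
  have := uE n; have := uE n.+1.
  have : (8 ^+ n.+1)^-1 <= (8 ^+ n)^-1 :> R.
    rewrite lef_pV2 ?posrE ?exprn_gt0// ler_weXn2l// ler1n//.
  rewrite -/gapb -/(v n) mulrC ler_pdivlMr//.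
  move: (Rintegral _ _ _) (functional _) (functional _) (functional _).
  move=> I f0 f1 f2 le8 f2m f1m mf mid.
  rewrite mulrC ler_pdivlMr//; move: le8 f2m f1m mf mid.
  by move: (8 ^- n) (8 ^- n.+1) (I * gapb) => c1 c2 c3; lra.
pose C := fine (leb Omega) + gapb^-1.
have young n x : `|v n x - v n.+1 x| <= (2 ^+ n)^-1 + 2 ^+ n * (v n x - v n.+1 x) ^+ 2.
  have t0 : 0 < 2 ^+ n :> R by rewrite exprn_gt0.
  set X := v n x - v n.+1 x; rewrite -(real_normK (num_real X)).
  have : 0 <= (2 ^+ n)^-1 * (1 - 2 ^+ n * `|X|) ^+ 2.
    by rewrite mulr_ge0 ?sqr_ge0// invr_ge0 ltW.
  have -> : (2 ^+ n)^-1 * (1 - 2 ^+ n * `|X|) ^+ 2 =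
    (2 ^+ n)^-1 + 2 ^+ n * `|X| ^+ 2 - 2 * `|X| by field; rewrite gt_eqF.
  by have := normr_ge0 X; move: `|X| => y; lra.
have vC n : (\int[leb]_(x in Omega) (`|v n.+1 x - v n x|)%:E <= (C / 2 ^+ n)%:E)%E.
  have ic : leb.-integrable Omega (EFin \o (fun=> (2 ^+ n)^-1 : R)).
    by apply: (@integ_bounded _ _ _ leb _ _ `|(2 ^+ n)^-1|).
  have i2 := integ_add mO ic (integ_scale (2 ^+ n) mO (iD n)).
  have ia : leb.-integrable Omega (EFin \o (fun x => `|v n.+1 x - v n x|)).
    apply: integ_le i2 => // [|x Ox].
      apply: measurable_funTS; apply: measurableT_comp => //.
      exact: measurable_funB.
    by rewrite normr_id distrC; exact: young.
  rewrite -(EFin_Rintegral mO ia) lee_fin.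
  apply: (@le_trans _ _ (\int[leb]_(x in Omega)
      ((2 ^+ n)^-1 + 2 ^+ n * (v n x - v n.+1 x) ^+ 2))).
    by apply: le_Rintegral => // x Ox; rewrite distrC; exact: young.
  rewrite RintegralD//; last exact: integ_scale.
  rewrite RintegralZl// Rintegral_cst// /C mulrDl [X in X + _]mulrC.
  apply: lerD => //; apply: (@le_trans _ _ (2 ^+ n * (gapb^-1 / 8 ^+ n))).
    by rewrite ler_wpM2l ?exprn_ge0.
  rewrite mulrCA ler_wpM2l ?invr_ge0 ?(ltW gB)//.
  have -> : 8 ^+ n = 2 ^+ n * (2 ^+ n * 2 ^+ n) :> R.
    by rewrite -!exprMn; congr (_ ^+ _); lra.
  have n2 : 1 <= 2 ^+ n :> R by rewrite exprn_ege1// ler1n.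
  have n0 : 0 < 2 ^+ n :> R by rewrite exprn_gt0.
  rewrite invfM mulrA divff ?gt_eqF// mul1r.
  by rewrite lef_pV2 ?posrE ?mulr_gt0// ler_peMr// ltW.
have aecv := ae_cvg_fast_cauchy mO (fun n => measurable_funTS (mv n)) vC.
pose vl := ulim v.
pose w x := vl x `^ mexp^-1.
have vl01 x : 0 <= vl x <= 1.
  by rewrite /vl /ulim le_min ler01 le_max lexx ge_min lexx.
have mvl : measurable_fun setT vl.
  apply: measurable_minr => //; apply: measurable_maxr => //.
  apply: measurable_fun_limn_sup => // x _.
    by exists 1 => _ [n _ <-]; have /andP[] := v01 n x.
  by exists 0 => _ [n _ <-]; have /andP[] := v01 n x.
have mw : measurable_fun setT w by exact: measurable_powR_fun.
have w01 x : 0 <= w x <= 1.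
  by rewrite /w powR_ge0 unit_powR_le1// invr_ge0 ltW.
have cvgw x : cvgn (fun n => v n x) -> (fun n => u_ n x) @ \oo --> w x.
  move=> cv; have E : vl x = limn (fun n => v n x).
    rewrite /vl /ulim cvg_limn_supE// max_r; last first.
      by apply: limr_ge => //; apply: nearW => n; have /andP[] := v01 n x.
    by rewrite min_r//; apply: limr_le => //; apply: nearW => n; have /andP[] := v01 n x.
  have ki : 0 < mexp^-1 by rewrite invr_gt0.
  have v0 n : 0 <= v n x by have /andP[] := v01 n x.
  have := cvg_powR ki v0 cv; rewrite -E -/(w x).
  rewrite (_ : (fun n => _) = fun n => u_ n x)//; apply/funext => n.
  by rewrite powRK// (uc_ge0 (uu n)).
have woff x : ~ Omega x -> w x = 0.
  move=> nO; have v0 : (fun n => v n x) = fun=> 0.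
    by apply/funext => n; rewrite /v (uc_off (uu n))// powR0// gt_eqF.
  have cv : cvgn (fun n => v n x) by rewrite v0; exact: is_cvg_cst.
  have := cvgw x cv; rewrite (_ : (fun n => u_ n x) = fun=> 0); last first.
    by apply/funext => n; rewrite (uc_off (uu n)).
  move=> /(cvg_lim (@Rhausdorff R)) <-; exact: lim_cst.
have aeu : {ae leb, forall x, (fun n => u_ n x) @ \oo --> w x}.
  apply: filterS aecv => x cv; have [Ox|nO] := pselect (Omega x).
    exact/cvgw/cv.
  rewrite woff// (_ : (fun n => u_ n x) = fun=> 0); first exact: cvg_cst.
  by apply/funext => n; rewrite (uc_off (uu n)).
have ae1 : {ae leb2, forall z : RN * RN, (fun n => u_ n z.1) @ \oo --> w z.1} :=
  ae_prod1 leb aeu.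
have ae2 : {ae leb2, forall z : RN * RN, (fun n => u_ n z.2) @ \oo --> w z.2} :=
  ae_prod2 leb aeu.
have aee : {ae leb2, forall z, (fun n => edens p s (u_ n) z) @ \oo --> edens p s w z}.
  apply: filterS2 ae1 ae2 => z c1 c2; rewrite /edens.
  apply: cvgMl.
  exact: (cvg_powR (p_gt0 H _ _) (fun n => normr_ge0 _) (cvg_norm_sub c1 c2)).
have PsiC : (fun n => Psi (u_ n)) @ \oo --> Psi w.
  have ip n := integrable_prim H OB Q (uc_measO (uu n)) (fun x _ => uc01 x (uu n)).
  have iw := integrable_prim H OB Q (measurable_funTS mw) (fun x _ => w01 x).
  have [] := @dominated_convergence _ _ _ leb Omega mO
    (fun n x => (prim x (u_ n x))%:E) (fun x => (prim x (w x))%:E)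
    (fun=> (beta + bM)%:E).
  - by move=> n; apply/measurable_EFinP; exact: integ_meas (ip n).
  - by apply/measurable_EFinP; exact: integ_meas iw.
  - apply: filterS aeu => x cv Ox; apply: cvg_EFin_comp.
    have a0 := alpha_gt0 Q Ox; have r0 := r_gt0 H Q.
    have u0 n : 0 <= u_ n x by exact: uc_ge0 (uu n) x.
    apply: cvgD.
      apply: cvgMr; apply: cvgMl.
      exact: (cvg_powR a0 u0 cv).
    apply: cvgMr; apply: cvgMl.
    exact: (cvg_powR r0 u0 cv).
  - by apply: (@integ_bounded _ _ _ leb _ _ `|beta + bM|).
  - apply: aeW => x n Ox; rewrite lee_fin.
    exact: (prim_norm_le H Q Ox (uc01 x (uu n))).
  move=> _ _; rewrite -(EFin_Rintegral mO iw).
  rewrite (_ : [sequence _]_n = EFin \o (fun n => Psi (u_ n))); last first.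
    by apply/funext => n /=; rewrite /Psi (EFin_Rintegral mO (ip n)).
  by move/fine_cvg.
have ie n := integrable_edens H (uc_meas (uu n)) (uc_fin (uu n)).
have lim0 : (fun n : nat => (8 ^+ n)^-1 : R) @ \oo --> (0 : R).
  rewrite (_ : (fun n : nat => _) = (fun n => 8^-1 ^+ n)); last first.
    by apply/funext => n; rewrite exprVn.
  by apply: cvg_expr; rewrite ger0_norm ?invr_ge0// invf_lt1// ltr1n.
have fat : (\int[leb2]_z (edens p s w z)%:E <= (m + Psi w)%:E)%E.
  apply: (@le_trans _ _ (\int[leb2]_z limn_einf (fun n => (edens p s (u_ n) z)%:E))%E).
    rewrite le_eqVlt; apply/orP; left; apply/eqP; apply: ae_eq_integral => //.
    - by apply/measurable_EFinP; exact: (measurable_edens H mw).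
    - rewrite (_ : (fun z => _) = fun z => oppe
          (limn_esup (fun n => (- (edens p s (u_ n) z)%:E)%E))); last first.
        apply/funext => z.
        by rewrite -[in LHS](oppeK (limn_einf _)) -limn_esupN.
      apply: measurableT_comp => //; apply: measurable_fun_limn_esup => n.
      apply: measurableT_comp => //; apply/measurable_EFinP.
      exact: integ_meas (ie n).
    apply: filterS aee => z cv _.
    have [-> _] := cvg_limn_einf_sup (cvg_EFin_comp cv).
    by [].
  apply: le_trans (fatou _ _ _ _) _ => //.
  - by move=> n; apply/measurable_EFinP; exact: integ_meas (ie n).
  - by move=> n z _; rewrite lee_fin (edens_ge0 H).
  apply: (@limn_einf_le_cvg _ (fun n => m + (8 ^+ n)^-1 + Psi (u_ n))).
    move=> n; rewrite -(EFin_Rintegral measurableT (ie n)) lee_fin -/(Phi p s (u_ n)).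
    have := uE n; rewrite /functional; move: (Phi _ _ _) (Psi _) => a1 a2; lra.
  rewrite -[X in _ --> X + _]addr0; apply: cvgD => //; apply: cvgD => //.
  exact: cvg_cst.
have wfin : (modular p s w < +oo)%E.
  by apply: (modular_lt_edens H mw); exact: le_lt_trans fat (ltry _).
have wu : unit_class w.
  by split=> // x; have /andP[] := w01 x.
exists w; split=> [|u uu']; first exact: wu.
have iw := integrable_edens H mw wfin.
move: fat; rewrite -(EFin_Rintegral measurableT iw) lee_fin -/(Phi p s w) => fat.
apply: le_trans (mle u uu'); rewrite /functional lerBlDr; exact: fat.
Qed.

End minimisation.

(** * Taylor expansion of the nonlocal energy *)

(** Integration of a pointwise first order expansion. *)
Lemma Rintegral_taylor d (T : measurableType d) {R : realType}
    (mu : {measure set T -> \bar R}) D (f1 f2 f3 g : T -> R) (e k : R) :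
  measurable D -> measurable_fun D f1 ->
  mu.-integrable D (EFin \o f2) -> mu.-integrable D (EFin \o f3) ->
  mu.-integrable D (EFin \o g) ->
  (forall x, D x -> `|f1 x - f2 x - e * f3 x| <= k * g x) ->
  mu.-integrable D (EFin \o f1) /\
  `|\int[mu]_(x in D) f1 x - \int[mu]_(x in D) f2 x
      - e * \int[mu]_(x in D) f3 x| <= k * \int[mu]_(x in D) g x.
Proof.
move=> mD m1 i2 i3 ig le.
have ik := integ_scale k mD ig; have i3e := integ_scale e mD i3.
have i1 : mu.-integrable D (EFin \o f1).
  have ib := integ_add mD (integ_add mD (integ_abs mD i2) (integ_abs mD i3e)) ik.
  apply: (integ_le mD m1 _ ib) => x Dx.
  rewrite (_ : f1 x = f2 x + e * f3 x + (f1 x - f2 x - e * f3 x)); last by ring.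
  apply: le_trans (ler_normD _ _) _; apply: lerD; last exact: le.
  exact: ler_normD.
split=> //.
have i12 := integ_sub mD i1 i2; have i123 := integ_sub mD i12 i3e.
rewrite -(RintegralZl e mD i3) -(RintegralB mD i1 i2) -(RintegralB mD i12 i3e).
rewrite -(RintegralZl k mD ig); apply: le_trans (le_normr_Rintegral mD i123) _.
by apply: le_Rintegral => //; exact: integ_abs.
Qed.

Section Phi_taylor.
Context {R : realType} {N : nat}.
Local Notation RN := 'rV[R]_N.
Local Notation leb := (lebesgue_rV N : {sigma_finite_measure set RN -> \bar R}).
Local Notation leb2 := (leb \x leb)%E.
Context (p s : RN -> RN -> R) (pm pM : R) (H : admissible p s pm pM).
Implicit Types (u v w : RN -> R) (z : RN * RN).

Lemma powR_max_le_add (P a b : R) : 0 <= a -> 0 <= b ->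
  Num.max a b `^ P <= a `^ P + b `^ P.
Proof.
move=> a0 b0; have [_|_] := leP a b; first by rewrite lerDr powR_ge0.
by rewrite lerDl powR_ge0.
Qed.

Lemma increment_powR_le (P a b e : R) : 2 < P -> 0 <= e <= 1 ->
  (`|a| + `|a + e * b|) `^ (P - 2) * (e * b) ^+ 2
    <= 3 `^ (P - 2) * e ^+ 2 * (`|a| `^ P + `|b| `^ P).
Proof.
move=> P2 /andP[e0 e1]; have P20 : 0 < P - 2 by rewrite subr_gt0.
pose M : R := Num.max `|a| `|b|.
have M0 : 0 <= M by rewrite /M le_max normr_ge0.
have aM : `|a| <= M by rewrite /M le_max lexx.
have bM : `|b| <= M by rewrite /M le_max lexx orbT.
have s3 : `|a| + `|a + e * b| <= 3 * M.
  have := ler_normD a (e * b); rewrite normrM (ger0_norm e0).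
  have : e * `|b| <= `|b| by rewrite ler_piMl.
  by move: (`|a + e * b|) => X; lra.
have MP : M `^ (P - 2) * M ^+ 2 = M `^ P.
  rewrite -powR_mulrn// -powRD; first by rewrite subrK.
  by rewrite subrK (gt_eqF (lt_trans _ P2)).
have b2 : b ^+ 2 <= M ^+ 2.
  by rewrite -(real_normK (num_real b)) ler_sqr ?nnegrE.
rewrite exprMn; apply: (@le_trans _ _ ((3 * M) `^ (P - 2) * (e ^+ 2 * M ^+ 2))).
  apply: ler_pM; first exact: powR_ge0.
  - by rewrite -exprMn sqr_ge0.
  - apply: (powR_le (ltW P20) _ s3); exact: addr_ge0.
  by apply: ler_wpM2l => //; exact: sqr_ge0.
rewrite powRM// -mulrA [X in _ * X]mulrCA MP mulrA ler_wpM2l//.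
  by rewrite mulr_ge0 ?powR_ge0 ?sqr_ge0.
exact: powR_max_le_add.
Qed.

(** Increments are measured by the sum of two powers, which is the form that
    integrates into modulars. *)
Lemma spow_taylor_scale (P a b e : R) : 2 < P -> 0 <= e <= 1 ->
  `| `|a + e * b| `^ P / P - `|a| `^ P / P - e * (spow P a * b)|
    <= (P - 1) * 3 `^ (P - 2) * e ^+ 2 * (`|a| `^ P + `|b| `^ P).
Proof.
move=> P2 e01; have P1 : 1 < P by lra.
have := spow_tangent a (a + e * b) P1.
have := spow_taylor a (a + e * b) (ltW P2).
rewrite (_ : a + e * b - a = e * b); last by lra.
rewrite mulrCA => up lo; rewrite ger0_norm; last by move: lo; lra.
apply: le_trans up _; rewrite -!(mulrA (P - 1)).
by rewrite ler_wpM2l ?increment_powR_le// subr_ge0 ltW.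
Qed.

Lemma npart_taylor_scale (P a b e : R) : 2 < P -> 0 <= e <= 1 ->
  `|npart (a + e * b) `^ P / P - npart a `^ P / P
     - e * - (npart a `^ (P - 1) * b)|
    <= (P - 1) * 3 `^ (P - 2) * e ^+ 2 * (`|a| `^ P + `|b| `^ P).
Proof.
move=> P2 e01; have P1 : 1 < P by lra.
have := npart_taylor a (a + e * b) (ltW P2).
rewrite (_ : a + e * b - a = e * b); last by lra.
rewrite mulrCA mulrN opprK => up; apply: le_trans up _; rewrite -!(mulrA (P - 1)).
by rewrite ler_wpM2l ?increment_powR_le// subr_ge0 ltW.
Qed.

(** The constant in the Taylor estimate of the nonlocal energy. *)
Definition taylorC : R := (pM - 1) * 3 `^ (pM - 2).

Lemma taylorC_ge0 : 0 <= taylorC.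
Proof. by rewrite mulr_ge0 ?powR_ge0// subr_ge0; have := pM_gt2 H; lra. Qed.

Lemma weak_lhsE u v z :
  weak_lhs p s u v z =
  spow (p z.1 z.2) (u z.1 - u z.2) * (v z.1 - v z.2) / Defs.kernel p s z.
Proof. by []. Qed.

Lemma edens_taylor u v (e : R) z : 0 <= e <= 1 ->
  `|edens p s (fun x => u x + e * v x) z - edens p s u z
     - e * weak_lhs p s u v z|
    <= taylorC * e ^+ 2 * (gdens p s u z + gdens p s v z).
Proof.
move=> e01; rewrite weak_lhsE /edens /gdens.
set P := p z.1 z.2; set K := Defs.kernel p s z.
have K0 : 0 <= K^-1 by rewrite invr_ge0 kernel_ge0.
have P2 : 2 < P := p_gt2 H _ _.
have PM : P <= pM := p_le H _ _.
set a := u z.1 - u z.2; set b := v z.1 - v z.2.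
have -> : u z.1 + e * v z.1 - (u z.2 + e * v z.2) = a + e * b.
  by rewrite /a /b; ring.
rewrite !invfM.
have -> : `|a + e * b| `^ P * (P^-1 / K) - `|a| `^ P * (P^-1 / K)
    - e * (spow P a * b / K) = (`|a + e * b| `^ P / P - `|a| `^ P / P
  - e * (spow P a * b)) / K by ring.
have -> : taylorC * e ^+ 2 * (`|a| `^ P / K + `|b| `^ P / K) =
  taylorC * e ^+ 2 * (`|a| `^ P + `|b| `^ P) / K by ring.
rewrite normrM (ger0_norm K0) ler_wpM2r//.
apply: le_trans (spow_taylor_scale a b P2 e01) _.
rewrite ler_wpM2r ?addr_ge0 ?powR_ge0// ler_wpM2r ?sqr_ge0//.
apply: ler_pM; rewrite ?powR_ge0//; [lra|lra|].
by rewrite ler_powR ?ler1n// lerD2r.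
Qed.

Lemma weak_lhs_le u v z :
  `|weak_lhs p s u v z| <= gdens p s u z + gdens p s v z.
Proof.
rewrite weak_lhsE /gdens.
set P := p z.1 z.2; set K := Defs.kernel p s z.
have K0 : 0 <= K^-1 by rewrite invr_ge0 kernel_ge0.
have P2 : 2 < P := p_gt2 H _ _.
have P1 : 1 < P by lra.
set a := u z.1 - u z.2; set b := v z.1 - v z.2.
rewrite normrM (ger0_norm K0) -mulrDl ler_wpM2r// normrM spow_norm//.
pose M : R := Num.max `|a| `|b|.
have aM : `|a| <= M by rewrite /M le_max lexx.
have bM : `|b| <= M by rewrite /M le_max lexx orbT.
have M0 : 0 <= M by rewrite /M le_max normr_ge0.
apply: le_trans (powR_max_le_add _ (normr_ge0 a) (normr_ge0 b)).
rewrite -/M -(@mulr_powRB1 _ M)//; last by lra.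
rewrite [leRHS]mulrC; apply: ler_pM => //.
by apply: powR_le => //; lra.
Qed.

Lemma measurable_weak_lhs u v : measurable_fun setT u -> measurable_fun setT v ->
  measurable_fun setT (weak_lhs p s u v).
Proof.
move=> mu mv; pose n z : R := `|u z.1 - u z.2| `^ (p z.1 z.2 - 2)
  * (u z.1 - u z.2) * (v z.1 - v z.2).
rewrite (_ : weak_lhs p s u v = fun z => n z / Defs.kernel p s z)//.
apply: measurable_fun_div; last exact: (measurable_gagliardo_kernel H).
have ma := measurable_increment mu; have mb := measurable_increment mv.
apply: measurable_funM => //; apply: measurable_funM => //.
apply: measurable_powR_fun; first exact: measurableT_comp.
by apply: measurable_funB => //; exact: (p_measurable H).
Qed.

Lemma integrable_weak_lhs u v :
  measurable_fun setT u -> (modular p s u < +oo)%E ->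
  measurable_fun setT v -> (modular p s v < +oo)%E ->
  leb2.-integrable setT (EFin \o weak_lhs p s u v).
Proof.
move=> mu fu mv fv.
apply: (integ_le measurableT (measurable_weak_lhs mu mv)
  (fun z _ => weak_lhs_le u v z)).
exact: (integ_add measurableT (integrable_gdens H mu fu)
  (integrable_gdens H mv fv)).
Qed.

(** The Gateaux derivative of [Phi] with a quantitative remainder. *)
Lemma Phi_taylor u v (e : R) :
  measurable_fun setT u -> (modular p s u < +oo)%E ->
  measurable_fun setT v -> (modular p s v < +oo)%E -> 0 <= e <= 1 ->
  `|Phi p s (fun x => u x + e * v x) - Phi p s u
     - e * \int[leb2]_z weak_lhs p s u v z|
    <= taylorC * e ^+ 2 * (fine (modular p s u) + fine (modular p s v)).
Proof.
move=> mu fu mv fv e01.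
have mT : measurable [set: RN * RN] := measurableT.
have e0 : 0 <= e by case/andP: e01.
have mev : measurable_fun setT (fun x => e * v x) by exact: measurable_funM.
have i1 := integrable_edens H (measurable_funD mu mev)
  (modular_add_fin H mu mev fu (modular_scale_fin H mv e0 fv)).
have i2 := integrable_edens H mu fu.
have i4 := integrable_gdens H mu fu.
have i5 := integrable_gdens H mv fv.
have [_ le] := Rintegral_taylor mT (integ_meas i1) i2
  (integrable_weak_lhs mu fu mv fv) (integ_add mT i4 i5)
  (fun z _ => edens_taylor u v z e01).
by apply: le_trans le _; rewrite (RintegralD mT i4 i5).
Qed.

End Phi_taylor.

(** * Truncated variations and the Euler equation *)

Lemma ge0_of_quadratic {R : realType} (D K : R) :
  (forall t : R, 0 < t <= 1 -> 0 <= t * D + t ^+ 2 * K) -> 0 <= D.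
Proof.
move=> h; rewrite leNgt; apply/negP => D0.
have K1 : 0 < 2 * (1 + `|K|) by rewrite mulr_gt0// ltr_pwDl.
pose t := Num.min 1 (- D / (2 * (1 + `|K|))).
have t0 : 0 < t by rewrite lt_min ltr01 divr_gt0// oppr_gt0.
have t1 : t <= 1 by rewrite ge_min lexx.
have := h t; rewrite t0 t1 => /(_ isT).
have tK : t * (2 * (1 + `|K|)) <= - D by rewrite -ler_pdivlMr// ge_min lexx orbT.
rewrite expr2 -mulrA -mulrDr pmulr_rge0//.
have := ler_norm K; have := normr_ge0 K; move: tK; move: `|K| => k; nra.
Qed.

Lemma euler_arith {R : realType} (Pc Pw Pu Iw Ic I W V J M k a t T C : R) :
  k * J <= Pu - Pc -> a * J <= k * J ->
  Iw + t * I - C * t ^+ 2 * V <= Ic + a * J -> Pw - Iw <= Pc - Ic ->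
  `|Pu - Pw - t * W| <= T * t ^+ 2 * M ->
  0 <= t * (W - I) + t ^+ 2 * (T * M + C * V).
Proof.
move=> h1 h2 h3 h4 h5; have := le_trans (ler_norm _) h5.
by move: h1 h2 h3 h4 => {h5}; move: (t ^+ 2) => t2; lra.
Qed.

Lemma Rintegral_le_combination d (T : measurableType d) {R : realType}
    (mu : {measure set T -> \bar R}) D (f1 f2 f3 g1 g2 : T -> R) (a k l : R) :
  measurable D ->
  mu.-integrable D (EFin \o f1) -> mu.-integrable D (EFin \o f2) ->
  mu.-integrable D (EFin \o f3) -> mu.-integrable D (EFin \o g1) ->
  mu.-integrable D (EFin \o g2) ->
  (forall x, D x -> f1 x + a * f2 x - k * f3 x <= g1 x + l * g2 x) ->
  \int[mu]_(x in D) f1 x + a * \int[mu]_(x in D) f2 x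
    - k * \int[mu]_(x in D) f3 x
  <= \int[mu]_(x in D) g1 x + l * \int[mu]_(x in D) g2 x.
Proof.
move=> mD i1 i2 i3 j1 j2 le.
have s2 := integ_scale a mD i2; have s3 := integ_scale k mD i3.
have s12 := integ_add mD i1 s2; have t2 := integ_scale l mD j2.
rewrite -(RintegralZl a mD i2) -(RintegralZl k mD i3) -(RintegralZl l mD j2).
rewrite -(RintegralD mD i1 s2) -(RintegralB mD s12 s3) -(RintegralD mD j1 t2).
by apply: le_Rintegral => //; [exact: integ_sub|exact: integ_add].
Qed.

(** Truncation to the unit interval. *)
Definition clamp {R : realType} (t : R) : R := Num.min 1 (Num.max 0 t).

Section clamp.
Context {R : realType}.
Implicit Types a b t : R.

Lemma clamp01 t : 0 <= clamp t <= 1.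
Proof. by rewrite /clamp le_min ler01 le_max lexx ge_min lexx. Qed.

Lemma clamp_case t : [\/ t < 0 /\ clamp t = 0, 0 <= t <= 1 /\ clamp t = t |
  1 < t /\ clamp t = 1].
Proof.
have [t0|t0] := boolP (t < 0).
  by constructor 1; split=> //; rewrite /clamp max_l ?ltW// min_r.
rewrite -leNgt in t0; have [t1|t1] := boolP (t <= 1).
  by constructor 2; split; [exact/andP|rewrite /clamp max_r// min_r].
rewrite -ltNge in t1.
by constructor 3; split=> //; rewrite /clamp max_r// min_l ?ltW.
Qed.

Lemma clamp_lipschitz a b : `|clamp a - clamp b| <= `|a - b|.
Proof.
have [[? ->]|[/andP[? ?] ->]|[? ->]] := clamp_case a;
have [[? ->]|[/andP[? ?] ->]|[? ->]] := clamp_case b => //; rewrite ?subrr ?normr0//.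
- rewrite ler0_norm ?ler0_norm; lra.
- rewrite ler0_norm ?ler0_norm; lra.
- rewrite ger0_norm ?ger0_norm; lra.
- rewrite ler0_norm ?ler0_norm; lra.
- rewrite ger0_norm ?ger0_norm; lra.
- rewrite ger0_norm ?ger0_norm; lra.
Qed.

Lemma clamp_id t : 0 <= t <= 1 -> clamp t = t.
Proof. by move=> /andP[t0 t1]; rewrite /clamp max_r// min_r. Qed.

End clamp.

Section euler.
Context {R : realType} {N : nat}.
Local Notation RN := 'rV[R]_N.
Local Notation leb := (lebesgue_rV N : {sigma_finite_measure set RN -> \bar R}).
Local Notation leb2 := (leb \x leb)%E.
Context (p s : RN -> RN -> R) (pm pM : R) (H : admissible p s pm pM).
Context (Omega : set RN) (B : R) (OB : located Omega B).
Context (alpha b : RN -> R) (am aM r beta bM : R)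
  (Q : reaction Omega pm pM alpha b am aM r beta bM).
Implicit Types (u v w : RN -> R) (z : RN * RN).
Local Notation kM := (@kmax R N pM B).
Local Notation unit_class := (unit_class p s Omega).
Local Notation functional := (total_energy p s Omega alpha b r beta).
Local Notation Psi := (reaction_energy Omega alpha b r beta).
Local Notation prim := (reaction_prim alpha b r beta).

Let mO : measurable Omega := mOmega OB.
Let Ooo : (leb Omega < +oo)%E := Omega_fin OB.

Lemma gdensN u z : gdens p s (fun x => - u x) z = gdens p s u z.
Proof. by rewrite /gdens -opprD normrN. Qed.

Lemma modularN u : modular p s (fun x => - u x)%R = modular p s u.
Proof. by apply: eq_integral => z _; rewrite gdensN. Qed.

(** The reaction term. *)
Definition react (x : RN) (t : R) : R :=
  beta * t `^ (alpha x - 1) + b x * t `^ (r - 1).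

(** The constant of the quadratic error in [prim_clamp_ge]. *)
Definition reactC : R := bM * ((r - 1) * 2 `^ (r - 2) + 1).

Lemma r_gt2 : 2 < r.
Proof. by apply: lt_trans (pM_r Q); exact: (pM_gt2 H). Qed.

Lemma alpha_gt2 x : Omega x -> 2 < alpha x.
Proof. by move=> Ox; apply: lt_le_trans (alpha_ge Q Ox); exact: am_gt2 Q. Qed.

Lemma react_norm_le x (t : R) : Omega x -> 0 <= t <= 1 ->
  `|react x t| <= beta + bM.
Proof.
move=> Ox t01; have a2 := alpha_gt2 Ox; have r2 := r_gt2.
have b0 := beta_gt0 Q.
apply: le_trans (ler_normD _ _) _; apply: lerD; rewrite normrM.
  rewrite gtr0_norm// ger0_norm ?powR_ge0// ler_piMr ?(ltW b0)//.
  by apply: unit_powR_le1 => //; lra.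
rewrite -[leRHS]mulr1; apply: ler_pM => //; first exact: (b_le Q Ox).
by rewrite ger0_norm ?powR_ge0//; apply: unit_powR_le1 => //; lra.
Qed.

Lemma measurable_react u : measurable_fun Omega u ->
  measurable_fun Omega (fun x => react x (u x)).
Proof.
move=> mu; have ma := alpha_measurable Q; have mb := b_measurable Q.
apply: measurable_funD; apply: measurable_funM => //;
  apply: measurable_powR_fun => //; exact: measurable_funB.
Qed.

Lemma reaction_clamp x (t e : R) : Omega x -> 0 <= t <= 1 ->
  - ((beta + bM) * Num.max (t + e - 1) 0 + bM * e ^+ 2)
    <= react x t * (clamp (t + e) - (t + e)).
Proof.
move=> Ox t01; have a2 := alpha_gt2 Ox; have r2 := r_gt2.
have b0 := beta_gt0 Q; have bM0 := bM_ge0 Q; have bM' := b_le Q Ox.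
have rn := react_norm_le Ox t01; have/andP[t0 t1] := t01.
have e2 : 0 <= bM * e ^+ 2 by rewrite mulr_ge0 ?sqr_ge0.
have [[n0 ->]|[/andP[? ?] ->]|[n1 ->]] := clamp_case (t + e).
- rewrite max_r; last by lra.
  rewrite mulr0 add0r sub0r.
  have te : t <= - e by lra.
  have tr : t `^ (r - 1) <= t.
    rewrite -mulr_powRB1//; last by lra.
    by rewrite ler_piMr//; apply: unit_powR_le1 => //; lra.
  rewrite /react mulrDl -[leLHS]add0r; apply: lerD.
    by rewrite mulr_ge0 ?mulr_ge0 ?powR_ge0 ?(ltW b0)//; lra.
  rewrite lerNl -mulrN; apply: le_trans (ler_norm _) _.
  rewrite normrM normrM -mulrA; apply: ler_pM => //.
  rewrite ger0_norm ?powR_ge0// opprK ler0_norm; last by lra.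
  have -> : e ^+ 2 = - e * - e by rewrite mulrNN expr2.
  apply: ler_pM; first exact: powR_ge0.
  - by rewrite oppr_ge0 ltW.
  - exact: le_trans tr te.
  by rewrite lerN2 lerDr.
- rewrite subrr mulr0 max_r; last by lra.
  by rewrite mulr0 add0r oppr_le0.
rewrite max_l; last by lra.
have h : 0 <= t + e - 1 by lra.
have := ler_norm (react x t).
move: rn e2 h; move: (react x t) (`|react x t|) (bM * e ^+ 2) => g n E nM E0 h gn.
  have : g * (t + e - 1) <= (beta + bM) * (t + e - 1).
    by rewrite ler_wpM2r// (le_trans gn).
  by move: E0 => {}E0 hh; lra.
Qed.

(** First order expansion of the primitive along a truncated variation. What is
    lost by truncating at height one is charged to the excess over one. *)
Lemma prim_clamp_ge x (t e : R) : Omega x -> 0 <= t <= 1 ->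
  prim x t + react x t * e - reactC * e ^+ 2
    <= prim x (clamp (t + e)) + (beta + bM) * Num.max (t + e - 1) 0.
Proof.
move=> Ox t01; have a2 := alpha_gt2 Ox; have r2 := r_gt2.
have b0 := beta_gt0 Q; have bM0 := bM_ge0 Q; have bM' := b_le Q Ox.
have := reaction_clamp e Ox t01; have/andP[t0 t1] := t01.
have lip := clamp_lipschitz (t + e) t.
rewrite (clamp_id t01) (_ : t + e - t = e) in lip; last by lra.
have := clamp01 (t + e).
move: (clamp _) lip => c ce /andP[c0 c1] rc.
have a1 : 1 < alpha x by lra.
have r1 : 1 < r by lra.
have ta := spow_tangent t c a1.
have tr := spow_tangent t c r1.
have up := spow_taylor t c (ltW r2).
rewrite !ger0_norm// !spow_ge0E// in ta tr up.
have c2 : (c - t) ^+ 2 <= e ^+ 2.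
  by rewrite -(real_normK (num_real (c - t))) -(real_normK (num_real e)) ler_sqr ?nnegrE.
have e2 : 0 <= e ^+ 2 by exact: sqr_ge0.
have up' : c `^ r / r - t `^ r / r - t `^ (r - 1) * (c - t)
    <= (r - 1) * 2 `^ (r - 2) * e ^+ 2.
  apply: le_trans up _; rewrite -!(mulrA (r - 1)); apply: ler_wpM2l; first by lra.
  apply: ler_pM; [exact: powR_ge0|exact: sqr_ge0| |exact: c2].
  by apply: powR_le; lra.
have bt : - (bM * ((r - 1) * 2 `^ (r - 2) * e ^+ 2)) <=
   b x * (c `^ r / r - t `^ r / r - t `^ (r - 1) * (c - t)).
  rewrite lerNl -mulNr; apply: le_trans (ler_norm _) _.
  rewrite normrM normrN; apply: ler_pM => //.
  by rewrite ger0_norm//; lra.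
have at' : 0 <= beta * (c `^ alpha x / alpha x - t `^ alpha x / alpha x
   - t `^ (alpha x - 1) * (c - t)).
  by apply: mulr_ge0; lra.
move: rc bt at'; rewrite /react /reactC /reaction_prim.
move: (c `^ alpha x / _) (c `^ r / r) (t `^ alpha x / _) (t `^ r / r).
move: (t `^ (alpha x - 1)) (t `^ (r - 1)) (2 `^ (r - 2)) => x1 x2 x3 x4 x5 x6 x7.
move: (Num.max _ _) => x8 h1 h2 h3.
move: (b x) (e ^+ 2) h1 h2 h3 => x9 x10 h1 h2 h3; lra.
Qed.

Lemma integrable_react_mul w v : unit_class w -> measurable_fun setT v ->
  leb.-integrable Omega (EFin \o (fun x => v x ^+ 2)) ->
  leb.-integrable Omega (EFin \o (fun x => react x (w x) * v x)).
Proof.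
move=> uw mv iv2; have b0 := beta_gt0 Q; have bM0 := bM_ge0 Q.
have ic : leb.-integrable Omega (EFin \o (fun=> 1 : R)).
  by apply: (@integ_bounded _ _ _ leb _ _ 1) => // x _; rewrite normr1.
have i1 := integ_scale (beta + bM) mO (integ_add mO ic iv2).
apply: (integ_le mO _ _ i1).
  apply: measurable_funM; last exact: measurable_funTS.
  exact: (measurable_react (uc_measO uw)).
move=> x Ox; rewrite normrM; apply: ler_pM => //.
  exact: (react_norm_le Ox (uc01 x uw)).
have := sqr_ge0 (`|v x| - 1); rewrite -[v x ^+ 2]real_normK ?num_real//.
have := sqr_ge0 `|v x|; nra.
Qed.

Lemma edens_clamp u z : edens p s (fun x => clamp (u x)) z <= edens p s u z.
Proof.
rewrite /edens ler_wpM2r//.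
  by rewrite invr_ge0 mulr_ge0 ?kernel_ge0//; exact/ltW/(p_gt0 H).
by apply: powR_le; rewrite ?clamp_lipschitz// ltW// (p_gt0 H).
Qed.

(** Truncation at height one strictly lowers the energy, because points outside
    [Omega] interact with the points where [u] exceeds one. *)
Lemma edens_clamp_gain u x y : Omega x -> outer_cube B y -> u y = 0 ->
  kM^-1 * Num.max (u x - 1) 0
    <= edens p s u (x, y) - edens p s (fun x => clamp (u x)) (x, y).
Proof.
move=> Ox oy uy; have [n1|n1] := leP (u x) 1.
  by rewrite max_r ?subr_le0// mulr0 subr_ge0 edens_clamp.
have/andP[K0 KM] := outer_cube_kernel H OB Ox oy.
have k0 : 0 < kM := lt_le_trans K0 KM.
rewrite max_l ?subr_ge0 ?(ltW n1)// /edens /= uy.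
have [[h _]|[h _]|[_ ->]] := clamp_case (u x); [lra|lra|].
rewrite (@clamp_id _ 0) ?lexx ?ler01// !subr0 normr1 powR1.
rewrite ger0_norm; last by lra.
have P1 := p_gt1 H x y; have P0 := p_gt0 H x y.
have tan : u x - 1 <= (u x `^ p x y - 1) / p x y.
  rewrite ler_pdivlMr// mulrC.
  have := @powR_tangent _ (p x y) (u x) 1 (ltW P1) (ltW (lt_trans ltr01 n1)) ler01.
  by rewrite !powR1; move: (u x `^ _) => X; lra.
rewrite -mulrBl invfM mulrA [leLHS]mulrC.
apply: ler_pM => //; first by lra.
  by rewrite invr_ge0 ltW.
by rewrite lef_pV2 ?posrE.
Qed.

Lemma Phi_clamp u : measurable_fun setT u -> (modular p s u < +oo)%E ->
  (forall x, ~ Omega x -> u x = 0) ->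
  [/\ (modular p s (fun x => clamp (u x)) < +oo)%E,
    leb.-integrable Omega (EFin \o (fun x => Num.max (u x - 1) 0)) &
  kM^-1 * \int[leb]_(x in Omega) Num.max (u x - 1) 0
    <= Phi p s u - Phi p s (fun x => clamp (u x))].
Proof.
move=> mu fu u0.
have mc : measurable_fun setT (fun x => clamp (u x)).
  by apply: measurable_minr => //; apply: measurable_maxr.
have k0 := kmax_gt0 pM OB.
have iu := integrable_edens H mu fu.
have ic : leb2.-integrable setT (EFin \o edens p s (fun x => clamp (u x))).
  apply: (integ_le measurableT (measurable_edens H mc) _ iu) => z _.
  by rewrite ger0_norm ?(edens_ge0 H)// edens_clamp.
have id := integ_sub measurableT iu ic.
have mg : measurable_fun Omega (fun x => kM^-1 * Num.max (u x - 1) 0).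
  apply: measurable_funM => //; apply: measurable_maxr => //.
  by apply: measurable_funB => //; exact: measurable_funTS.
have g0 x : Omega x -> 0 <= kM^-1 * Num.max (u x - 1) 0.
  by move=> _; rewrite mulr_ge0 ?invr_ge0 ?(ltW k0)// le_max lexx orbT.
have d0 z : 0 <= edens p s u z - edens p s (fun x => clamp (u x)) z.
  by rewrite subr_ge0 edens_clamp.
have gh : {ae leb2, forall z : RN * RN, Omega z.1 -> outer_cube B z.2 ->
    kM^-1 * Num.max (u z.1 - 1) 0
      <= edens p s u z - edens p s (fun x => clamp (u x)) z}.
  apply: aeW => -[x y] /= Ox oy; apply: edens_clamp_gain => //.
  by apply: u0; exact: (outer_cube_notin OB oy).
have := outer_integral_ge OB mg g0 (integ_meas id) d0 gh.
rewrite -(EFin_Rintegral measurableT id) (RintegralB measurableT iu ic).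
rewrite -/(Phi p s u) -/(Phi p s (fun x => clamp (u x))).
move: (Phi _ _ _) (Phi _ _ _) => a2 a1 le.
have gi0 : (0 <= \int[leb]_(x in Omega) (kM^-1 * Num.max (u x - 1) 0)%:E)%E.
  by apply: integral_ge0 => x Ox; rewrite lee_fin; exact: g0.
have le1 : (\int[leb]_(x in Omega) (kM^-1 * Num.max (u x - 1) 0)%:E
    <= (a1 - a2)%:E)%E.
  apply: le_trans le; rewrite -[leLHS]mul1e; apply: lee_wpmul2r => //.
  by rewrite lee_fin exprn_ege1// ler1n.
have ig : leb.-integrable Omega (EFin \o (fun x => kM^-1 * Num.max (u x - 1) 0)).
  by apply: integ_ge0 => //; exact: le_lt_trans le1 (ltry _).
have im : leb.-integrable Omega (EFin \o (fun x => Num.max (u x - 1) 0)).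
  have := integ_scale kM mO ig; congr (_.-integrable _ _).
  by apply/funext => x /=; rewrite mulrA divff ?gt_eqF// mul1r.
split; [exact: (modular_lt_edens H mc (integ_ltoo measurableT ic))|exact: im|].
by rewrite -(RintegralZl _ mO im) -lee_fin (EFin_Rintegral mO ig).
Qed.

(** Half of the Euler equation: the truncated variation competes with the
    minimiser, and the energy gained by truncation pays for the excess. *)
Lemma euler_le w v : unit_class w ->
  (forall u, unit_class u -> functional w <= functional u) ->
  beta + bM <= kM^-1 ->
  measurable_fun setT v -> (modular p s v < +oo)%E ->
  (forall x, ~ Omega x -> v x = 0) ->
  leb.-integrable Omega (EFin \o (fun x => v x ^+ 2)) ->
  \int[leb]_(x in Omega) (react x (w x) * v x) <= \int[leb2]_z weak_lhs p s w v z.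
Proof.
move=> uw wmin small mv fv v0 iv2.
have mw := uc_meas uw; have fw := uc_fin uw.
have w01 x : 0 <= w x <= 1 := uc01 x uw.
have b0 := beta_gt0 Q; have bM0 := bM_ge0 Q.
pose K := taylorC pM * (fine (modular p s w) + fine (modular p s v))
  + reactC * \int[leb]_(x in Omega) v x ^+ 2.
have irv := integrable_react_mul uw mv iv2.
rewrite -subr_ge0; apply: (@ge0_of_quadratic _ _ K) => t /andP[t0 t1].
have mtv : measurable_fun setT (fun x => t * v x) by exact: measurable_funM.
have mu : measurable_fun setT (fun x => w x + t * v x) :=
  measurable_funD mw mtv.
have fu : (modular p s (fun x => w x + t * v x)%R < +oo)%E :=
  modular_add_fin H mw mtv fw (modular_scale_fin H mv (ltW t0) fv).
have u0 x : ~ Omega x -> w x + t * v x = 0.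
  by move=> nO; rewrite (uc_off uw)// v0// mulr0 addr0.
have [fc im gain] := Phi_clamp mu fu u0.
have t01 : 0 <= t <= 1 by rewrite (ltW t0).
have := Phi_taylor H mw fw mv fv t01.
pose c x := clamp (w x + t * v x).
have mc : measurable_fun setT c.
  by apply: measurable_minr => //; apply: measurable_maxr.
have c01 x : 0 <= c x <= 1 := clamp01 _.
have uc : unit_class c.
  split=> // [x|x|x nO]; try by have /andP[] := c01 x.
  by rewrite /c u0// clamp_id// lexx ler01.
have := wmin c uc.
have ipw := integrable_prim H OB Q (uc_measO uw) (fun x _ => w01 x).
have ipc := integrable_prim H OB Q (uc_measO uc) (fun x _ => c01 x).
have := @Rintegral_le_combination _ _ R leb Omega _ _ _ _ _ t (reactC * t ^+ 2)
  (beta + bM) mO ipw irv iv2 ipc im.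
have pw x : Omega x -> prim x (w x) + t * (react x (w x) * v x)
    - reactC * t ^+ 2 * v x ^+ 2
    <= prim x (c x) + (beta + bM) * Num.max (w x + t * v x - 1) 0.
  move=> Ox; have := prim_clamp_ge (t * v x) Ox (w01 x).
  by rewrite exprMn [react x (w x) * (t * v x)]mulrCA [reactC * (_ * _)]mulrA.
move=> /(_ pw) hc hw ht.
have J0 : 0 <= \int[leb]_(x in Omega) Num.max (w x + t * v x - 1) 0.
  by apply: Rintegral_ge0 => x _; rewrite le_max lexx orbT.
have /(ler_wpM2r J0) hs := small.
exact: (euler_arith gain hs hc hw ht).
Qed.

(** The Euler equation of a minimiser, obtained by truncating its variations. *)
Lemma euler_equation w v : unit_class w ->
  (forall u, unit_class u -> functional w <= functional u) ->
  beta + bM <= kM^-1 ->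
  measurable_fun setT v -> (modular p s v < +oo)%E ->
  (forall x, ~ Omega x -> v x = 0) ->
  leb.-integrable Omega (EFin \o (fun x => v x ^+ 2)) ->
  \int[leb2]_z weak_lhs p s w v z = \int[leb]_(x in Omega) (react x (w x) * v x).
Proof.
move=> uw wmin small mv fv v0 iv2.
have mw := uc_meas uw; have fw := uc_fin uw.
have mnv : measurable_fun setT (fun x => - v x) 
  by exact: measurableT_comp.
have fnv : (modular p s (fun x => - v x)%R < +oo)%E.
  by rewrite modularN.
have nv0 x : ~ Omega x -> - v x = 0 by move=> nO; rewrite v0// oppr0.
have iv2' : leb.-integrable Omega (EFin \o (fun x => (- v x) ^+ 2)).
  by rewrite (_ : (fun x => _) = fun x => v x ^+ 2)//; apply/funext => x; rewrite sqrrN.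
apply/le_anti/andP; split; last exact: euler_le.
have := euler_le uw wmin small mnv fnv nv0 iv2'.
have i1 := integrable_weak_lhs H mw fw mv fv.
have i2 := integrable_react_mul uw mv iv2.
rewrite (_ : Rintegral _ _ (weak_lhs p s w (fun x => - v x)) =
  - Rintegral leb2 setT (weak_lhs p s w v)); last first.
  transitivity (Rintegral leb2 setT (fun z => -1 * weak_lhs p s w v z)).
    by apply: eq_Rintegral => z _; rewrite /weak_lhs; ring.
  by rewrite (RintegralZl _ measurableT i1) mulN1r.
rewrite (_ : Rintegral _ _ (fun x => react x (w x) * - v x) =
  - Rintegral leb Omega (fun x => react x (w x) * v x)); last first.
  transitivity (Rintegral leb Omega (fun x => -1 * (react x (w x) * v x))).
    by apply: eq_Rintegral => z _; ring.
  by rewrite (RintegralZl _ mO i2) mulN1r.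
by rewrite lerN2.
Qed.

End euler.

(** * Lipschitz functions have finite modular *)

Section sup_norm.
Context {R : realType}.

Lemma norm_le_cube n (x y : 'rV[R]_n) (e : R) : 0 <= e ->
  (`|x - y| <= e) <-> cube x e y.
Proof.
move=> e0; split=> [le i|le].
  apply: le_trans le; rewrite [leRHS]mx_normrE.
  by apply: (le_trans _ (le_bigmax _ _ (ord0, i))); rewrite !mxE.
rewrite [leLHS]mx_normrE; apply/bigmax_leP; split=> // -[i j] _ /=.
by rewrite !mxE ord1; exact: le.
Qed.

Lemma norm_le_edist n (x y : 'rV[R]_n) : `|x - y| <= edist x y.
Proof.
by apply/norm_le_cube => [|i]; [exact: edist_nneg|exact: coord_le_edist].
Qed.

Lemma dyadic_level (X : R) : 1 <= X ->
  exists k : nat, 2 `^ k%:R <= X < 2 `^ (k%:R + 1).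
Proof.
move=> X1; have ex : exists n : nat, X < 2 `^ n%:R.
  exists (Num.truncn X).+1; rewrite powR_mulrn//.
  have := truncnS_gt X; move=> /lt_trans; apply.
  by rewrite -natrX ltr_nat ltn_expl.
case: (ex_minnP ex) => -[|k] lt min.
  by move: lt; rewrite powRr0 ltNge X1.
exists k; rewrite leNgt natr1 lt andbT.
by apply/negP => /min; rewrite ltnn.
Qed.

Lemma powR_antitone (e x y : R) : e <= 0 -> 0 < x -> x <= y -> y `^ e <= x `^ e.
Proof.
move=> e0 x0 xy; rewrite -(opprK e) !(powRN _ (- e)).
have y0 : 0 < y := lt_le_trans x0 xy.
rewrite lef_pV2 ?posrE ?powR_gt0//; apply: powR_le; rewrite ?oppr_ge0//.
exact: ltW.
Qed.

Lemma nneseries_geometric_fin (C q : R) (f : nat -> \bar R) :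
  0 <= C -> 0 <= q -> q < 1 ->
  (forall n, 0 <= f n)%E -> (forall n, f n <= (C * q ^+ n)%:E)%E ->
  (\sum_(n <oo) f n < +oo)%E.
Proof.
move=> C0 q0 q1 f0 fC; apply: (@le_lt_trans _ _ (C / (1 - q))%:E); last exact: ltry.
apply: lime_le; first by apply: is_cvg_nneseries => n _ _; exact: f0.
apply: nearW => n; apply: (@le_trans _ _ (\sum_(0 <= k < n) (C * q ^+ k)%:E)%E).
  by apply: lee_sum => k _; exact: fC.
rewrite sumEFin lee_fin.
have -> : \sum_(0 <= k < n) C * q ^+ k = C * (1 - q ^+ n) / (1 - q).
  elim: n => [|n ih]; first by rewrite big_geq// expr0 subrr mulr0 mul0r.
  rewrite big_nat_recr//= ih exprS; field.
  by rewrite subr_eq0 eq_sym lt_eqF.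
rewrite ler_wpM2r ?invr_ge0 ?subr_ge0 ?(ltW q1)// ler_piMr// gerBl exprn_ge0//.
Qed.

End sup_norm.

Section lipschitz_modular.
Context {R : realType} {N : nat}.
Local Notation RN := 'rV[R]_N.
Local Notation leb := (lebesgue_rV N : {sigma_finite_measure set RN -> \bar R}).
Local Notation leb2 := (leb \x leb)%E.
Context (p s : RN -> RN -> R) (pm pM : R) (H : admissible p s pm pM).
Context (sm sM : R) (sm_gt0 : 0 < sm) (sM_lt1 : sM < 1)
  (s_in : forall x y, sm <= s x y <= sM) (N0 : (0 < N)%N).
Implicit Types (u v w : RN -> R) (z : RN * RN).

(** Pairs of points at sup distance at most [e]. *)
Definition near_diag (e : R) : set (RN * RN) := [set z | `|z.1 - z.2| <= e].

Lemma measurable_near_diag e : measurable (near_diag e).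
Proof.
have m : measurable_fun setT (fun z : RN * RN => `|z.1 - z.2|).
  apply: continuous_rV2_measurable => z.
  apply: cvg_norm; apply: cvgB; [exact: cvg_fst|exact: cvg_snd].
rewrite -[near_diag e]setTI.
rewrite (_ : near_diag e = (fun z : RN * RN => `|z.1 - z.2|) @^-1` `]-oo, e]%classic).
  by apply: m => //; exact: measurable_itv.
by apply/seteqP; split=> z /=; rewrite in_itv.
Qed.

Lemma integral_near_diag1 (K : set RN) (e : R) : measurable K -> 0 <= e ->
  (\int[leb2]_z (\1_K z.1 * \1_(near_diag e) z)%:E = ((2 * e) ^+ N)%:E * leb K)%E.
Proof.
move=> mK e0.
rewrite fubini_tonelli1//; last first.
  apply/measurable_EFinP; apply: measurable_funM.
    by apply: measurableT_comp => //; exact: measurable_indic.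
  by apply: measurable_indic; exact: measurable_near_diag.
transitivity (\int[leb]_x (((2 * e) ^+ N)%:E * (\1_K x)%:E))%E.
  apply: eq_integral => x _; rewrite /fubini_F /=.
  under eq_integral do rewrite EFinM.
  rewrite ge0_integralZl//; last first.
    apply/measurable_EFinP.
    have mD : measurable_fun setT (\1_(near_diag e) : RN * RN -> R).
      by apply: measurable_indic; exact: measurable_near_diag.
    exact: (measurableT_comp mD (measurable_pair1 x)).
  rewrite muleC; congr (_ * _)%E.
  rewrite -(lebesgue_rV_cube x e0).
  transitivity (\int[leb]_y (\1_(cube x e) y)%:E)%E.
    apply: eq_integral => y _; congr EFin; rewrite !indicE; congr ((nat_of_bool _)%:R).
    apply/idP/idP => /set_mem h; apply/mem_set.
      exact/norm_le_cube.
    by apply/norm_le_cube.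
  by rewrite integral_indic ?setIT//; exact: measurable_cube.
rewrite ge0_integralZl//; last 2 first.
- by apply/measurable_EFinP; exact: measurable_indic.
- by rewrite lee_fin exprn_ge0// mulr_ge0.
by rewrite integral_indic ?setIT.
Qed.

Lemma integral_near_diag2 (K : set RN) (e : R) : measurable K -> 0 <= e ->
  (\int[leb2]_z (\1_K z.2 * \1_(near_diag e) z)%:E = ((2 * e) ^+ N)%:E * leb K)%E.
Proof.
move=> mK e0.
rewrite fubini_tonelli2//; last first.
  apply/measurable_EFinP; apply: measurable_funM.
    by apply: measurableT_comp => //; exact: measurable_indic.
  by apply: measurable_indic; exact: measurable_near_diag.
transitivity (\int[leb]_x (((2 * e) ^+ N)%:E * (\1_K x)%:E))%E.
  apply: eq_integral => x _; rewrite /fubini_G /=.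
  under eq_integral do rewrite EFinM.
  rewrite ge0_integralZl//; last first.
    apply/measurable_EFinP.
    have mD : measurable_fun setT (\1_(near_diag e) : RN * RN -> R).
      by apply: measurable_indic; exact: measurable_near_diag.
    exact: (measurableT_comp mD (measurable_pair2 x)).
  rewrite muleC; congr (_ * _)%E.
  rewrite -(lebesgue_rV_cube x e0).
  transitivity (\int[leb]_y (\1_(cube x e) y)%:E)%E.
    apply: eq_integral => y _; congr EFin; rewrite !indicE; congr ((nat_of_bool _)%:R).
    apply/idP/idP => /set_mem h; apply/mem_set.
      by apply/norm_le_cube => //; rewrite distrC.
    by rewrite /near_diag/= distrC; apply/norm_le_cube.
  by rewrite integral_indic ?setIT//; exact: measurable_cube.
rewrite ge0_integralZl//; last 2 first.
- by apply/measurable_EFinP; exact: measurable_indic.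
- by rewrite lee_fin exprn_ge0// mulr_ge0.
by rewrite integral_indic ?setIT.
Qed.

Lemma powR2D (a c : R) : 2 `^ a * 2 `^ c = 2 `^ (a + c) :> R.
Proof. by rewrite powRD// pnatr_eq0 implybT. Qed.

Lemma powR2_cube (a : R) : (2 * 2 `^ a) ^+ N = 2 `^ ((1 + a) * N%:R) :> R.
Proof.
by rewrite -{1}(powRr1 (ler0n R 2)) powR2D -powR_mulrn ?powR_ge0// -powRrM.
Qed.

(** Counts the members lying in [K] of a pair at distance at most [e]. *)
Definition near_ind (K : set RN) (e : R) z : R :=
  (\1_K z.1 + \1_K z.2) * \1_(near_diag e) z.

Lemma near_ind_ge0 K e z : 0 <= near_ind K e z.
Proof. by rewrite /near_ind mulr_ge0 ?addr_ge0. Qed.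

Lemma measurable_near_ind K e : measurable K ->
  measurable_fun setT (near_ind K e).
Proof.
move=> mK; apply: measurable_funM.
  by apply: measurable_funD; apply: measurableT_comp => //; exact: measurable_indic.
by apply: measurable_indic; exact: measurable_near_diag.
Qed.

Lemma integral_near_ind K e : measurable K -> (leb K < +oo)%E -> 0 <= e ->
  (\int[leb2]_z (near_ind K e z)%:E = (2 * (2 * e) ^+ N * fine (leb K))%:E)%E.
Proof.
move=> mK Koo e0.
have mD : measurable_fun setT (\1_(near_diag e) : RN * RN -> R).
  by apply: measurable_indic; exact: measurable_near_diag.
have m1 : measurable_fun setT (fun z : RN * RN => \1_K z.1 * \1_(near_diag e) z : R).
  apply: measurable_funM => //.
  by apply: measurableT_comp => //; exact: measurable_indic.
have m2 : measurable_fun setT (fun z : RN * RN => \1_K z.2 * \1_(near_diag e) z : R).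
  apply: measurable_funM => //.
  by apply: measurableT_comp => //; exact: measurable_indic.
transitivity (\int[leb2]_z ((\1_K z.1 * \1_(near_diag e) z)%:E
   + (\1_K z.2 * \1_(near_diag e) z)%:E))%E.
  by apply: eq_integral => z _; rewrite -EFinD -mulrDl.
rewrite ge0_integralD//; last 2 first.
- exact/measurable_EFinP.
- exact/measurable_EFinP.
rewrite integral_near_diag1// integral_near_diag2//.
have VE : leb K = (fine (leb K))%:E by rewrite fineK// ge0_fin_numE.
have step : (((2 * e) ^+ N)%:E * leb K = ((2 * e) ^+ N * fine (leb K))%:E)%E.
  by rewrite [in LHS]VE EFinM.
transitivity (((2 * e) ^+ N * fine (leb K))%:E + ((2 * e) ^+ N * fine (leb K))%:E)%E.
  by congr (_ + _)%E; exact: step.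
rewrite -EFinD; congr EFin; move: (_ ^+ N) (fine _) => a c; ring.
Qed.

(** A Lipschitz function vanishing outside a set of finite measure has a finite
    modular: the kernel is summed over dyadic distances, converging near the
    diagonal because [s < 1] and far from it because [s > 0]. *)
Lemma modular_lipschitz_fin (K : set RN) u : measurable K -> (leb K < +oo)%E ->
  measurable_fun setT u -> (forall x, ~ K x -> u x = 0) ->
  (forall x y, `|u x - u y| <= `|x - y|) -> (forall x y, `|u x - u y| <= 1) ->
  (modular p s u < +oo)%E.
Proof.
move=> mK Koo mu uK ulip u1.
have pm0 : 0 < pm by apply: lt_trans (pm_gt2 H).
pose e := Num.min 1 (Num.min (pm * (1 - sM)) (sm * pm)).
have e0 : 0 < e by rewrite !lt_min ltr01 !mulr_gt0//= subr_gt0.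
have e1 : e <= 1 by rewrite ge_min lexx.
have e2 : e <= pm * (1 - sM) by rewrite !ge_min lexx orbT.
have e3 : e <= sm * pm by rewrite !ge_min lexx !orbT.
move: e e0 e1 e2 e3 => e e0 e1 e2 e3.
pose n : R := N%:R; have n1 : 1 <= n by rewrite /n ler1n.
(* a bounds the kernel at distances about 2^(-k), b at distances about 2^k. *)
pose a k : R := 2 `^ ((k%:R + 1) * (n - e)).
pose b k : R := 2 `^ (- (k%:R * (n + e))).
pose c (k : nat) z : R := a k * near_ind K (2 `^ (- k%:R)) z
  + b k * near_ind K (2 `^ (k%:R + 1)) z.
have c0 k z : 0 <= c k z.
  by rewrite addr_ge0// mulr_ge0 ?powR_ge0 ?near_ind_ge0.
have mc k : measurable_fun setT (EFin \o c k).
  apply/measurable_EFinP; apply: measurable_funD; apply: measurable_funM => //;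
    exact: measurable_near_ind.
have point z : exists k, gdens p s u z <= c k z.
  set t := `|z.1 - z.2|.
  have zero : u z.1 - u z.2 = 0 -> exists k, gdens p s u z <= c k z.
    move=> uz; exists 0%N; rewrite /gdens uz normr0 powR0 ?mul0r//.
    by rewrite gt_eqF// (p_gt0 H).
  have [t0|tn0] := eqVneq t 0.
    apply: zero; apply/eqP; rewrite subr_eq0; move/eqP: t0.
    by rewrite /t normr_eq0 subr_eq0 => /eqP ->.
  have t0 : 0 < t by rewrite lt_neqAle eq_sym tn0 normr_ge0.
  have [[z1 z2]|nzK] := pselect (~ K z.1 /\ ~ K z.2).
    by apply: zero; rewrite !uK// subrr.
  have ind e' : t <= e' -> 1 <= near_ind K e' z.
    move=> te; rewrite /near_ind (_ : \1_(near_diag e') z = 1) ?mulr1; last first.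
      by rewrite indicE mem_set.
    have [K1|K1] := pselect (K z.1).
      by rewrite indicE (mem_set K1) lerDl.
    have [K2|K2] := pselect (K z.2); last by exfalso; apply: nzK.
    by rewrite [X in _ + X]indicE (mem_set K2) lerDr.
  have P2 := p_gt2 H z.1 z.2; have Pm := p_ge H z.1 z.2.
  have /andP[s1 s2] := s_in z.1 z.2.
  have td : t <= edist z.1 z.2 := norm_le_edist _ _.
  have := ulip z.1 z.2; have := u1 z.1 z.2.
  rewrite /gdens /Defs.kernel -/n -/t.
  move: (p z.1 z.2) (s z.1 z.2) (`|u z.1 - u z.2|) (normr_ge0 (u z.1 - u z.2))
    (edist z.1 z.2) P2 Pm s1 s2 td => P S D D0 d P2 Pm s1 s2 td D1 Dt.
  have P0 : 0 <= P by lra.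
  have SP1 : e <= P * (1 - S).
    apply: le_trans e2 _; apply: ler_pM => //; [exact: ltW|by rewrite subr_ge0 ltW|].
    by rewrite lerD2l lerN2.
  have SP2 : e <= S * P.
    by apply: le_trans e3 _; apply: ler_pM => //; exact: ltW.
  have E0 : 0 <= n + S * P by lra.
  have dE : t `^ (n + S * P) <= d `^ (n + S * P) by apply: powR_le => //; lra.
  have tE0 : 0 < t `^ (n + S * P) by rewrite powR_gt0.
  have dE0 : 0 < d `^ (n + S * P) := lt_le_trans tE0 dE.
  have [t1|t1] := leP t 1.
    have X1 : 1 <= t^-1 by rewrite invf_ge1.
    have [k /andP[k1 k2]] := dyadic_level X1; exists k.
    have tk : t <= 2 `^ (- k%:R).
      by rewrite powRN -[leLHS]invrK lef_pV2 ?posrE ?invr_gt0 ?powR_gt0.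
    have tk1 : 2 `^ (- (k%:R + 1)) <= t.
      by rewrite powRN -[leRHS]invrK lef_pV2 ?posrE ?invr_gt0 ?powR_gt0// ltW.
    apply: (@le_trans _ _ (a k)); last first.
      rewrite -[leLHS]mulr1 /c; apply: (@le_trans _ _ (a k * near_ind K (2 `^ (- k%:R)) z)).
        by rewrite ler_wpM2l ?powR_ge0// ind.
      by rewrite lerDl mulr_ge0 ?powR_ge0 ?near_ind_ge0.
    apply: (@le_trans _ _ (t `^ P / t `^ (n + S * P))).
      apply: ler_pM; rewrite ?powR_ge0 ?invr_ge0 ?(ltW dE0)//; first exact: powR_le.
      by rewrite lef_pV2 ?posrE.
    rewrite -powRN -powRD; last by rewrite (gt_eqF t0) implybT.
    apply: (@le_trans _ _ (t `^ (e - n))).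
      by apply: ger_powR; [rewrite t0|lra].
    apply: (@le_trans _ _ ((2 `^ (- (k%:R + 1))) `^ (e - n))).
      by apply: powR_antitone => //; lra.
    by rewrite -powRrM /a (_ : - (k%:R + 1) * (e - n) = (k%:R + 1) * (n - e))//; ring.
  have [k /andP[k1 k2]] := dyadic_level (ltW t1); exists k.
  apply: (@le_trans _ _ (b k)); last first.
    rewrite -[leLHS]mulr1 /c; apply: (@le_trans _ _ (b k * near_ind K (2 `^ (k%:R + 1)) z)).
      by rewrite ler_wpM2l ?powR_ge0// ind// ltW.
    by rewrite lerDr mulr_ge0 ?powR_ge0 ?near_ind_ge0.
  apply: (@le_trans _ _ (1 / t `^ (n + S * P))).
    apply: ler_pM; rewrite ?powR_ge0 ?invr_ge0 ?(ltW dE0)//.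
      by have := powR_le P0 D0 D1; rewrite powR1.
    by rewrite lef_pV2 ?posrE.
  rewrite mul1r -powRN.
  apply: (@le_trans _ _ (t `^ (- (n + e)))).
    by apply: ler_powR; [exact: ltW|lra].
  apply: (@le_trans _ _ ((2 `^ k%:R) `^ (- (n + e)))).
    by apply: powR_antitone => //; lra.
  by rewrite -powRrM mulrN /b.
have le z : ((gdens p s u z)%:E <= \sum_(k <oo) (c k z)%:E)%E.
  have [k gk] := point z; apply: (@le_trans _ _ (c k z)%:E); first by rewrite lee_fin.
  have := @nneseries_lim_ge R (fun k => (c k z)%:E) xpredT 0 k.+1.
  move=> /(_ (fun i _ _ => c0 i z)); apply: le_trans.
  rewrite big_nat_recr//= leeDr// sume_ge0// => i _.
  by rewrite lee_fin.
apply: (@le_lt_trans _ _ (\int[leb2]_z \sum_(k <oo) (c k z)%:E)%E).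
  apply: ge0_le_integral => //.
  - by move=> z _; rewrite lee_fin gdens_ge0.
  - exact: (measurable_egdens H mu).
  - by apply: ge0_emeasurable_sum => [k z _ _|k _]; [rewrite lee_fin|exact: mc].
rewrite integral_nneseries//; last by move=> k z _; rewrite lee_fin.
pose q : R := 2 `^ (- e).
have V0 : 0 <= fine (leb K) by rewrite fine_ge0.
have q0 : 0 < q by rewrite powR_gt0.
have q1 : q < 1.
  rewrite /q powRN invf_lt1 ?powR_gt0//.
  have := @gt0_ltr_powR R e e0 1 2; rewrite powR1; apply; rewrite ?nnegrE//.
  by rewrite ltr1n.
apply: (@nneseries_geometric_fin _ (4 * 2 `^ (2 * n) * fine (leb K)) q) => //.
- by rewrite !mulr_ge0 ?powR_ge0.
- exact: ltW.
- by move=> k; apply: integral_ge0 => z _; rewrite lee_fin.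
move=> k; have icE : (\int[leb2]_z (c k z)%:E = (
   a k * (2 * (2 * 2 `^ (- k%:R)) ^+ N * fine (leb K)) +
   b k * (2 * (2 * 2 `^ (k%:R + 1)) ^+ N * fine (leb K)))%:E)%E.
  transitivity (\int[leb2]_z ((a k)%:E * (near_ind K (2 `^ (- k%:R)) z)%:E +
    (b k)%:E * (near_ind K (2 `^ (k%:R + 1)) z)%:E))%E.
    by apply: eq_integral => z _; rewrite -!EFinM -EFinD.
  have m1 := measurable_near_ind (2 `^ (- k%:R)) mK.
  have m2 := measurable_near_ind (2 `^ (k%:R + 1)) mK.
  have g1 z : (0 <= (near_ind K (2 `^ (- k%:R)) z)%:E)%E.
    by rewrite lee_fin near_ind_ge0.
  have g2 z : (0 <= (near_ind K (2 `^ (k%:R + 1)) z)%:E)%E.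
    by rewrite lee_fin near_ind_ge0.
  have a0 : (0 <= (a k)%:E)%E by rewrite lee_fin powR_ge0.
  have b0 : (0 <= (b k)%:E)%E by rewrite lee_fin powR_ge0.
  rewrite ge0_integralD//; last 4 first.
  - by move=> z _; apply: mule_ge0.
  - by apply/measurable_EFinP; apply: measurable_funM.
  - by move=> z _; apply: mule_ge0.
  - by apply/measurable_EFinP; apply: measurable_funM.
  rewrite ge0_integralZl//; last exact/measurable_EFinP.
  rewrite ge0_integralZl//; last exact/measurable_EFinP.
  by rewrite !integral_near_ind// ?powR_ge0.
rewrite icE lee_fin !powR2_cube -/n.
have qk : q ^+ k = 2 `^ (- (k%:R * e)).
  by rewrite -powR_mulrn ?powR_ge0// -powRrM mulNr mulrC.
have h1 : a k * 2 `^ ((1 + - k%:R) * n) <= 2 `^ (2 * n) * q ^+ k.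
  by rewrite qk !powR2D ler_powR ?ler1n//; lra.
have h2 : b k * 2 `^ ((1 + (k%:R + 1)) * n) <= 2 `^ (2 * n) * q ^+ k.
  by rewrite qk !powR2D ler_powR ?ler1n//; lra.
move: (fine (leb K)) V0 => v v0; have v20 : 0 <= 2 * v by rewrite mulr_ge0.
have := ler_wpM2l v20 h1; have := ler_wpM2l v20 h2.
move: (q ^+ k) (a k) (b k) (2 `^ (2 * n)) (2 `^ ((1 + - k%:R) * n)).
by move: (2 `^ _) => x1 x2 x3 x4 x5 x6; lra.
Qed.

End lipschitz_modular.

(** * Nontrivial minimisers *)

Section nontrivial.
Context {R : realType} {N : nat}.
Local Notation RN := 'rV[R]_N.
Local Notation leb := (lebesgue_rV N : {sigma_finite_measure set RN -> \bar R}).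
Local Notation leb2 := (leb \x leb)%E.
Context (p s : RN -> RN -> R) (pm pM : R) (H : admissible p s pm pM).
Context (sm sM : R) (sm_gt0 : 0 < sm) (sM_lt1 : sM < 1)
  (s_in : forall x y, sm <= s x y <= sM).
Context (Omega : set RN) (B : R) (OB : located Omega B).
Context (alpha b : RN -> R) (am aM r beta bM : R)
  (Q : reaction Omega pm pM alpha b am aM r beta bM).
Implicit Types (u v w : RN -> R) (z : RN * RN).
Local Notation kM := (@kmax R N pM B).
Local Notation unit_class := (unit_class p s Omega).
Local Notation functional := (total_energy p s Omega alpha b r beta).
Local Notation Psi := (reaction_energy Omega alpha b r beta).
Local Notation prim := (reaction_prim alpha b r beta).
Local Notation react := (react alpha b r beta).
Context (Oopen : open Omega) (Ononempty : Omega !=set0).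

Let mO : measurable Omega := mOmega OB.
Let Ooo : (leb Omega < +oo)%E := Omega_fin OB.

(** A Lipschitz bump inside the domain. *)
Lemma bump_exists : exists phi, unit_class phi /\
  exists (x0 : RN) (c : R), [/\ 0 < c, c <= 1, cube x0 c `<=` Omega &
    forall x, cube x0 c x -> c <= phi x].
Proof.
have [x0 Ox0] := Ononempty.
have /nbhs_ballP[e /= e0 eO] : nbhs x0 Omega by exact: open_nbhs_nbhs.
pose rho : R := Num.min 1 (e / 2).
have rho0 : 0 < rho by rewrite lt_min ltr01 divr_gt0.
have rho1 : rho <= 1 by rewrite ge_min lexx.
have rhoe : rho < e.
  by rewrite gt_min; apply/orP; right; rewrite ltr_pdivrMr// ltr_pMr// ltr1n.
have nO x : `|x0 - x| <= rho -> Omega x.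
  by move=> h; apply: eO; rewrite -ball_normE; exact: le_lt_trans h rhoe.
pose phi x : R := Num.max 0 (rho - `|x0 - x|).
have phi0 x : 0 <= phi x by rewrite /phi le_max lexx.
have phi1 x : phi x <= rho.
  by rewrite /phi ge_max ltW//= gerBl.
have phiO x : ~ Omega x -> phi x = 0.
  move=> nOx; rewrite /phi max_l// subr_le0 leNgt; apply/negP => h.
  by apply: nOx; apply: nO; exact: ltW.
have mphi : measurable_fun setT phi.
  apply: measurable_maxr => //; apply: measurable_funB => //.
  apply: (@continuous_rV_measurable R N setT); first exact: openT.
  move=> x _; apply: (@continuous_comp _ _ _ (fun y : RN => x0 - y) (fun y => `|y|)).
    by apply: continuousB; [exact: cst_continuous|exact: cvg_id].
  exact: norm_continuous.
have lip x y : `|phi x - phi y| <= `|x - y|.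
  have : `| `|x0 - x| - `|x0 - y| | <= `|x - y|.
    have := ler_distD y x0 x; have := ler_distD x x0 y; rewrite (distrC y x).
    by move: (`|x0 - x|) (`|x0 - y|) (`|x - y|) => a c d h1 h2; rewrite ler_norml; lra.
  rewrite /phi; move: (`|x0 - x|) (`|x0 - y|) (`|x - y|) => a c d acd.
  move: acd; rewrite !ler_norml => /andP[d1 d2].
  by have [h|h] := leP 0 (rho - a); have [h'|h'] := leP 0 (rho - c);
    apply/andP; split; lra.
have lip1 x y : `|phi x - phi y| <= 1.
  have := phi0 x; have := phi0 y; have := phi1 x; have := phi1 y.
  move: (phi x) (phi y) => a c *; rewrite ler_norml; lra.
exists phi; split.
  split=> // [x|]; first exact: le_trans (phi1 x) rho1.
  exact: (modular_lipschitz_fin H sm_gt0 sM_lt1 s_in (N_gt0 OB) mO Ooo mphi phiO).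
exists x0, (rho / 2); split.
- by rewrite divr_gt0.
- by rewrite ler_pdivrMr// mul1r (le_trans rho1)// ler1n.
- move=> x /norm_le_cube h; apply: nO; apply: le_trans (h _) _.
    by rewrite ltW// divr_gt0.
  by rewrite ler_pdivrMr// ler_peMr ?ler1n// ltW.
move=> x /norm_le_cube h; rewrite /phi le_max; apply/orP; right.
have := h (ltW (divr_gt0 rho0 _)); rewrite ltr0n => /(_ isT).
by move: (`|_|) => a; lra.
Qed.

(** The energy of a negligible function is zero. *)
Lemma functional_ae0 w : measurable_fun setT w ->
  {ae leb, forall x, w x = 0} -> functional w = 0.
Proof.
move=> mw w0; rewrite /functional (@eq_ae_Phi _ _ _ _ _ _ H w (fun=> 0))//.
have -> : Phi p s (fun=> 0) = 0.
  rewrite /Phi /Rintegral integral0_eq// => z _.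
  rewrite /edens subrr normr0 powR0 ?mul0r//.
  by rewrite gt_eqF// (p_gt0 H).
rewrite sub0r; apply/eqP; rewrite oppr_eq0; apply/eqP.
rewrite /reaction_energy; transitivity (fine (\int[leb]_(x in Omega) cst 0%:E x)%E); last first.
  by rewrite integral0.
congr fine; apply: ae_eq_integral => //.
  by apply/measurable_EFinP; apply: (measurable_prim Q); exact: measurable_funTS.
apply: filterS w0 => x wx Ox; rewrite /reaction_prim wx !powR0 ?mul0r ?mulr0 ?addr0//.
  by rewrite gt_eqF// (r_gt0 H Q).
by rewrite gt_eqF// (alpha_gt0 Q).
Qed.

(** Small multiples of a bump have negative energy, as [alpha < p < r]. *)
Lemma functional_neg : exists u, unit_class u /\ functional u < 0.
Proof.
have [phi [uphi [x0 [c [c0 c1 cO cphi]]]]] := bump_exists.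
have b0 := beta_gt0 Q; have r0 := r_gt0 H Q.
have a0 := aM_gt0 Q; have bM0 := bM_ge0 Q.
have phi01 x : 0 <= phi x <= 1 := uc01 x uphi.
pose A : R := c `^ aM / aM * (2 * c) ^+ N.
have A0 : 0 < A by rewrite !mulr_gt0 ?invr_gt0 ?powR_gt0 ?exprn_gt0 ?mulr_gt0.
pose K : R := Phi p s phi + bM * fine (leb Omega).
have K0 : 0 <= K by rewrite addr_ge0 ?(Phi_ge0 H)// mulr_ge0 ?fine_ge0.
have d0 : 0 < pm - aM by rewrite subr_gt0; exact: aM_pm Q.
(* the threshold below which the term of lowest exponent dominates *)
pose t : R := Num.min 1 ((beta * A / (2 * (1 + K))) `^ (pm - aM)^-1).
have t0 : 0 < t.
  rewrite lt_min ltr01 powR_gt0// (divr_gt0 (mulr_gt0 b0 A0))//.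
  by apply: mulr_gt0 => //; rewrite ltr_pwDl.
have t1 : t <= 1 by rewrite ge_min lexx.
have tK : t `^ (pm - aM) * K < beta * A.
  have K1 : 0 < 2 * (1 + K) by apply: mulr_gt0 => //; rewrite ltr_pwDl.
  have : t `^ (pm - aM) <= beta * A / (2 * (1 + K)).
    have X0 : 0 <= beta * A / (2 * (1 + K)).
      by apply: divr_ge0; apply: ltW => //; exact: mulr_gt0.
    have dn : (pm - aM)^-1 * (pm - aM) = 1 by rewrite mulVf// gt_eqF.
    rewrite [leRHS](_ : _ = (beta * A / (2 * (1 + K))) `^ (pm - aM)^-1 `^ (pm - aM)).
      by apply: powR_le; [exact: ltW|exact: ltW|rewrite /t ge_min lexx orbT].
    by rewrite -powRrM dn powRr1.
  rewrite ler_pdivlMr//; have : 0 < beta * A by exact: mulr_gt0.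
  have := powR_ge0 t (pm - aM); move: (t `^ _) (beta * A) => x y; nra.
have mphi := uc_meas uphi.
have mt : measurable_fun setT (fun x => t * phi x) by exact: measurable_funM.
have ut : unit_class (fun x => t * phi x).
  split=> //.
  - by move=> x; rewrite mulr_ge0 ?(ltW t0)//; case/andP: (phi01 x).
  - by move=> x; rewrite mulr_ile1 ?(ltW t0)//; case/andP: (phi01 x).
  - by move=> x nO; rewrite (uc_off uphi)// mulr0.
  - exact: (modular_scale_fin H mphi (ltW t0) (uc_fin uphi)).
exists (fun x => t * phi x); split; first exact: ut.
have iphi := integrable_edens H mphi (uc_fin uphi).
have h1 : Phi p s (fun x => t * phi x) <= t `^ pm * Phi p s phi.
  rewrite /Phi -(RintegralZl _ measurableT iphi).
  apply: le_Rintegral => //.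
  - exact: (integrable_edens H mt (uc_fin ut)).
  - exact: (integ_scale _ measurableT iphi).
  move=> z _; rewrite !edensE (gdens_scale _ _ _ _ (ltW t0)) mulrA.
  rewrite ler_wpM2r ?ler_wpM2r ?gdens_ge0//.
    by rewrite invr_ge0 ltW// (p_gt0 H).
  exact: (powR_le_pm H _ _ (ltW t0) t1).
have h2 : t `^ aM * (beta * A) - t `^ pm * (bM * fine (leb Omega))
    <= Psi (fun x => t * phi x).
  have mcube := measurable_cube x0 c.
  have mI : measurable_fun Omega (\1_(cube x0 c) : RN -> R).
    exact: measurable_indic.
  have iI : leb.-integrable Omega (EFin \o (\1_(cube x0 c) : RN -> R)).
    apply: (@integ_bounded _ _ _ leb _ _ 1) => // x _.
    by rewrite indicE; case: (_ \in _); rewrite ?normr1 ?normr0.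
  have ic : leb.-integrable Omega (EFin \o (fun=> t `^ pm * bM : R)).
    by apply: (@integ_bounded _ _ _ leb _ _ `|t `^ pm * bM|).
  have IE : \int[leb]_(x in Omega) \1_(cube x0 c) x = (2 * c) ^+ N :> R.
    rewrite /Rintegral (_ : (\int[leb]_(x in Omega) _)%E = ((2 * c) ^+ N)%:E)//.
    rewrite integral_indic// setIidl//; exact: (lebesgue_rV_cube x0 (ltW c0)).
  pose k : R := t `^ aM * (beta * (c `^ aM / aM)).
  have iI' := integ_scale k mO iI.
  have -> : t `^ aM * (beta * A) - t `^ pm * (bM * fine (leb Omega)) =
      \int[leb]_(x in Omega) (k * \1_(cube x0 c) x - t `^ pm * bM).
    rewrite (RintegralB mO iI' ic) (RintegralZl _ mO iI) (Rintegral_cst leb mO) IE.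
    by rewrite /k /A !mulrA.
  apply: le_Rintegral => //; first exact: (integ_sub mO iI' ic).
    apply: (integrable_prim H OB Q (uc_measO ut)) => x Ox; exact: uc01 x ut.
  move=> x Ox; have xa := alpha_le Q Ox; have xg := alpha_gt0 Q Ox.
  have /andP[p0 p1] := phi01 x.
  have t01 : 0 < t <= 1 by rewrite t0.
  have r1 : 1 <= r.
    by apply: ltW; apply: lt_trans (pM_r Q); apply: lt_trans (pM_gt2 H); rewrite ltr1n.
  have tr : (t * phi x) `^ r / r <= t `^ pm.
    rewrite ler_pdivrMr// (powRM _ (ltW t0) p0).
    apply: ler_pM; rewrite ?powR_ge0//.
      apply: ger_powR => //.
      by rewrite (le_trans (p_ge H 0 0))// (le_trans (p_le H 0 0))// ltW// (pM_r Q).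
    by rewrite (le_trans (unit_powR_le1 (phi01 x) (ltW r0))).
  have br : - (t `^ pm * bM) <= b x * ((t * phi x) `^ r / r).
    rewrite lerNl -mulNr; apply: le_trans (ler_norm _) _.
    rewrite normrM normrN mulrC; apply: ler_pM => //; last exact: (b_le Q Ox).
    by rewrite ger0_norm// divr_ge0 ?powR_ge0// ltW.
  rewrite /reaction_prim; apply: lerD; last exact: br.
  rewrite indicE; have [/set_mem cx|_] := boolP (x \in cube x0 c); last first.
    by rewrite mulr0 mulr_ge0 ?divr_ge0 ?powR_ge0 ?(ltW b0) ?(ltW xg).
  rewrite mulr1 /k mulrCA ler_wpM2l ?(ltW b0)// (powRM _ (ltW t0) p0).
  rewrite -mulrA; apply: ler_pM; rewrite ?powR_ge0//.
  - by rewrite divr_ge0 ?powR_ge0// ltW.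
  - exact: ger_powR.
  apply: ler_pM; rewrite ?powR_ge0 ?invr_ge0 ?(ltW a0)//.
    apply: (@le_trans _ _ (c `^ alpha x)); first by apply: ger_powR; rewrite ?c0.
    by apply: powR_le; [exact: ltW|exact: ltW|exact: cphi].
  by rewrite lef_pV2 ?posrE.
have E : t `^ pm = t `^ aM * t `^ (pm - aM).
  by rewrite -powRD; [congr (_ `^ _); lra|rewrite (gt_eqF t0) implybT].
rewrite /functional /total_energy subr_lt0; apply: le_lt_trans h1 _.
apply: lt_le_trans h2; rewrite ltrBrDr -mulrDr -/K E -mulrA ltr_pM2l//.
by rewrite powR_gt0.
Qed.

(** A nonnegative bounded solution of the equation with a small reaction
    coefficient [b] of order [r]. *)
Theorem reaction_solution :
  bM <= r * @gapD R N pm pM B aM r -> beta + bM <= kM^-1 ->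
  exists w, [/\ unit_class w, ~ {ae leb, forall x, w x = 0} &
    forall v, measurable_fun setT v -> (modular p s v < +oo)%E ->
      (forall x, ~ Omega x -> v x = 0) ->
      leb.-integrable Omega (EFin \o (fun x => v x ^+ 2)) ->
      leb.-integrable Omega (EFin \o (fun x => react x (w x) * v x)) /\
      \int[leb2]_z weak_lhs p s w v z
        = \int[leb]_(x in Omega) (react x (w x) * v x)].
Proof.
move=> small1 small2; have [w [uw wmin]] := minimiser_exists H OB Q small1.
exists w; split=> //.
  move=> w0; have [u [uu]] := functional_neg.
  by rewrite ltNge -(functional_ae0 (uc_meas uw) w0) wmin.
move=> v mv fv v0 iv2; split; first exact: (integrable_react_mul H OB Q uw mv iv2).
exact: (euler_equation H OB Q uw wmin small2 mv fv v0 iv2).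
Qed.

End nontrivial.

(** * The fractional space *)

Section X0_space.
Context {R : realType} {N : nat}.
Local Notation RN := 'rV[R]_N.
Local Notation leb := (lebesgue_rV N : {sigma_finite_measure set RN -> \bar R}).
Local Notation leb2 := (leb \x leb)%E.
Context (p s : RN -> RN -> R) (pm pM : R) (H : admissible p s pm pM).
Context (Omega : set RN) (mO : measurable Omega) (q : RN -> R).
Implicit Types (u v w : RN -> R) (z : RN * RN).

(** The representative of an element of the space which vanishes everywhere off
    the domain. *)
Definition zero_ext v : RN -> R := v \_ Omega.

Lemma zero_ext_in v x : Omega x -> zero_ext v x = v x.
Proof. by move=> Ox; rewrite /zero_ext patchE mem_set. Qed.

Lemma zero_ext_out v x : ~ Omega x -> zero_ext v x = 0.
Proof. by move=> Ox; rewrite /zero_ext patchE memNset. Qed.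

Lemma measurable_zero_ext v : measurable_fun setT v ->
  measurable_fun setT (zero_ext v).
Proof.
by move=> mv; apply/(measurable_restrictT _ _).1 => //; exact: measurable_funTS.
Qed.

Lemma zero_ext_ae v : {ae leb, forall x, ~ Omega x -> v x = 0} ->
  {ae leb, forall x, v x = zero_ext v x}.
Proof.
apply: filterS => x v0; have [Ox|nO] := pselect (Omega x).
  by rewrite zero_ext_in.
by rewrite zero_ext_out// v0.
Qed.

Let T : set (RN * RN) := ~` (~` Omega `*` ~` Omega).

Let mT : measurable T.
Proof. by apply: measurableC; apply: measurableX; exact: measurableC. Qed.

Lemma in_X0_measurable v : in_X0 Omega p s q v -> measurable_fun setT v.
Proof. by case=> [[]]. Qed.

Lemma in_X0_ae v : in_X0 Omega p s q v -> {ae leb, forall x, v x = zero_ext v x}.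
Proof. by case=> _; exact: zero_ext_ae. Qed.

Lemma in_X0_modular v : in_X0 Omega p s q v -> (modular p s v < +oo)%E.
Proof.
move=> Xv; have mv := in_X0_measurable Xv; have v0 := in_X0_ae Xv.
case: Xv => -[_ _ [th th0 fin]] _.
pose w x := v x / th; pose w' x := zero_ext v x / th.
have mw : measurable_fun setT w by exact: measurable_funM.
have mw' : measurable_fun setT w'.
  by apply: measurable_funM => //; exact: measurable_zero_ext.
have ww' : {ae leb, forall x, w x = w' x}.
  by apply: filterS v0 => x vx; rewrite /w /w' -vx.
have ww1 : {ae leb2, forall z, w z.1 = w' z.1} := ae_prod1 leb ww'.
have ww2 : {ae leb2, forall z, w z.2 = w' z.2} := ae_prod2 leb ww'.
suff fw : (modular p s w < +oo)%E.
  have := modular_scale_fin H mw (ltW th0) fw.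
  rewrite (_ : (fun x => th * w x) = v)//; apply/funext => x.
  by rewrite /w mulrCA divff ?mulr1// gt_eqF.
rewrite (eq_ae_modular H mw mw' ww').
rewrite (_ : modular p s w' = (\int[leb2]_(z in T) (gdens p s w' z)%:E)%E); last first.
  rewrite /modular [RHS]integral_mkcond; apply: eq_integral => z _.
  rewrite patchE; case: ifPn => // /negP zT.
  have [z1 z2] : ~ Omega z.1 /\ ~ Omega z.2.
    by apply: contrapT => h; apply: zT; apply/mem_set.
  rewrite /gdens /w' !zero_ext_out// subrr normr0 powR0 ?mul0r//.
  by rewrite gt_eqF// (p_gt0 H).
apply: le_lt_trans fin; rewrite le_eqVlt; apply/orP; left; apply/eqP.
apply: ae_eq_integral => //.
- by apply: measurable_funTS; exact: (measurable_egdens H mw').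
- apply: measurable_funTS; rewrite (_ : (fun z => _) = fun z => (gdens p s w z)%:E).
    exact: (measurable_egdens H mw).
  by apply/funext => z; rewrite gagliardoE.
apply: filterS2 ww1 ww2 => z e1 e2 _.
by rewrite gagliardoE// /gdens -/(w z.1) -/(w z.2) e1 e2.
Qed.

(** A finite modular characterises the space among bounded functions vanishing
    off a domain of finite measure. *)
Lemma bounded_in_X0 v : measurable_fun Omega q -> (leb Omega < +oo)%E ->
  (forall x, Omega x -> 0 <= q x) ->
  measurable_fun setT v -> (forall x, ~ Omega x -> v x = 0) ->
  (forall x, `|v x| <= 1) -> (modular p s v < +oo)%E -> in_X0 Omega p s q v.
Proof.
move=> mq Ooo q0 mv v0 v1 fv; split; last exact: aeW.
split=> //.
  exists 1 => //; apply: (@le_lt_trans _ _ (\int[leb]_(x in Omega) cst 1%:E x)%E).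
    apply: ge0_le_integral => //.
      apply/measurable_EFinP; apply: measurable_powR_fun => //.
      apply: measurable_funM => //; apply: measurableT_comp => //.
      exact: measurable_funTS.
    move=> x Ox; rewrite lee_fin divr1.
    by have := powR_le (q0 x Ox) (normr_ge0 (v x)) (v1 x); rewrite powR1.
  by rewrite integral_cst// mul1e.
exists 1 => //; apply: le_lt_trans fv.
apply: (@le_trans _ _ (\int[leb2]_(z in T) (gdens p s v z)%:E)%E).
  rewrite le_eqVlt; apply/orP; left; apply/eqP; apply: eq_integral => z _.
  by rewrite gagliardoE// (_ : (fun x => v x / 1) = v)//; apply/funext => x; rewrite divr1.
apply: ge0_subset_integral => //; first exact: (measurable_egdens H mv).
by move=> z _; rewrite lee_fin gdens_ge0.
Qed.

Lemma X0norm_set_nonempty v : measurable_fun setT v -> (modular p s v < +oo)%E ->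
  exists th : R, 0 < th /\ (\int[leb2]_z (gagliardo p s v th z)%:E < 1)%E.
Proof.
move=> mv fv; have M0 := modular_ge0 p s v.
pose M := fine (modular p s v).
have Mge : 0 <= M by rewrite fine_ge0.
have ME : modular p s v = M%:E by rewrite fineK// ge0_fin_numE.
pose th : R := 1 + M; have th1 : 1 <= th by rewrite /th lerDl.
have th0 : 0 < th by exact: lt_le_trans th1.
exists th; split=> //.
apply: (@le_lt_trans _ _ (\int[leb2]_z (th^-1%:E * (gdens p s v z)%:E))%E).
  apply: ge0_le_integral => //.
  - by move=> z _; rewrite lee_fin gagliardoE// gdens_ge0.
  - rewrite (_ : (fun z => _) = fun z => (gdens p s (fun x => v x / th)%R z)%:E).
      by apply: (measurable_egdens H); exact: measurable_funM.
    by apply/funext => z; rewrite gagliardoE.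
  - by apply: measurable_funeM; exact: (measurable_egdens H mv).
  move=> z _; rewrite -EFinM lee_fin gagliardoE//.
  rewrite (_ : (fun x => v x / th) = fun x => th^-1 * v x); last first.
    by apply/funext => x; rewrite mulrC.
  have ti0 : 0 <= th^-1 by rewrite invr_ge0 ltW.
  rewrite (gdens_scale _ _ _ _ ti0) ler_wpM2r ?gdens_ge0//.
  have ti1 : th^-1 <= 1 by rewrite invf_le1.
  rewrite -[leRHS](powRr1 ti0); apply: ger_powR.
    by rewrite invr_gt0 th0.
  exact/ltW/(p_gt1 H).
rewrite ge0_integralZl//; last 3 first.
- exact: (measurable_egdens H mv).
- by move=> z _; rewrite lee_fin gdens_ge0.
- by rewrite lee_fin invr_ge0 ltW.
rewrite -/(modular p s v) ME -EFinM lte_fin mulrC ltr_pdivrMr// mul1r /th.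
by rewrite ltrDr.
Qed.

Lemma X0norm_ge0 v : measurable_fun setT v -> (modular p s v < +oo)%E ->
  0 <= X0norm p s v.
Proof.
move=> mv fv; apply: lb_le_inf; first exact: (X0norm_set_nonempty mv fv).
by move=> th [/ltW].
Qed.

(** Any number above the norm normalises a function to modular at most one. *)
Lemma X0norm_lt v (th : R) : measurable_fun setT v -> (modular p s v < +oo)%E ->
  X0norm p s v < th -> 0 < th /\ (modular p s (fun x => v x / th)%R <= 1%:E)%E.
Proof.
move=> mv fv lt; have e0 : 0 < th - X0norm p s v by rewrite subr_gt0.
have hi : has_inf [set th : R | 0 < th /\
    (\int[leb2]_z (gagliardo p s v th z)%:E < 1)%E].
  by split; [exact: (X0norm_set_nonempty mv fv)|exists 0 => a [/ltW]].
have [a [a0 a1] ] := inf_adherent e0 hi.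
rewrite -/(X0norm p s v) addrC subrK => ath.
have th0 : 0 < th := lt_trans a0 ath; split=> //.
apply: (le_trans _ (ltW a1)); apply: ge0_le_integral => //.
- by move=> z _; rewrite lee_fin gdens_ge0.
- by apply: (measurable_egdens H); exact: measurable_funM.
- rewrite (_ : (fun z => _) = fun z => (gdens p s (fun x => v x / a)%R z)%:E).
    by apply: (measurable_egdens H); exact: measurable_funM.
  by apply/funext => z; rewrite gagliardoE.
move=> z _; rewrite lee_fin gagliardoE// /gdens ler_wpM2r ?invr_ge0 ?kernel_ge0//.
apply: powR_le => //; first exact/ltW/(p_gt0 H).
rewrite -!mulrBl !normrM ler_wpM2l// !normfV !gtr0_norm//.
by rewrite lef_pV2 ?posrE ?ltW.
Qed.

End X0_space.

(** * Frechet differentiability of the energy *)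

Lemma ler_mul_limit {R : realType} (x n C : R) : 0 <= n ->
  (forall t, n < t -> x <= C * t) -> x <= C * n.
Proof.
move=> n0 h; apply/ler_addgt0Pr => e e0.
have C1 : 0 < `|C| + 1 by rewrite ltr_wpDl.
have lt : n < n + e / (`|C| + 1) by rewrite ltrDl divr_gt0.
apply: le_trans (h _ lt) _; rewrite mulrDr lerD2l mulrA ler_pdivrMr//.
by rewrite mulrC ler_wpM2l ?(ltW e0)// (le_trans (ler_norm _))// lerDl.
Qed.

(** A quadratic bound for all numbers above [n] is a small o of [n]. *)
Lemma small_o_arith {R : realType} (x n K e : R) : 0 <= n -> 0 <= K -> 0 < e ->
  n < 1 / 2 -> n < e / (4 * (K + 1)) ->
  (forall t, n < t -> t <= 1 -> x <= K * t ^+ 2) -> x <= e * n.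
Proof.
move=> n0 K0 e0 n1 n2 h; have K1 : 0 < K + 1 by rewrite ltr_wpDl.
have [nz|nn] := eqVneq n 0.
  rewrite nz mulr0 leNgt; apply/negP => x0.
  pose t : R := Num.min 1 (x / (2 * (K + 1))).
  have t0 : 0 < t by rewrite lt_min ltr01 divr_gt0// mulr_gt0.
  have t1 : t <= 1 by rewrite ge_min lexx.
  have tK : t * (2 * (K + 1)) <= x.
    by rewrite -ler_pdivlMr ?mulr_gt0// ge_min lexx orbT.
  have := h t; rewrite nz => /(_ t0 t1); rewrite expr2.
  have : t * t <= t by rewrite ler_piMr// ltW.
  by move: t t0 t1 tK => t t0 t1 tK tt; nra.
have n0' : 0 < n by rewrite lt_neqAle eq_sym nn.
have := h (2 * n); rewrite ltr_pMl// ltr1n => /(_ isT).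
have -> : 2 * n <= 1 by lra.
move=> /(_ isT) /le_trans; apply.
have : n * (4 * (K + 1)) < e by rewrite -ltr_pdivlMr// mulr_gt0.
rewrite exprMn; move=> h4; rewrite [n ^+ 2]expr2 !mulrA ler_wpM2r//.
by apply: ltW; apply: le_lt_trans h4; nra.
Qed.

Section frechet.
Context {R : realType} {N : nat}.
Local Notation RN := 'rV[R]_N.
Local Notation leb := (lebesgue_rV N : {sigma_finite_measure set RN -> \bar R}).
Local Notation leb2 := (leb \x leb)%E.
Context (p s : RN -> RN -> R) (pm pM : R) (H : admissible p s pm pM).
Context (Omega : set RN) (mO : measurable Omega) (Ooo : (leb Omega < +oo)%E).
Context (q alpha h : RN -> R) (f F : RN -> R -> R) (aM r hM lambda beta S : R).
Context (alpha_meas : measurable_fun Omega alpha)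
  (alpha2 : forall x, Omega x -> 2 < alpha x)
  (alphaM : forall x, Omega x -> alpha x <= aM) (aM2 : 2 < aM) (aM_r : aM <= r) (r2 : 2 < r)
  (h_meas : measurable_fun Omega h) (h_le : forall x, Omega x -> `|h x| <= hM)
  (hM0 : 0 <= hM) (lambda0 : 0 <= lambda) (beta0 : 0 <= beta).
Context (f_meas : forall g : RN -> R, measurable_fun Omega g ->
    measurable_fun Omega (fun x => f x (g x)))
  (F_meas : forall g : RN -> R, measurable_fun Omega g ->
    measurable_fun Omega (fun x => F x (g x)))
  (f_ae : {ae leb, forall x, Omega x ->
     forall t, f x t = h x * npart t `^ (r - 1)})
  (F_ae : {ae leb, forall x, Omega x ->
     forall t, F x t = - (h x * (npart t `^ r / r))})
  (f_le : forall x t, Omega x -> `|t| <= 1 -> `|f x t| <= hM).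
(* The only information on the embedding that is needed. *)
Context (sobolev : forall w : RN -> R, measurable_fun setT w ->
  (forall x, ~ Omega x -> w x = 0) -> (modular p s w <= 1%:E)%E ->
  (\int[leb]_(x in Omega) (`|w x| `^ r)%:E <= S%:E)%E).
Implicit Types (u v w : RN -> R) (z : RN * RN).
Local Notation zero_ext := (zero_ext Omega).
Local Notation J := (energy Omega p s alpha F lambda beta).
Local Notation in_X0 := (in_X0 Omega p s q).
Local Notation integO g := (leb.-integrable Omega (EFin \o g)).

Let V : R := fine (leb Omega).

Let V0 : 0 <= V. Proof. by rewrite fine_ge0. Qed.

(** Variations for which all the integrals below converge. *)
Record variation v : Prop := Variation {
  var_meas : measurable_fun setT v;
  var_fin : (modular p s v < +oo)%E;
  var_int : integO (fun x => 1 + `|v x| `^ r) }.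

Let W : R := V + S.

Lemma integrable_cstO (c : R) : integO (fun=> c).
Proof. exact: (@integ_bounded _ _ _ leb _ _ `|c|). Qed.

Lemma norm_le_powR (t e : R) : 1 <= e -> e <= r -> `|t| `^ e <= 1 + `|t| `^ r.
Proof.
move=> e1 er; have [t1|/ltW t1] := leP `|t| 1.
  have := powR_le (le_trans ler01 e1) (normr_ge0 t) t1; rewrite powR1.
  by move=> /le_trans; apply; rewrite lerDl powR_ge0.
by apply: le_trans (ler_powR t1 er) _; rewrite lerDr.
Qed.

Lemma norm_le_one_powR (t : R) : `|t| <= 1 + `|t| `^ r.
Proof.
have r1 : 1 <= r by apply: ltW; apply: lt_trans r2; rewrite ltr1n.
by have := norm_le_powR t (lexx 1) r1; rewrite powRr1.
Qed.

Lemma unit_variation w : measurable_fun setT w ->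
  (forall x, ~ Omega x -> w x = 0) -> (modular p s w <= 1%:E)%E ->
  variation w /\ \int[leb]_(x in Omega) (1 + `|w x| `^ r) <= W.
Proof.
move=> mw w0 w1.
have mr : measurable_fun Omega (fun x => `|w x| `^ r).
  apply: measurable_powR_fun => //; apply: measurableT_comp => //.
  exact: measurable_funTS.
have le := sobolev mw w0 w1.
have ir : integO (fun x => `|w x| `^ r).
  apply: integ_ge0 => //; exact: le_lt_trans le (ltry _).
have i1 := integrable_cstO 1.
split; first by split=> //; [exact: le_lt_trans w1 (ltry _)|exact: (integ_add mO i1 ir)].
rewrite (RintegralD mO i1 ir) (Rintegral_cst leb mO) mul1r /W lerD2l.
by rewrite -lee_fin (EFin_Rintegral mO ir).
Qed.

(** An element of the space is a multiple, by any number above its norm, of a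
    function of modular at most one vanishing off the domain. *)
Lemma X0_rescale v (th : R) : in_X0 v -> X0norm p s v < th ->
  let w x := zero_ext v x / th in
  [/\ 0 < th, variation w, (modular p s w <= 1%:E)%E,
      \int[leb]_(x in Omega) (1 + `|w x| `^ r) <= W &
      {ae leb, forall x, v x = th * w x} /\ forall x, Omega x -> v x = th * w x].
Proof.
move=> Xv lt w; have mv := in_X0_measurable Xv.
have fv := in_X0_modular H mO Xv.
have [th0 m1] := X0norm_lt H mv fv lt.
have mz := measurable_zero_ext mO mv.
have mw : measurable_fun setT w by exact: measurable_funM.
have w0 x : ~ Omega x -> w x = 0 by move=> nO; rewrite /w zero_ext_out// mul0r.
have thw x : th * w x = zero_ext v x by rewrite /w mulrCA divff ?mulr1// gt_eqF.
have w1 : (modular p s w <= 1%:E)%E.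
  have mvt : measurable_fun setT (fun x => v x / th) by exact: measurable_funM.
  rewrite -(eq_ae_modular H mvt mw) ?m1//.
  by apply: filterS (in_X0_ae Xv) => x vx; rewrite /w -vx.
have [vw iw] := unit_variation mw w0 w1.
split=> //; split=> [|x Ox]; last by rewrite thw zero_ext_in.
by apply: filterS (in_X0_ae Xv) => x vx; rewrite thw.
Qed.

Lemma variation_scale (c : R) w : 0 <= c -> variation w ->
  variation (fun x => c * w x).
Proof.
move=> c0 [mw fw iw]; split; first exact: measurable_funM.
  exact: (modular_scale_fin H mw c0 fw).
have i1 := integ_scale (1 + c `^ r) mO iw.
apply: (integ_le mO _ _ i1).
  apply: measurable_funD => //; apply: measurable_powR_fun => //.
  apply: measurableT_comp => //; apply: measurable_funTS; exact: measurable_funM.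
move=> x Ox; rewrite ger0_norm ?addr_ge0 ?powR_ge0//.
rewrite normrM (ger0_norm c0) powRM//.
have := powR_ge0 c r; have := powR_ge0 `|w x| r.
move: (c `^ r) (`|w x| `^ r) => a1 a2 h1 h2; nra.
Qed.

Lemma in_X0_variation v : in_X0 v -> variation v.
Proof.
move=> Xv; have mv := in_X0_measurable Xv; have fv := in_X0_modular H mO Xv.
have lt : X0norm p s v < X0norm p s v + 1 by rewrite ltrDl.
have [th0 vw _ _ [_ vE]] := X0_rescale Xv lt.
have [_ _ iw] := variation_scale (ltW th0) vw.
split=> //; apply: eq_integrable iw => // x /set_mem Ox /=.
by rewrite -vE.
Qed.

Lemma variation_sqr v : variation v -> integO (fun x => v x ^+ 2).
Proof.
move=> [mv _ iv]; apply: (integ_le mO _ _ iv).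
  by apply: measurable_funTS; exact: measurable_funX.
move=> x Ox; rewrite normrX -powR_mulrn//; apply: norm_le_powR; last exact: ltW.
by rewrite ler1n.
Qed.

Section derivative.
Context (u : RN -> R) (mu : measurable_fun setT u) (u1 : forall x, `|u x| <= 1)
  (fu : (modular p s u < +oo)%E).

(** The candidate derivative of the energy at [u]. *)
Definition denergy v : R :=
  \int[leb2]_z weak_lhs p s u v z
  - beta * \int[leb]_(x in Omega) (`|u x| `^ (alpha x - 2) * u x * v x)
  - lambda * \int[leb]_(x in Omega) (f x (u x) * v x).

Let uO : measurable_fun Omega u. Proof. exact: measurable_funTS. Qed.

Lemma integrable_unit_mul (g : RN -> R) (C : R) v : measurable_fun Omega g ->
  (forall x, Omega x -> `|g x| <= C) -> variation v ->
  integO (fun x => g x * v x) /\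
  `|\int[leb]_(x in Omega) (g x * v x)|
    <= C * \int[leb]_(x in Omega) (1 + `|v x| `^ r).
Proof.
move=> mg gC [mv _ iv]; have iC := integ_scale C mO iv.
have le x : Omega x -> `|g x * v x| <= C * (1 + `|v x| `^ r).
  move=> Ox; rewrite normrM; apply: ler_pM => //; first exact: gC.
  exact: norm_le_one_powR.
have i : integO (fun x => g x * v x).
  apply: (integ_le mO _ le iC); apply: measurable_funM => //.
  exact: measurable_funTS.
split=> //; apply: le_trans (le_normr_Rintegral mO i) _.
rewrite -(RintegralZl C mO iv); apply: le_Rintegral => //.
exact: (integ_abs mO i).
Qed.

Lemma measurable_spow_comp :
  measurable_fun Omega (fun x => `|u x| `^ (alpha x - 2) * u x).
Proof.
apply: measurable_funM => //; apply: measurable_powR_fun.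
  exact: measurableT_comp.
exact: measurable_funB.
Qed.

Lemma spow_comp_le x : Omega x -> `| `|u x| `^ (alpha x - 2) * u x| <= 1.
Proof.
move=> Ox; rewrite normrM ger0_norm ?powR_ge0// mulr_ile1 ?powR_ge0//.
by apply: unit_powR_le1; rewrite ?normr_ge0 ?u1// subr_ge0 ltW// alpha2.
Qed.

Lemma measurable_npart_comp :
  measurable_fun Omega (fun x => h x * npart (u x) `^ (r - 1)).
Proof.
apply: measurable_funM => //; apply: measurable_powR_fun => //.
by apply: measurable_maxr => //; exact: measurableT_comp.
Qed.

Lemma npart_comp_le x : Omega x -> `|h x * npart (u x) `^ (r - 1)| <= hM.
Proof.
move=> Ox; rewrite normrM -[leRHS]mulr1; apply: ler_pM => //; first exact: h_le.
have r1 : 0 <= r - 1 by rewrite subr_ge0 ltW// (lt_trans _ r2)// ltr1n.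
rewrite ger0_norm ?powR_ge0//; apply: (unit_powR_le1 _ r1).
by rewrite npart_ge0 (le_trans (npart_le_norm _)).
Qed.

Lemma denergy_linear (a : R) v w : variation v -> variation w ->
  denergy (fun x => a * v x + w x) = a * denergy v + denergy w.
Proof.
move=> vv vw.
have [iv1 _] := integrable_unit_mul measurable_spow_comp spow_comp_le vv.
have [iw1 _] := integrable_unit_mul measurable_spow_comp spow_comp_le vw.
have fl x : Omega x -> `|f x (u x)| <= hM by move=> Ox; exact: f_le.
have [iv2 _] := integrable_unit_mul (f_meas uO) fl vv.
have [iw2 _] := integrable_unit_mul (f_meas uO) fl vw.
have [mv fv _] := vv; have [mw fw _] := vw.
have iv3 := integrable_weak_lhs H mu fu mv fv.
have iw3 := integrable_weak_lhs H mu fu mw fw.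
rewrite /denergy.
rewrite (_ : Rintegral leb2 _ _ = a * Rintegral leb2 setT (weak_lhs p s u v)
    + Rintegral leb2 setT (weak_lhs p s u w)); last first.
  transitivity (Rintegral leb2 setT
      (fun z => a * weak_lhs p s u v z + weak_lhs p s u w z)).
    by apply: eq_Rintegral => z _; rewrite /weak_lhs; ring.
  have iav := integ_scale a measurableT iv3.
  by rewrite (RintegralD measurableT iav iw3) (RintegralZl a measurableT iv3).
have lin g (iv : integO (fun x => g x * v x)) (iw : integO (fun x => g x * w x)) :
  \int[leb]_(x in Omega) (g x * (a * v x + w x)) =
  a * \int[leb]_(x in Omega) (g x * v x) + \int[leb]_(x in Omega) (g x * w x).
  transitivity (\int[leb]_(x in Omega) (a * (g x * v x) + g x * w x)).
    by apply: eq_Rintegral => z _; ring.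
  have iav := integ_scale a mO iv.
  by rewrite (RintegralD mO iav iw) (RintegralZl a mO iv).
rewrite (lin _ iv1 iw1) (lin _ iv2 iw2).
move: (Rintegral _ _ _) (Rintegral _ _ _) (Rintegral _ _ _) (Rintegral _ _ _).
by move: (Rintegral _ _ _) (Rintegral _ _ _) => *; ring.
Qed.

(** The explicit form, almost everywhere, of the potential [F]. *)
Let potential (g : RN -> R) x : R := - (h x * (npart (g x) `^ r / r)).

Lemma measurable_potential g : measurable_fun Omega g ->
  measurable_fun Omega (potential g).
Proof.
move=> mg; apply: measurableT_comp => //; apply: measurable_funM => //.
apply: measurable_fun_div => //; apply: measurable_powR_fun => //.
by apply: measurable_maxr => //; exact: measurableT_comp.
Qed.

Lemma energyE g : measurable_fun Omega g ->
  J g = Phi p s g - beta * \int[leb]_(x in Omega) (`|g x| `^ alpha x / alpha x)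
    - lambda * \int[leb]_(x in Omega) potential g x.
Proof.
move=> mg; rewrite /energy; congr (_ - _ * _); congr fine.
apply: ae_eq_integral => //.
- by apply/measurable_EFinP; exact: F_meas.
- by apply/measurable_EFinP; exact: measurable_potential.
by apply: filterS F_ae => x FE Ox; rewrite FE.
Qed.

Lemma measurable_power (g : RN -> R) : measurable_fun Omega g ->
  measurable_fun Omega (fun x => `|g x| `^ alpha x / alpha x).
Proof.
move=> mg; apply: measurable_fun_div => //; apply: measurable_powR_fun => //.
exact: measurableT_comp.
Qed.

Let kA : R := (aM - 1) * 3 `^ (aM - 2).
Let kG : R := hM * ((r - 1) * 3 `^ (r - 2)).

Lemma power_expansion w (e : R) x : Omega x -> 0 <= e <= 1 ->
  `| `|u x + e * w x| `^ alpha x / alpha x - `|u x| `^ alpha x / alpha x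
     - e * (`|u x| `^ (alpha x - 2) * u x * w x)|
  <= kA * e ^+ 2 * 2 * (1 + `|w x| `^ r).
Proof.
move=> Ox e01; have a2 := alpha2 Ox; have aM' := alphaM Ox.
apply: le_trans (spow_taylor_scale (u x) (w x) a2 e01) _.
have a1 : 1 <= alpha x by lra.
have ua : `|u x| `^ alpha x <= 1.
  by apply: unit_powR_le1; [rewrite normr_ge0 u1|lra].
have wa := norm_le_powR (w x) a1 (le_trans aM' aM_r).
have wr := powR_ge0 `|w x| r.
rewrite -(mulrA _ 2); apply: ler_pM.
- apply: mulr_ge0; last exact: sqr_ge0.
  by apply: mulr_ge0; [rewrite subr_ge0|exact: powR_ge0].
- by rewrite addr_ge0 ?powR_ge0.
- rewrite ler_wpM2r ?sqr_ge0//; apply: ler_pM; rewrite ?powR_ge0 ?subr_ge0//.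
    by rewrite lerD2r.
  by apply: ler_powR; rewrite ?ler1n// lerD2r.
by move: ua wa wr; move: (`|u x| `^ _) (`|w x| `^ _) (`|w x| `^ r) => b1 b2 b3; lra.
Qed.

Lemma potential_expansion w (e : R) x : Omega x -> 0 <= e <= 1 ->
  `|potential (fun x => u x + e * w x) x - potential u x
     - e * (h x * npart (u x) `^ (r - 1) * w x)|
  <= kG * e ^+ 2 * 2 * (1 + `|w x| `^ r).
Proof.
move=> Ox e01; rewrite /potential.
set n1 := npart _ `^ r / r; set n0 := npart _ `^ r / r.
rewrite (_ : - (h x * n1) - - (h x * n0)
    - e * (h x * npart (u x) `^ (r - 1) * w x) =
  - h x * (n1 - n0 - e * - (npart (u x) `^ (r - 1) * w x))); last by ring.
rewrite (_ : kG * e ^+ 2 * 2 * (1 + `|w x| `^ r) =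
  hM * ((r - 1) * 3 `^ (r - 2) * e ^+ 2 * (2 * (1 + `|w x| `^ r)))); last first.
  by rewrite /kG; ring.
rewrite normrM normrN; apply: ler_pM => //; first exact: h_le.
have r2' : 2 < r := r2.
apply: le_trans (npart_taylor_scale (u x) (w x) r2 e01) _.
have r1 : 1 <= r by lra.
have ua : `|u x| `^ r <= 1.
  by apply: unit_powR_le1; [rewrite normr_ge0 u1|lra].
have wr := powR_ge0 `|w x| r.
apply: ler_wpM2l.
  apply: mulr_ge0; last exact: sqr_ge0.
  by apply: mulr_ge0; [rewrite subr_ge0|exact: powR_ge0].
by move: ua wr; move: (`|u x| `^ _) (`|w x| `^ r) => b1 b3; lra.
Qed.

Lemma denergyE v : variation v -> denergy v =
  \int[leb2]_z weak_lhs p s u v z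
  - beta * \int[leb]_(x in Omega) (`|u x| `^ (alpha x - 2) * u x * v x)
  - lambda * \int[leb]_(x in Omega) (h x * npart (u x) `^ (r - 1) * v x).
Proof.
move=> [mv _ _]; rewrite /denergy; congr (_ - _ * _); congr fine.
have mvO : measurable_fun Omega v by exact: measurable_funTS.
apply: ae_eq_integral => //.
- by apply/measurable_EFinP; apply: measurable_funM => //; exact: f_meas.
- apply/measurable_EFinP; apply: measurable_funM => //; apply: measurable_funM => //.
  apply: measurable_powR_fun => //.
  by apply: measurable_maxr => //; exact: measurableT_comp.
by apply: filterS f_ae => x fE Ox; rewrite fE.
Qed.

(** The constant of the quadratic remainder of the energy. *)
Definition energyC : R :=
  taylorC pM * (fine (modular p s u) + 1) + beta * (kA * 2 * W)
    + lambda * (kG * 2 * W).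

Lemma expansion_arith (P1 P0 P' A1 A0 A' G1 G0 G' e T M kA' kG' W' I Mw : R) :
  `|P1 - P0 - e * P'| <= T * e ^+ 2 * (M + Mw) -> Mw <= 1 -> 0 <= T ->
  `|A1 - A0 - e * A'| <= kA' * e ^+ 2 * 2 * I ->
  `|G1 - G0 - e * G'| <= kG' * e ^+ 2 * 2 * I -> I <= W' -> 0 <= kA' -> 0 <= kG' ->
  `|P1 - beta * A1 - lambda * G1 - (P0 - beta * A0 - lambda * G0)
     - e * (P' - beta * A' - lambda * G')|
  <= (T * (M + 1) + beta * (kA' * 2 * W') + lambda * (kG' * 2 * W')) * e ^+ 2.
Proof.
move=> hP hM' T0 hA hG IW kA0 kG0; have e2 : 0 <= e ^+ 2 by exact: sqr_ge0.
have step X k : 0 <= k -> X <= k * e ^+ 2 * 2 * I -> X <= k * 2 * W' * e ^+ 2.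
  move=> k0 /le_trans; apply.
  rewrite (_ : k * e ^+ 2 * 2 * I = k * 2 * e ^+ 2 * I); last by ring.
  rewrite (_ : k * 2 * W' * e ^+ 2 = k * 2 * e ^+ 2 * W'); last by ring.
  by apply: ler_wpM2l => //; apply: mulr_ge0 => //; exact: mulr_ge0.
have {}hA := step _ _ kA0 hA; have {}hG := step _ _ kG0 hG.
rewrite (_ : P1 - beta * A1 - lambda * G1 - (P0 - beta * A0 - lambda * G0)
     - e * (P' - beta * A' - lambda * G') = (P1 - P0 - e * P')
  - beta * (A1 - A0 - e * A') - lambda * (G1 - G0 - e * G')); last by ring.
apply: le_trans (ler_normB _ _) _; rewrite !mulrDl; apply: lerD.
  apply: le_trans (ler_normB _ _) _; apply: lerD.
    apply: le_trans hP _; rewrite mulrAC ler_wpM2r// ler_wpM2l//.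
    by rewrite lerD2l.
  by rewrite normrM (ger0_norm beta0) -mulrA ler_wpM2l.
by rewrite normrM (ger0_norm lambda0) -mulrA ler_wpM2l.
Qed.

(** Second order expansion of the energy along a normalised direction. *)
Lemma energy_expansion w (e : R) : variation w -> (modular p s w <= 1%:E)%E ->
  \int[leb]_(x in Omega) (1 + `|w x| `^ r) <= W -> 0 <= e <= 1 ->
  `|J (fun x => u x + e * w x) - J u - e * denergy w| <= energyC * e ^+ 2.
Proof.
move=> vw w1 wW e01; have [mw fw iw] := vw.
have r2' : 2 < r := r2; have aM2' : 2 < aM := aM2.
have r0 : 0 < r by lra.
have r1 : 1 <= r by lra.
have r10 : 0 <= r - 1 by lra.
have kA0 : 0 <= kA by rewrite mulr_ge0 ?powR_ge0//; lra.
have kG0 : 0 <= kG by rewrite !mulr_ge0 ?powR_ge0.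
have alpha0 x : Omega x -> 0 < alpha x by move=> /alpha2; lra.
have alpha1 x : Omega x -> 1 <= alpha x by move=> /alpha2; lra.
have mwO : measurable_fun Omega w by exact: measurable_funTS.
have muw : measurable_fun Omega (fun x => u x + e * w x).
  by apply: measurable_funD => //; exact: measurable_funM.
have hP := Phi_taylor H mu fu mw fw e01.
have iu : integO (fun x => `|u x| `^ alpha x / alpha x).
  apply: (@integ_bounded _ _ _ leb _ _ 1) => //; first exact: measurable_power.
  move=> x Ox; have a0 := alpha0 x Ox.
  rewrite ger0_norm ?divr_ge0 ?powR_ge0 ?(ltW a0)// ler_pdivrMr// mul1r.
  apply: (@le_trans _ _ 1); last exact: alpha1.
  by apply: unit_powR_le1; [rewrite normr_ge0 u1|exact: ltW].
have ip : integO (potential u).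
  apply: (@integ_bounded _ _ _ leb _ _ hM) => //; first exact: measurable_potential.
  move=> x Ox; rewrite /potential normrN normrM -[leRHS]mulr1.
  apply: ler_pM => //; first exact: h_le.
  rewrite ger0_norm ?divr_ge0 ?powR_ge0 ?(ltW r0)// ler_pdivrMr// mul1r.
  apply: (@le_trans _ _ 1); last exact: r1.
  apply: unit_powR_le1; last exact: ltW.
  by rewrite npart_ge0 (le_trans (npart_le_norm _)).
have [id1 _] := integrable_unit_mul measurable_spow_comp spow_comp_le vw.
have [id2 _] := integrable_unit_mul measurable_npart_comp npart_comp_le vw.
have [_ hA] := Rintegral_taylor mO (measurable_power muw) iu id1 iw
  (fun x Ox => power_expansion w Ox e01).
have [_ hG] := Rintegral_taylor mO (measurable_potential muw) ip id2 iw
  (fun x Ox => potential_expansion w Ox e01).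
rewrite (energyE muw) (energyE uO) (denergyE vw).
apply: (expansion_arith hP _ (taylorC_ge0 H) hA hG wW kA0 kG0).
by rewrite -lee_fin fineK// ge0_fin_numE ?modular_ge0//.
Qed.

Lemma denergy_eq v w : measurable_fun setT v -> measurable_fun setT w ->
  {ae leb, forall x, v x = w x} -> (forall x, Omega x -> v x = w x) ->
  denergy v = denergy w.
Proof.
move=> mv mw vw vwO; rewrite /denergy.
have -> : Rintegral leb2 setT (weak_lhs p s u v) =
    Rintegral leb2 setT (weak_lhs p s u w).
  have vw1 : {ae leb2, forall z, v z.1 = w z.1} := ae_prod1 leb vw.
  have vw2 : {ae leb2, forall z, v z.2 = w z.2} := ae_prod2 leb vw.
  congr fine; apply: ae_eq_integral => //.
  - by apply/measurable_EFinP; exact: (measurable_weak_lhs H mu mv).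
  - by apply/measurable_EFinP; exact: (measurable_weak_lhs H mu mw).
  by apply: filterS2 vw1 vw2 => z e1 e2 _; rewrite /weak_lhs e1 e2.
congr (_ - _ * _ - _ * _); apply: eq_Rintegral => x /set_mem Ox; by rewrite vwO.
Qed.

Lemma denergy_scale (a : R) w : variation w ->
  denergy (fun x => a * w x) = a * denergy w.
Proof.
move=> vw; have := denergy_linear (a - 1) vw vw.
rewrite (_ : (fun x => (a - 1) * w x + w x) = fun x => a * w x).
  by move=> ->; rewrite mulrBl mul1r subrK.
by apply/funext => x; rewrite mulrBl mul1r subrK.
Qed.

Let denergyC : R := fine (modular p s u) + 1 + beta * W + lambda * (hM * W).

Lemma denergy_le w : variation w -> (modular p s w <= 1%:E)%E ->
  \int[leb]_(x in Omega) (1 + `|w x| `^ r) <= W -> `|denergy w| <= denergyC.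
Proof.
move=> vw w1 wW; have [mw fw iw] := vw.
have [_ l1] := integrable_unit_mul measurable_spow_comp spow_comp_le vw.
have fl x : Omega x -> `|f x (u x)| <= hM by move=> Ox; exact: f_le.
have [_ l2] := integrable_unit_mul (f_meas uO) fl vw.
have l3 : `|Rintegral leb2 setT (weak_lhs p s u w)| <= fine (modular p s u) + 1.
  have ig := integrable_gdens H mu fu; have iw' := integrable_gdens H mw fw.
  have il := integrable_weak_lhs H mu fu mw fw.
  apply: le_trans (le_normr_Rintegral measurableT il) _.
  apply: (@le_trans _ _ (\int[leb2]_z (gdens p s u z + gdens p s w z))).
    apply: le_Rintegral => //; first exact: (integ_abs measurableT il).
      exact: (integ_add measurableT ig iw').
    by move=> z _; exact: (weak_lhs_le H).
  rewrite (RintegralD measurableT ig iw'); apply: lerD; first exact: lexx.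
  rewrite -lee_fin; apply: le_trans w1.
  by rewrite (EFin_Rintegral measurableT iw').
rewrite mul1r in l1; rewrite /denergy /denergyC.
apply: le_trans (ler_normB _ _) _; apply: lerD; last first.
  rewrite normrM (ger0_norm lambda0) ler_wpM2l//; apply: le_trans l2 _.
  by rewrite ler_wpM2l.
apply: le_trans (ler_normB _ _) _; apply: lerD; first exact: l3.
by rewrite normrM (ger0_norm beta0) ler_wpM2l// (le_trans l1).
Qed.

(** Rescaling by numbers slightly above the norm turns the expansion along
    normalised directions into Frechet differentiability. *)
Theorem energy_frechet : is_frechet_derivative Omega p s q J u denergy.
Proof.
split.
- by move=> a v w Xv Xw; apply: denergy_linear; exact: in_X0_variation.
- exists denergyC => v Xv.
  have mv := in_X0_measurable Xv; have fv := in_X0_modular H mO Xv.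
  have n0 := X0norm_ge0 H mv fv.
  have le th : X0norm p s v < th -> `|denergy v| <= denergyC * th.
    move=> lt; have [th0 vw w1 wW [vae vO]] := X0_rescale Xv lt.
    rewrite (denergy_eq mv _ vae vO); last by apply: measurable_funM => //; case: vw.
    rewrite denergy_scale// normrM gtr0_norm// mulrC ler_wpM2r ?(ltW th0)//.
    exact: denergy_le.
  exact: (ler_mul_limit n0 le).
move=> e e0; exists (Num.min (1 / 2) (e / (4 * (`|energyC| + 1)))).
  by rewrite lt_min !divr_gt0// mulr_gt0// ltr_wpDl.
move=> v Xv; rewrite lt_min => /andP[n1 n2].
have mv := in_X0_measurable Xv; have fv := in_X0_modular H mO Xv.
have n0 := X0norm_ge0 H mv fv.
apply: (small_o_arith n0 (normr_ge0 energyC) e0 n1 n2) => th lt th1.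
have [th0 vw w1 wW [vae vO]] := X0_rescale Xv lt.
have th01 : 0 <= th <= 1 by rewrite ltW.
have := energy_expansion vw w1 wW th01.
rewrite -denergy_scale//.
set w := fun x : RN => zero_ext v x / th in vw w1 wW vae vO *.
have mw : measurable_fun setT w by case: vw.
have mtw : measurable_fun setT (fun x => th * w x) by exact: measurable_funM.
rewrite -(denergy_eq mv mtw vae vO).
have -> : J (fun x => u x + th * w x) = J (u \+ v).
  have m1 : measurable_fun setT (fun x => u x + th * w x).
    exact: measurable_funD.
  have m2 : measurable_fun setT (u \+ v) by exact: measurable_funD.
  rewrite (energyE (measurable_funTS m1)) (energyE (measurable_funTS m2)).
  have e1 : Phi p s (fun x => u x + th * w x) = Phi p s (u \+ v).
    by apply: (eq_ae_Phi H m1 m2); apply: filterS vae => x vx /=; rewrite -vx.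
  have e2 : Rintegral leb Omega
      (fun x => `|u x + th * w x| `^ alpha x / alpha x) =
      Rintegral leb Omega (fun x => `|(u \+ v) x| `^ alpha x / alpha x).
    by apply: eq_Rintegral => x /set_mem Ox /=; rewrite (vO x Ox).
  have e3 : Rintegral leb Omega (potential (fun x => u x + th * w x)) =
      Rintegral leb Omega (potential (u \+ v)).
    by apply: eq_Rintegral => x /set_mem Ox /=; rewrite /potential /= (vO x Ox).
  by rewrite e1 e2 e3.
move=> /le_trans; apply; rewrite ler_wpM2r ?sqr_ge0//; exact: ler_norm.
Qed.

(** A bounded solution of the Euler equation, tested with functions vanishing
    everywhere off the domain, is a weak solution; testing it with itself shows
    that it lies on the Nehari manifold. *)
Theorem euler_solution : in_X0 u -> ~ {ae leb, forall x, u x = 0} ->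
  (forall v, variation v -> (forall x, ~ Omega x -> v x = 0) ->
    \int[leb2]_z weak_lhs p s u v z =
      \int[leb]_(x in Omega) (beta * (`|u x| `^ (alpha x - 2) * u x * v x)
        + lambda * (h x * npart (u x) `^ (r - 1) * v x))) ->
  [/\ weak_solution Omega p s q alpha f lambda beta u,
      ~ {ae leb, forall x, u x = 0},
      nehari Omega p s q alpha F lambda beta u & in_Linfty Omega u].
Proof.
move=> Xu un0 euler.
have d0 v : in_X0 v -> denergy v = 0.
  move=> Xv; have mv := in_X0_measurable Xv.
  have vv := in_X0_variation Xv.
  have mz := measurable_zero_ext mO mv.
  have zae := in_X0_ae Xv.
  have zin x : Omega x -> v x = zero_ext v x by move=> Ox; rewrite zero_ext_in.
  have vz : variation (zero_ext v).
    split; [exact: mz|by rewrite -(eq_ae_modular H mv mz zae); case: vv|].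
    case: vv => _ _; apply: eq_integrable => // x /set_mem Ox /=.
    by rewrite zero_ext_in.
  have zout x : ~ Omega x -> zero_ext v x = 0 by exact: zero_ext_out.
  rewrite (denergy_eq mv mz zae zin) (denergyE vz) (euler _ vz zout).
  have [i1 _] := integrable_unit_mul measurable_spow_comp spow_comp_le vz.
  have [i2 _] := integrable_unit_mul measurable_npart_comp npart_comp_le vz.
  have j1 := integ_scale beta mO i1; have j2 := integ_scale lambda mO i2.
  rewrite (RintegralD mO j1 j2) (RintegralZl beta mO i1) (RintegralZl lambda mO i2).
  by move: (Rintegral _ _ _) (Rintegral _ _ _) => a b; ring.
have fl x : Omega x -> `|f x (u x)| <= hM by move=> Ox; exact: f_le.
split=> //.
- split=> // v Xv; have vv := in_X0_variation Xv; have [mv fv _] := vv.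
  have [i1 _] := integrable_unit_mul measurable_spow_comp spow_comp_le vv.
  have [i2 _] := integrable_unit_mul (f_meas uO) fl vv.
  split; [exact: (integrable_weak_lhs H mu fu mv fv)|exact: i1|exact: i2|].
  have := d0 v Xv; rewrite /denergy.
  by move: (Rintegral _ _ _) (Rintegral _ _ _) (Rintegral _ _ _) => a b c; lra.
- by split=> //; exists denergy; [exact: energy_frechet|exact: d0].
by split=> //; exists 1; apply: aeW => x _; exact: u1.
Qed.

End derivative.

End frechet.

(** * The homogeneous nonlinearity *)

Section signed_power_calculus.
Context {R : realType}.
Implicit Types (g : R -> R) (a c l K P : R).

Lemma continuous_of_lipschitz_at g a K :
  (forall c, `|c - a| <= 1 -> `|g c - g a| <= K * `|c - a|) ->
  {for a, continuous g}.
Proof.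
move=> lip; apply/cvgrPdist_le => e e0; near=> c.
have ca1 : `|c - a| <= 1.
  by near: c; apply/nbhs_ballP; exists 1 => //= c; rewrite /ball_ /= distrC => /ltW.
rewrite distrC; apply: le_trans (lip c ca1) _.
have K1 : 0 < `|K| + 1 by rewrite ltr_wpDl.
apply: (@le_trans _ _ ((`|K| + 1) * `|c - a|)).
  by rewrite ler_wpM2r// (le_trans (ler_norm _))// lerDl.
rewrite mulrC -ler_pdivlMr//; near: c; apply/nbhs_ballP.
exists (e / (`|K| + 1)) => /=; first exact: divr_gt0.
by move=> c; rewrite /ball_ /= distrC => /ltW.
Unshelve. all: by end_near. Qed.

Lemma is_derive_of_quadratic g a l K :
  (forall c, `|c - a| <= 1 -> `|g c - g a - l * (c - a)| <= K * (c - a) ^+ 2) ->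
  is_derive a 1 g l.
Proof.
move=> quad.
have cv : h^-1 *: (g (h *: 1 + a) - g a) @[h --> 0^'] --> l.
  apply/cvgrPdist_le => e e0; near=> t.
  have tn0 : t != 0 by near: t; exact: nbhs_dnbhs_neq.
  have t1 : `|t| <= 1.
    near: t; apply: dnbhs0_le => //.
  have K1 : 0 < `|K| + 1 by rewrite ltr_wpDl.
  have te : `|t| <= e / (`|K| + 1).
    by near: t; apply: dnbhs0_le; exact: divr_gt0.
  have E : t *: 1 + a - a = t by rewrite addrK /GRing.scale /= mulr1.
  have := quad (t *: 1 + a); rewrite E => /(_ t1) h.
  rewrite distrC (_ : _ - l = t^-1 * (g (t *: 1 + a) - g a - l * t)); last first.
    by rewrite mulrBr mulrCA mulVf// mulr1.
  rewrite normrM normfV ler_pdivrMl ?normr_gt0//; apply: le_trans h _.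
  rewrite -(real_normK (num_real t)) expr2 mulrCA ler_wpM2l//.
  move: te; rewrite ler_pdivlMr// mulrC; apply: le_trans.
  by rewrite ler_wpM2r// (le_trans (ler_norm _))// lerDl.
apply: DeriveDef; first by apply/cvg_ex; exists l.
exact: (cvg_lim (@Rhausdorff R) cv).
Unshelve. all: by end_near. Qed.

Lemma spow_base_le P a c : 2 <= P -> `|c - a| <= 1 ->
  (`|a| + `|c|) `^ (P - 2) <= (2 * `|a| + 1) `^ (P - 2).
Proof.
move=> P2 ca; apply: powR_le; rewrite ?subr_ge0// ?addr_ge0//.
have := ler_normD (c - a) a; rewrite subrK.
by move: (`|c|) (`|a|) (`|c - a|) ca => x y z ca h; lra.
Qed.

Lemma continuous_spow P a : 2 <= P -> {for a, continuous (spow P)}.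
Proof.
move=> P2; apply: (@continuous_of_lipschitz_at _ _ ((P - 1) * (2 * `|a| + 1) `^ (P - 2))).
move=> c ca; apply: le_trans (spow_lipschitz a c P2) _.
by rewrite ler_wpM2r// ler_wpM2l ?spow_base_le//; lra.
Qed.

Lemma is_derive_power P a : 2 <= P ->
  is_derive a 1 (fun t => `|t| `^ P / P) (spow P a).
Proof.
move=> P2; have P1 : 1 < P by lra.
apply: (@is_derive_of_quadratic _ _ _ ((P - 1) * (2 * `|a| + 1) `^ (P - 2))).
move=> c ca; have := spow_tangent a c P1; have := spow_taylor a c P2.
move=> up lo; rewrite ger0_norm; last by lra.
apply: le_trans up _.
by rewrite ler_wpM2r ?sqr_ge0// ler_wpM2l ?spow_base_le//; lra.
Qed.

Lemma integral_spow P (a b : R) : 2 <= P -> a < b ->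
  \int[lebesgue_measure]_(x in `[a, b]) spow P x
    = `|b| `^ P / P - `|a| `^ P / P.
Proof.
move=> P2 ab; have cs x := @continuous_spow P x P2.
have d x := is_derive_power x P2.
have cg x : {for x, continuous (fun t : R => `|t| `^ P / P)}.
  by apply/differentiable_continuous/derivable1_diffP; case: (d x).
have := @continuous_FTC2 R (spow P) (fun t => `|t| `^ P / P) a b ab.
rewrite /Rintegral => ->//.
- exact/continuous_subspaceT.
- split.
  + by move=> x _; case: (d x).
  + by apply: cvg_at_right_filter; exact: cg.
  + by apply: cvg_at_left_filter; exact: cg.
by move=> x _; rewrite derive1E; case: (d x).
Qed.

Lemma integrable_spow P (a b : R) : 2 <= P ->
  lebesgue_measure.-integrable `[a, b] (EFin \o spow P).
Proof.
move=> P2; apply: continuous_compact_integrable; first exact: segment_compact.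
by apply: continuous_subspaceT => x; exact: continuous_spow.
Qed.

End signed_power_calculus.

Section nonlinearity.
Context {R : realType} {N : nat}.
Local Notation RN := 'rV[R]_N.
Local Notation leb := (lebesgue_rV N : {sigma_finite_measure set RN -> \bar R}).
Context (Omega : set RN) (Oopen : open Omega) (r : R) (r2 : 2 < r)
  (f F : RN -> R -> R) (delta : R).
Context (f_diff : forall z : RN * R^o, (Omega `*` [set: R^o]) z ->
    differentiable (fun z : RN * R^o => f z.1 z.2 : R^o) z)
  (FE : forall x t, Omega x -> F x t = oriented_integral 0 t (f x))
  (f0 : forall x, Omega x -> f x 0 = 0)
  (f_hom : forall x t sigma, Omega x -> 0 < t ->
    f x (t * sigma) = t `^ (r - 1) * f x sigma)
  (F_hom : forall x t sigma, Omega x -> 0 < t ->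
    F x (t * sigma) = t `^ r * F x sigma)
  (df_le : forall x sigma, Omega x ->
      `|derive1 (f x) sigma| <= delta * `|sigma| `^ (r - 2))
  (f_vanish : forall e : R, 0 < e -> exists M : R,
    {ae lebesgue_rV N, forall x, Omega x -> forall sigma, M < sigma ->
      `|f x sigma / sigma `^ (r - 1)| < e}).

Let r0 : 0 < r. Proof. by apply: lt_trans r2. Qed.
Let r1 : 1 < r. Proof. by apply: lt_trans r2; rewrite ltr1n. Qed.
Let r10 : r - 1 != 0. Proof. by rewrite gt_eqF// subr_gt0. Qed.

Lemma nonlinearityE x t : Omega x ->
  f x t = npart (- t) `^ (r - 1) * f x 1 + npart t `^ (r - 1) * f x (- 1).
Proof.
move=> Ox; have [t0|t0|->] := ltgtP t 0.
- have nt0 : 0 < - t by rewrite oppr_gt0.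
  rewrite (ger0_npart (ltW nt0)) powR0// mul0r add0r ler0_npart ?ltW//.
  by rewrite -f_hom// mulrN1 opprK.
- have nt0 : - t <= 0 by rewrite oppr_le0 ltW.
  rewrite (ger0_npart (ltW t0)) powR0// mul0r addr0 ler0_npart// opprK.
  by rewrite -f_hom// mulr1.
by rewrite oppr0 ger0_npart// powR0// !mul0r addr0 f0.
Qed.

Lemma potentialE x t : Omega x ->
  F x t = npart (- t) `^ r * F x 1 + npart t `^ r * F x (- 1).
Proof.
move=> Ox; have rn0 : r != 0 by rewrite gt_eqF.
have [t0|t0|->] := ltgtP t 0.
- have nt0 : 0 < - t by rewrite oppr_gt0.
  rewrite (ger0_npart (ltW nt0)) powR0// mul0r add0r ler0_npart ?ltW//.
  by rewrite -F_hom// mulrN1 opprK.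
- have nt0 : - t <= 0 by rewrite oppr_le0 ltW.
  rewrite (ger0_npart (ltW t0)) powR0// mul0r addr0 ler0_npart// opprK.
  by rewrite -F_hom// mulr1.
rewrite oppr0 ger0_npart// powR0// !mul0r addr0.
have := F_hom 0 Ox (ltr0Sn R 1); rewrite mulr0 => /eqP.
rewrite -subr_eq0 -{1}[F x 0]mul1r -mulrBl mulf_eq0 => /orP[|/eqP//].
rewrite subr_eq0 => /eqP h; exfalso.
have := @gt0_ltr_powR R r r0 1 2; rewrite powR1 -h ltxx => /(_ _ _ _)/negP.
by rewrite nnegrE ler01 nnegrE ler0n ltr1n; case => //.
Qed.

Lemma potential_one x : Omega x -> F x 1 = f x 1 / r.
Proof.
move=> Ox; rewrite FE// /oriented_integral ler01.
have r2' := ltW r2.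
transitivity (\int[lebesgue_measure]_(t in `[0, 1]) (f x 1 * spow r t)).
  apply: eq_Rintegral => t /set_mem; rewrite /= in_itv/= => /andP[t0 t1].
  rewrite (nonlinearityE _ Ox) (ger0_npart t0) powR0// mul0r addr0.
  by rewrite ler0_npart ?oppr_le0// opprK mulrC spow_ge0E.
rewrite RintegralZl//; last exact: integrable_spow.
by rewrite integral_spow// normr1 powR1 normr0 powR0 ?gt_eqF// mul0r subr0 mul1r.
Qed.

Lemma potential_minus_one x : Omega x -> F x (- 1) = - (f x (- 1) / r).
Proof.
move=> Ox; rewrite FE// /oriented_integral ler0N1; congr (- _).
have r2' := ltW r2.
transitivity (\int[lebesgue_measure]_(t in `[-1, 0]) (- f x (- 1) * spow r t)).
  apply: eq_Rintegral => t /set_mem; rewrite /= in_itv/= => /andP[t1 t0].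
  have nt0 : 0 <= - t by rewrite oppr_ge0.
  rewrite (nonlinearityE _ Ox) (ger0_npart nt0) powR0// mul0r add0r.
  by rewrite ler0_npart// -spow_ge0E// spowN !mulNr mulrC.
rewrite RintegralZl//; last exact: integrable_spow.
rewrite integral_spow//.
by rewrite normrN normr1 powR1 normr0 powR0 ?gt_eqF// mul0r sub0r mul1r mulrN mulNr opprK.
Qed.

(** Continuity in the first variable makes the traces measurable. *)
Lemma measurable_trace (t : R) : measurable_fun Omega (fun x => f x t).
Proof.
apply: continuous_rV_measurable => // x Ox.
have /differentiable_continuous c := f_diff (z := (x, t)) (conj Ox I).
apply: (@continuous_comp _ _ _ (fun y : RN => (y, t : R^o))
  (fun z : RN * R^o => f z.1 z.2 : R^o) x); last exact: c.
exact: (@cvg_pair _ _ _ (nbhs x) (nbhs x) (nbhs (t : R^o)) _ _ _ id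
  (fun=> t : R^o) cvg_id (cvg_cst _)).
Qed.

Lemma measurable_superposition (e : R) (c d g : RN -> R) :
  measurable_fun Omega c -> measurable_fun Omega d -> measurable_fun Omega g ->
  measurable_fun Omega (fun x => npart (- g x) `^ e * c x + npart (g x) `^ e * d x).
Proof.
move=> mc md mg.
have mng : measurable_fun Omega (fun x => - g x) by exact: measurableT_comp.
have mp (k : RN -> R) : measurable_fun Omega k ->
    measurable_fun Omega (fun x => npart (k x) `^ e).
  move=> mk; apply: measurable_powR_fun => //; apply: measurable_maxr => //.
  exact: measurableT_comp.
by apply: measurable_funD; apply: measurable_funM => //; exact: mp.
Qed.

Lemma measurable_nonlinearity (g : RN -> R) : measurable_fun Omega g ->
  measurable_fun Omega (fun x => f x (g x)).
Proof.
move=> mg; have m := measurable_superposition (r - 1) (measurable_trace 1)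
  (measurable_trace (- 1)) mg.
apply: (eq_measurable_fun _ _ m) => x /set_mem Ox.
by rewrite [RHS](nonlinearityE _ Ox).
Qed.

Lemma measurable_potential_comp (g : RN -> R) : measurable_fun Omega g ->
  measurable_fun Omega (fun x => F x (g x)).
Proof.
move=> mg.
have m1 : measurable_fun Omega (fun x => f x 1 / r).
  by apply: measurable_funM => //; exact: measurable_trace.
have m2 : measurable_fun Omega (fun x => - (f x (- 1) / r)).
  apply: measurableT_comp => //; apply: measurable_funM => //.
  exact: measurable_trace.
have m := measurable_superposition r m1 m2 mg.
apply: (eq_measurable_fun _ _ m) => x /set_mem Ox.
by rewrite [RHS](potentialE _ Ox) potential_one// potential_minus_one.
Qed.

Lemma derivable_section x t : Omega x -> derivable (f x : R -> R) t 1.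
Proof.
move=> Ox; apply/derivable1_diffP.
have d := f_diff (z := (x, t)) (conj Ox I).
apply: (@differentiable_comp R _ _ _ (fun t : R^o => (x, t) : RN * R^o)
  (fun z : RN * R^o => f z.1 z.2 : R^o) t); last exact: d.
by apply: differentiable_pair => //.
Qed.

Lemma trace_le x (t : R) : Omega x -> `|t| <= 1 -> 0 <= delta ->
  `|f x t| <= delta.
Proof.
move=> Ox t1 d0.
have step (a b : R) : -1 <= a -> a <= b -> b <= 1 ->
    `|f x b - f x a| <= delta * (b - a).
  move=> a1 ab b1.
  have dv t' : is_derive (t' : R) 1 (f x : R -> R) (derive1 (f x) t').
    by apply: DeriveDef; [exact: derivable_section|rewrite derive1E].
  have ct : {within `[a, b], continuous (f x : R -> R)}.
    apply: continuous_subspaceT => t'.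
    exact/differentiable_continuous/derivable1_diffP/derivable_section.
  have [c] := MVT_segment ab (fun t' _ => dv t') ct.
  rewrite in_itv/= => /andP[ac cb] ->.
  have c1 : `|c| <= 1 by rewrite ler_norml (le_trans a1 ac) (le_trans cb b1).
  have ba : 0 <= b - a by rewrite subr_ge0.
  rewrite normrM (ger0_norm ba) ler_wpM2r//.
  apply: le_trans (df_le _ Ox) _; rewrite ler_piMr//.
  apply: unit_powR_le1; first by rewrite normr_ge0.
  by rewrite subr_ge0 ltW.
move: t1; rewrite ler_norml => /andP[tm tM].
have [t0|/ltW t0] := leP 0 t.
  have := step 0 t (lerN10 R) t0 tM; rewrite (f0 Ox) !subr0 => /le_trans; apply.
  by rewrite ler_piMr.
have := step t 0 tm t0 ler01; rewrite (f0 Ox) !sub0r normrN => /le_trans; apply.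
by rewrite ler_piMr// lerNl.
Qed.

(** The decay at infinity and the homogeneity force the nonlinearity to vanish on
    the positive half line, for almost every point. *)
Lemma trace_one_ae : {ae leb, forall x, Omega x -> f x 1 = 0}.
Proof.
have : {ae leb, forall x, forall k : nat, Omega x -> `|f x 1| < k.+1%:R^-1}.
  apply: ae_foralln => k.
  have k0 : 0 < k.+1%:R^-1 :> R by rewrite invr_gt0.
  have [M Mae] := f_vanish k0; apply: filterS Mae => x h Ox.
  pose t : R := Num.max M 0 + 1.
  have t0 : 0 < t by rewrite ltr_wpDl// le_max lexx orbT.
  have Mt : M < t by apply: (@le_lt_trans _ _ (Num.max M 0)); rewrite ?le_max ?lexx// ltrDl.
  have := h Ox t Mt; rewrite -{1}(mulr1 t) f_hom// mulrAC divff ?mul1r//.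
  by rewrite gt_eqF// powR_gt0.
apply: filterS => x h Ox; apply/eqP; rewrite -normr_eq0 eq_le normr_ge0 andbT.
rewrite leNgt; apply/negP => fx0; have [k kf] := natSinv_lt fx0.
by have := h k Ox; rewrite ltNge (ltW kf).
Qed.

Lemma nonlinearity_ae : {ae leb, forall x, Omega x ->
  forall t, f x t = f x (- 1) * npart t `^ (r - 1)}.
Proof.
apply: filterS trace_one_ae => x h Ox t.
by rewrite (nonlinearityE _ Ox) h// mulr0 add0r mulrC.
Qed.

Lemma potential_ae : {ae leb, forall x, Omega x ->
  forall t, F x t = - (f x (- 1) * (npart t `^ r / r))}.
Proof.
apply: filterS trace_one_ae => x h Ox t.
rewrite (potentialE _ Ox) potential_one// potential_minus_one// h//.
by rewrite mul0r mulr0 add0r; ring.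
Qed.

End nonlinearity.

(** * Bounded domains *)

Section bounded_domain.
Context {R : realType} {N : nat}.
Local Notation RN := 'rV[R]_N.
Implicit Types (K : set RN) (g : RN -> R) (p s : RN -> RN -> R).

Lemma bounded_closure K : bounded_set K -> bounded_set (closure K).
Proof.
move=> [M [Mr KM]]; exists M; split=> // e Me x Kx.
have cl : closed [set y : RN | `|y| <= e].
  apply: (@preimage_closed _ _ (fun y : RN => `|y|) [set t : R | t <= e]).
    by move=> y _; exact: norm_continuous.
  exact: closed_le.
have := closure_id [set y : RN | `|y| <= e]; move=> /iffLR/(_ cl) clE.
have : closure [set y : RN | `|y| <= e] x.
  by apply: (closure_subset _ Kx) => y Ky; exact: KM.
by rewrite -clE.
Qed.

Lemma compact_closure K : bounded_set K -> compact (closure K).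
Proof.
by move=> bK; apply: bounded_closed_compact; [exact: bounded_closure|exact: closed_closure].
Qed.

Lemma bounded_located (Omega : set RN) : (0 < N)%N -> open Omega ->
  bounded_set Omega -> exists B : R, located Omega B.
Proof.
move=> N0 oO [M [_ OM]]; exists (`|M| + 1); split=> //.
  exact: open_rV_measurable.
move=> x i Ox; have Mlt : M < `|M| + 1 by rewrite (le_lt_trans (ler_norm _))// ltrDl.
apply: le_trans (OM _ Mlt x Ox); rewrite [leRHS]mx_normrE.
exact: (le_trans _ (le_bigmax _ _ (ord0, i))).
Qed.

Lemma inf_sup_image K g : compact K -> {within K, continuous g} ->
  forall x, K x -> inf (g @` K) <= g x <= sup (g @` K).
Proof.
move=> cK cg x Kx.
have /compact_bounded[M [_ Mb]] : compact (g @` K) by exact: continuous_compact.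
have Mlt : M < `|M| + 1 by rewrite (le_lt_trans (ler_norm _))// ltrDl.
have b y : K y -> `|g y| <= `|M| + 1 by move=> Ky; apply: (Mb _ Mlt); exists y.
apply/andP; split.
  apply: ge_inf; last by exists x.
  exists (- (`|M| + 1)) => _ [y Ky <-].
  by have := b y Ky; rewrite ler_norml => /andP[].
apply: ub_le_sup; last by exists x.
exists (`|M| + 1) => _ [y Ky <-].
by have := b y Ky; rewrite ler_norml => /andP[].
Qed.

Lemma within_continuous_measurable (Omega : set RN) g : open Omega ->
  {within closure Omega, continuous g} -> measurable_fun Omega g.
Proof.
move=> oO cg; apply: continuous_rV_measurable => // x Ox.
have : {within Omega, continuous g}.
  by apply: continuous_subspaceW cg; exact: subset_closure.
by rewrite continuous_open_subspace// => /(_ x); rewrite inE; exact.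
Qed.

(** A positive continuous function on the diagonal of a compact set stays
    nonnegative in a uniform neighbourhood of the diagonal. *)
Lemma uniform_near_diag K (g : RN * RN -> R) : compact K -> continuous g ->
  (forall x, K x -> 0 < g (x, x)) ->
  exists2 eta : R, 0 < eta & forall x y, K x -> cube x eta y -> 0 <= g (x, y).
Proof.
move=> cK cg g0; have /compact_near_coveringP ncK := cK.
have := ncK R (0^'+ : set_system R) (fun eta x => forall y, cube x eta y -> 0 <= g (x, y)).
move=> /(_ _) nc.
have : \forall eta \near (0 : R)^'+, K `<=` (fun x => forall y, cube x eta y -> 0 <= g (x, y)).
  apply: nc => x Kx.
  have : \forall z \near (x, x), 0 < g z.
    have := cg (x, x); move=> /cvgrPdist_lt /(_ _ (g0 x Kx)).
    apply: filterS => z; rewrite ltr_distlC => /andP[h _].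
    by move: h; rewrite subrr.
  move=> [[A1 A2] /= [/nbhs_ballP[e1 /= e10 A1e] /nbhs_ballP[e2 /= e20 A2e]] A12].
  pose e := Num.min e1 e2.
  have e0 : 0 < e by rewrite lt_min e10.
  exists (ball x (e / 2), [set eta : R | eta < e / 2]) => /=.
    split; first exact: nbhsx_ballx (divr_gt0 e0 (ltr0Sn R 1)).
    by apply: nbhs_right_lt; exact: divr_gt0.
  move=> [x' eta] /= [xx' eta_e] y xy; apply/ltW/(A12 (x', y)); split => /=.
    apply: A1e; apply: (le_ball _ xx'); apply: (@le_trans _ _ e).
      by rewrite ler_pdivrMr// ler_peMr ?ler1n// ltW.
    by rewrite ge_min lexx.
  apply: A2e; apply: (@le_ball _ _ x e); first by rewrite ge_min lexx orbT.
  split=> // i j; have := xx'.2 i j; rewrite -!ball_normE /ball_ /= !ord1 => h.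
  have := ler_distD (x' ord0 j) (x ord0 j) (y ord0 j); have := xy j.
  move: h; move: (`|_|) (`|_|) (`|_|) => a b c; lra.
move=> near0.
have [eta [h eta0]] := @filter_ex _ (0 : R)^'+ _ _
  (filterI near0 (nbhs_right_gt (0 : R))).
by exists eta => // x y Kx; exact: h.
Qed.

End bounded_domain.

(** * Two solutions on the Nehari manifold *)

Theorem theorem1p1 (R : realType) (N : nat) (hN : (2 <= N)%N)
  (Omega : set 'rV[R]_N) (hOmega : smooth_bounded_domain Omega)
  (p s : 'rV[R]_N -> 'rV[R]_N -> R) (alpha q : 'rV[R]_N -> R) (r : R)
  (p_cont : continuous (fun z : 'rV[R]_N * 'rV[R]_N => p z.1 z.2))
  (s_cont : continuous (fun z : 'rV[R]_N * 'rV[R]_N => s z.1 z.2))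
  (p_sym : forall x y, p x y = p y x)
  (s_sym : forall x y, s x y = s y x)
  (p_ext : forall x y,
    inf2 (closure Omega) p <= p x y <= sup2 (closure Omega) p)
  (s_ext : forall x y,
    inf2 (closure Omega) s <= s x y <= sup2 (closure Omega) s)
  (s_gt0 : 0 < inf2 (closure Omega) s)
  (s_lt1 : sup2 (closure Omega) s < 1)
  (sp_ltN : forall x y, closure Omega x -> closure Omega y ->
    s x y * p x y < N%:R)
  (alpha_cont : {within closure Omega, continuous alpha})
  (q_cont : {within closure Omega, continuous q})
  (pq : forall x, closure Omega x -> p x x <= q x < crit_exp p s x)
  (alpha_gt2 : 2 < inf (alpha @` closure Omega))
  (alpha_p : sup (alpha @` closure Omega) < inf2 (closure Omega) p)
  (p_q : sup2 (closure Omega) p < sup (q @` closure Omega))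
  (q_r : sup (q @` closure Omega) < r)
  (r_r2 : r < r ^+ 2)
  (r2_crit : forall x, closure Omega x -> r ^+ 2 < crit_exp p s x)
  (alpha_pdiag : forall x, closure Omega x -> alpha x <= p x x) :
  exists2 delta0 : R, 0 < delta0 &
  forall (f F : 'rV[R]_N -> R -> R),
  Ck_on (Omega `*` [set: R^o]) 1 (fun z : 'rV[R]_N * R^o => f z.1 z.2) ->
  (forall x t, Omega x -> F x t = oriented_integral 0 t (f x)) ->
  (forall x, Omega x -> f x 0 = 0) ->
  (forall x t sigma, Omega x -> 0 < t ->
    f x (t * sigma) = t `^ (r - 1) * f x sigma) ->
  (forall x t sigma, closure Omega x -> 0 < t ->
    F x (t * sigma) = t `^ r * F x sigma) ->
  (exists2 delta : R, 0 < delta <= delta0 &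
    forall x sigma, Omega x ->
      `|derive1 (f x) sigma| <= delta * `|sigma| `^ (r - 2)) ->
  (forall e : R, 0 < e -> exists M : R,
    {ae lebesgue_rV N, forall x, Omega x -> forall sigma, M < sigma ->
      `|f x sigma / sigma `^ (r - 1)| < e}) ->
  exists lambda_star beta_star : R,
  [/\ 0 < lambda_star, 0 < beta_star &
  forall lambda beta : R,
  0 < lambda < lambda_star -> 0 < beta < beta_star ->
  exists u1 u2 : 'rV[R]_N -> R,
  [/\ ~ {ae lebesgue_rV N, forall x, u1 x = u2 x} &
      forall u, u = u1 \/ u = u2 ->
        [/\ weak_solution Omega p s q alpha f lambda beta u,
            ~ {ae lebesgue_rV N, forall x, u x = 0},
            nehari Omega p s q alpha F lambda beta u &
            in_Linfty Omega u]]].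
Proof.
have [Ono Oop _ Obd _] := hOmega.
have N0 : (0 < N)%N by exact: leq_trans hN.
have [B OB] := bounded_located N0 Oop Obd.
have mO : measurable Omega := mOmega OB.
have Ooo := Omega_fin OB.
have Kc : compact (closure Omega) := compact_closure Obd.
have OK x : Omega x -> closure Omega x by exact: subset_closure.
have [x0 Ox0] := Ono; have Kx0 := OK x0 Ox0.
set pm := inf2 (closure Omega) p in p_ext alpha_p *.
set pM := sup2 (closure Omega) p in p_ext p_q *.
set sm := inf2 (closure Omega) s in s_ext s_gt0 *.
set sM := sup2 (closure Omega) s in s_ext s_lt1 *.
set am := inf (alpha @` closure Omega) in alpha_gt2 *.
set aM := sup (alpha @` closure Omega) in alpha_p *.
have alphaK := inf_sup_image Kc alpha_cont.
have amM : am <= aM by have /andP[h1 h2] := alphaK x0 Kx0; exact: le_trans h2.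
have pm2 : 2 < pm by apply: lt_trans alpha_p; exact: lt_le_trans amM.
have pmM : pm <= pM by have /andP[h1 h2] := p_ext x0 x0; exact: le_trans h2.
have pMr : pM < r by exact: lt_trans q_r.
have r2 : 2 < r by apply: lt_trans pMr; exact: lt_le_trans pmM.
have r0 : 0 <= r by apply: ltW; exact: lt_trans r2.
have H : admissible p s pm pM.
  split=> //; try by move=> x y; have /andP[] := p_ext x y.
  - exact: continuous_rV2_measurable.
  - exact: continuous_rV2_measurable.
  - by move=> x y; have /andP[h _] := s_ext x y; exact/(le_trans (ltW s_gt0)).
  - by move=> x y; have /andP[_ h] := s_ext x y; exact/(le_trans h)/ltW.
have Nr0 : 0 < N%:R :> R by rewrite ltr0n.
(* The strict subcriticality on the diagonal persists near it. *)
have [eta eta0 subcrit] : exists2 eta : R, 0 < eta & forall x y,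
    closure Omega x -> cube x eta y ->
    0 <= p x y + r ^+ 2 * (s x y * p x y / N%:R) - r ^+ 2.
  apply: (@uniform_near_diag _ _ _ (fun z => p z.1 z.2
    + r ^+ 2 * (s z.1 z.2 * p z.1 z.2 / N%:R) - r ^+ 2) Kc).
    move=> z; apply: cvgB; last exact: cvg_cst.
    apply: cvgD; first exact: p_cont.
    apply: cvgMr; apply: cvgMl; apply: cvgM; [exact: s_cont|exact: p_cont].
  move=> x Kx /=; have := r2_crit x Kx; rewrite /crit_exp.
  have d0 : 0 < N%:R - s x x * p x x by rewrite subr_gt0; exact: sp_ltN.
  rewrite ltr_pdivlMr// => h; rewrite -(pmulr_rgt0 _ Nr0).
  have -> : N%:R * (p x x + r ^+ 2 * (s x x * p x x / N%:R) - r ^+ 2) =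
    N%:R * p x x - r ^+ 2 * (N%:R - s x x * p x x) by field; rewrite gt_eqF.
  by rewrite subr_gt0.
have pm_r2 : pm <= r ^+ 2 by apply: ltW; apply: (le_lt_trans pmM); exact: lt_trans r_r2.
have sub x y : Omega x -> cube x eta y ->
    r ^+ 2 <= p x y + r ^+ 2 * (s x y * p x y / N%:R).
  by move=> Ox xy; rewrite -subr_ge0; apply: subcrit => //; exact: OK.
have rr2 : r + 1 <= r ^+ 2 by rewrite expr2; nra.
have [S _ sobolev] := sobolev_bound H OB pm_r2 eta0 sub r0 rr2.
have malpha : measurable_fun Omega alpha.
  exact: within_continuous_measurable Oop alpha_cont.
have mq : measurable_fun Omega q.
  exact: within_continuous_measurable Oop q_cont.
have q0 x : Omega x -> 0 <= q x.
  move=> Ox; have /andP[h _] := pq x (OK x Ox); apply: le_trans h.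
  exact/ltW/(p_gt0 H).
have alpha2 x : Omega x -> 2 < alpha x.
  by move=> /OK/alphaK/andP[h _]; exact: lt_le_trans h.
have alphaM x : Omega x -> alpha x <= aM by move=> /OK/alphaK/andP[].
have aM2 : 2 < aM by exact: lt_le_trans amM.
have aMr : aM <= r.
  by apply: ltW; apply: (lt_trans alpha_p); exact: le_lt_trans pMr.
(* The value 1 only normalises the bound on |f x (- 1)|, which the smallness of
   lambda takes into account. *)
exists 1 => // f F fC1 FE f0 f_hom F_homK [delta /andP[delta0 delta1] df_le] f_van.
have F_hom x t sigma : Omega x -> 0 < t -> F x (t * sigma) = t `^ r * F x sigma.
  by move=> /OK; exact: F_homK.
have f_diff := fC1.1.
have f_meas := measurable_nonlinearity Oop r2 f_diff f0 f_hom.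
have F_meas := measurable_potential_comp Oop r2 f_diff FE f0 f_hom F_hom.
have f_ae := nonlinearity_ae r2 f0 f_hom f_van.
have F_ae := potential_ae r2 FE f0 f_hom F_hom f_van.
have tr_le x t : Omega x -> `|t| <= 1 -> `|f x t| <= 1.
  move=> Ox t1; apply: le_trans delta1.
  exact: (trace_le r2 f_diff f0 df_le Ox t1 (ltW delta0)).
pose h x : R := f x (- 1).
have mh : measurable_fun Omega h by exact: (measurable_trace Oop f_diff).
have h1 x : Omega x -> `|h x| <= 1 by move=> Ox; apply: tr_le; rewrite ?normrN1.
have k0 := kmax_gt0 pM OB; set kM := @kmax R N pM B in k0.
have Qb (lambda beta : R) (b : 'rV[R]_N -> R) : 0 < beta -> 0 <= lambda ->
    measurable_fun Omega b -> (forall x, Omega x -> `|b x| <= lambda) ->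
    reaction Omega pm pM alpha b am aM r beta lambda.
  move=> b0 l0 mb bl; split=> // x Ox.
  by have /andP[] := alphaK x (OK x Ox).
have D0 : 0 < @gapD R N pm pM B aM r.
  have Q : reaction Omega pm pM alpha (fun=> 0) am aM r 1 0.
    by apply: Qb => // x _; rewrite normr0.
  exact: (gapD_gt0 H OB Q).
set D := @gapD R N pm pM B aM r in D0.
(* The bound r * D serves the existence of a minimiser; halves of kM^-1 make
   beta + lambda small enough for the truncation. *)
exists (Num.min (r * D) (kM^-1 / 2)), (kM^-1 / 2).
have r0' : 0 < r by exact: lt_trans r2.
have kV0 : 0 < kM^-1 / 2 by rewrite divr_gt0 ?invr_gt0.
split=> //; first by rewrite lt_min kV0 mulr_gt0.
move=> lambda beta /andP[l0]; rewrite lt_min => /andP[lD lk] /andP[b0 bk].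
have small1 : lambda <= r * D by exact: ltW.
have small2 : beta + lambda <= kM^-1.
  by rewrite [leRHS](splitr kM^-1); apply: lerD; exact: ltW.
have lh x : Omega x -> `|- (lambda * h x)| <= lambda.
  move=> Ox; rewrite normrN normrM gtr0_norm// ler_piMr ?(ltW l0)//; exact: h1.
have Q1 : reaction Omega pm pM alpha (fun=> 0) am aM r beta lambda.
  by apply: Qb => //; [exact: ltW|move=> x _; rewrite normr0 ltW].
have Q2 : reaction Omega pm pM alpha (fun x => - (lambda * h x)) am aM r beta lambda.
  apply: Qb => //; first exact: ltW.
  by apply: measurableT_comp => //; exact: measurable_funM.
(* The positive solution ignores f, which vanishes on the positive half line;
   the negative one is minus a solution with coefficient - lambda f(x, -1). *)
have [w1 [uw1 nw1 ew1]] :=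
  reaction_solution H s_gt0 s_lt1 s_ext OB Q1 Oop Ono small1 small2.
have [w2 [uw2 nw2 ew2]] :=
  reaction_solution H s_gt0 s_lt1 s_ext OB Q2 Oop Ono small1 small2.
have l0' := ltW l0; have b0' := ltW b0.
have sol u := @euler_solution R N p s pm pM H Omega mO Ooo q alpha h f F aM r 1
  lambda beta S malpha alpha2 alphaM aM2 aMr r2 mh h1 ler01 l0' b0' f_meas F_meas
  f_ae F_ae tr_le sobolev u.
have X0u u := @bounded_in_X0 R N p s pm pM H Omega mO q u mq Ooo q0.
have r1n0 : r - 1 != 0 by rewrite gt_eqF// subr_gt0 (lt_trans _ r2)// ltr1n.
have a1 x : Omega x -> 1 < alpha x.
  by move=> /alpha2; apply: lt_trans; rewrite ltr1n.
pose u2 x := - w2 x.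
have mu1 := uc_meas uw1; have fu1 := uc_fin uw1.
have mu2 : measurable_fun setT u2.
  by apply: measurableT_comp => //; exact: uc_meas uw2.
have fu2 : (modular p s u2 < +oo)%E by rewrite modularN; exact: uc_fin uw2.
have n1 x : `|w1 x| <= 1 by rewrite ger0_norm ?(uc_ge0 uw1)// (uc_le1 uw1).
have n2 x : `|u2 x| <= 1.
  by rewrite normrN ger0_norm ?(uc_ge0 uw2)// (uc_le1 uw2).
have off2 x : ~ Omega x -> u2 x = 0.
  by move=> nO; rewrite /u2 (uc_off uw2)// oppr0.
have nu2 : ~ {ae lebesgue_rV N, forall x, u2 x = 0}.
  move=> u20; apply: nw2; apply: filterS u20 => x /eqP.
  by rewrite oppr_eq0 => /eqP.
exists w1, u2; split.
  move=> eq; apply: nw1; apply: filterS eq => x e12.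
  apply/le_anti; rewrite (uc_ge0 uw1) andbT e12 oppr_le0.
  exact: (uc_ge0 uw2).
move=> u [->|->].
- apply: (sol _ mu1 n1 fu1 (X0u _ mu1 (uc_off uw1) n1 fu1) nw1) => v vv v0.
  have [_ ->//] := ew1 v (var_meas vv) (var_fin vv) v0 (variation_sqr mO r2 vv).
  apply: eq_Rintegral => x /set_mem Ox; rewrite /react mul0r addr0.
  rewrite (ger0_npart (uc_ge0 uw1 x)) powR0// mulr0 mul0r mulr0 addr0.
  by rewrite -/(spow (alpha x) (w1 x)) (spow_ge0E (a1 x Ox) (uc_ge0 uw1 x)) mulrA.
apply: (sol _ mu2 n2 fu2 (X0u _ mu2 off2 n2 fu2) nu2) => v vv v0.
have [ir er] := ew2 v (var_meas vv) (var_fin vv) v0 (variation_sqr mO r2 vv).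
have iw := integrable_weak_lhs H (uc_meas uw2) (uc_fin uw2) (var_meas vv) (var_fin vv).
transitivity (- Rintegral (lebesgue_rV N \x lebesgue_rV N)%E setT (weak_lhs p s w2 v)).
  rewrite -mulN1r -(RintegralZl (-1) measurableT iw).
  apply: eq_Rintegral => z _; rewrite !weak_lhsE /u2 -opprD spowN.
  by rewrite !mulNr mul1r.
rewrite er.
transitivity (\int[lebesgue_rV N]_(x in Omega)
    (-1 * (react alpha (fun x => - (lambda * h x)) r beta x (w2 x) * v x))).
  by rewrite (RintegralZl (-1) mO ir) mulN1r.
apply: eq_Rintegral => x /set_mem Ox; rewrite /react /u2.
have w20 := uc_ge0 uw2 x.
rewrite ler0_npart ?oppr_le0// opprK.
rewrite -/(spow (alpha x) (- w2 x)) spowN (spow_ge0E (a1 x Ox) w20).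
by move: (w2 x `^ _) (w2 x `^ _) => t1 t2; ring.
Qed.
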